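(* Let $\Psi:[0,\infty)\to\mathbb{R}$ be measurable, let $V:\mathbb{R}^d\to\mathbb{R}$ be measurable, and consider $H=H_0+V$ on $L^2(\mathbb{R}^d)$ with $H_0=\Psi(p^2/2)$, $p=-i\nabla$. Suppose that: (H.1) $\Psi\in C^1(0,\infty)$, $\Psi\ge 0$, $\Psi'\ge 0$, and $\Psi(+0)=\Psi(0)=0$; (H.2) there exist constants $c_1,d_1\ge 0$ such that $u^{1/2}\le c_1\Psi(u)+d_1$ for all $u\ge 0$; (H.3) there exist constants $c_2,d_2\ge 0$ such that $u\Psi'(u)\le c_2\Psi(u)+d_2$ for all $u\ge 0$; (H.4) there exists a constant $\mu>0$ such that $2u\Psi'(u)\ge\mu\Psi(u)$ for all $u\ge 0$; (H.5) $\langle x\rangle V$ is $H_0$-compact. Then $\mathrm{Spec}_{\rm p}(H)\setminus\{0\}$ is discrete and the multiplicity of each eigenvalue in it is finite. The only accumulation point of $\mathrm{Spec}_{\rm p}(H)$ can be at zero.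
   Context: $\langle x\rangle=\sqrt{1+|x|^2}$. $H_0=\Psi(p^2/2)$ is the Fourier multiplier with symbol $\Psi(|\xi|^2/2)$; by (H.5), $H$ is self-adjoint on $\mathrm{Dom}(H)=\mathrm{Dom}(H_0)$. $\mathrm{Spec}_{\rm p}(H)$ denotes the pure point spectrum, i.e. the set of eigenvalues of $H$. At $u=0$, where $\Psi'$ need not be defined, $u\Psi'(u)$ is read as $0$. *)

(* Defs.v *)
From HB Require Import structures.
From mathcomp Require Import all_boot all_order all_algebra.
From mathcomp Require Import all_classical all_reals all_analysis.
From mathcomp Require Import complex.

Set Implicit Arguments.
Unset Strict Implicit.
Unset Printing Implicit Defensive.
Import Order.TTheory GRing.Theory Num.Theory.
Import numFieldNormedType.Exports.

Local Open Scope classical_set_scope.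
Local Open Scope ring_scope.
Local Open Scope complex_scope.

(* [measurableTypeR R] is [R] with its Borel sigma-algebra; the tuples carry
   the product sigma-algebra. *)
Notation Rd R d := (d.-tuple (measurableTypeR R)).

Section Lebesgue_measure_Rd.
Context {R : realType}.

Section cons.
Context (d : nat) (nu : {sigma_finite_measure set (Rd R d) -> \bar R}).

Let consp (p : measurableTypeR R * Rd R d) : Rd R d.+1 :=
  [tuple of p.1 :: p.2].

Definition cons_measure : set (Rd R d.+1) -> \bar R :=
  pushforward (lebesgue_measure \x nu)%E consp.

Let measurable_consp : measurable_fun setT consp.
Proof. exact: measurable_cons. Qed.

Let cons_measure0 : cons_measure set0 = 0%E.
Proof. by rewrite /cons_measure /pushforward preimage_set0 measure0. Qed.

Let cons_measure_ge0 A : (0 <= cons_measure A)%E.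
Proof. exact: measure_ge0. Qed.

Let cons_measure_sigma_additive : semi_sigma_additive cons_measure.
Proof.
move=> F mF tF mUF; rewrite /cons_measure /pushforward preimage_bigcup.
apply: measure_semi_sigma_additive.
- by move=> n; rewrite -[X in measurable X]setTI; exact: measurable_consp.
- apply/trivIsetP => /= i j _ _ ij; rewrite -preimage_setI.
  by move/trivIsetP : tF => /(_ _ _ _ _ ij) ->//; rewrite preimage_set0.
- by rewrite -preimage_bigcup -[X in measurable X]setTI; exact: measurable_consp.
Qed.

HB.instance Definition _ := isMeasure.Build _ _ _ cons_measure
  cons_measure0 cons_measure_ge0 cons_measure_sigma_additive.

Let cons_measure_sigma_finite : sigma_finite setT cons_measure.
Proof.
have /sigma_finiteP[F [TF ndF Foo]] := sigma_finiteT (@lebesgue_measure R).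
have /sigma_finiteP[G [TG ndG Goo]] := sigma_finiteT nu.
pose u (t : Rd R d.+1) : measurableTypeR R * Rd R d :=
  (thead t, [tuple of behead t]).
have mu : measurable_fun setT u.
  apply: measurable_fun_pair; last exact: measurable_behead.
  exact: measurable_tnth.
have uK : u \o consp = id.
  by apply/funext => -[a b] /=; congr pair; apply/val_inj.
exists (fun n => u @^-1` (F n `*` G n)).
  rewrite -preimage_bigcup; apply/esym; rewrite -subTset => t _.
  have [n _ Fn] : (\bigcup_n F n) (u t).1 by rewrite -TF.
  have [k _ Gk] : (\bigcup_n G n) (u t).2 by rewrite -TG.
  exists (maxn n k) => //; split.
  - by move: Fn; apply: (subsetPset _ _ (ndF _ _ (leq_maxl n k))).
  - by move: Gk; apply: (subsetPset _ _ (ndG _ _ (leq_maxr n k))).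
move=> n; have [mF Fn] := Foo n; have [mG Gn] := Goo n; split.
  by rewrite -[X in measurable X]setTI; apply: mu => //; exact: measurableX.
rewrite /cons_measure /pushforward -comp_preimage uK preimage_id.
by rewrite product_measure1E// lte_mul_pinfty// ge0_fin_numE.
Qed.

HB.instance Definition _ := Measure_isSigmaFinite.Build _ _ _ cons_measure
  cons_measure_sigma_finite.

End cons.

(* The [d]-fold product of Lebesgue measure on the line; see [lebesgue_Rd_box]. *)
Fixpoint lebesgue_Rd (d : nat) : {sigma_finite_measure set (Rd R d) -> \bar R} :=
  match d with
  | 0 => \d_ ([tuple] : Rd R 0)
  | n.+1 => cons_measure (lebesgue_Rd n)
  end.

End Lebesgue_measure_Rd.

Arguments lebesgue_Rd {R} d.

Lemma lebesgue_Rd_box (R : realType) d (A : 'I_d -> set (measurableTypeR R)) :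
  (forall i, measurable (A i)) ->
  lebesgue_Rd d [set x | forall i, A i (tnth x i)] =
  (\prod_(i < d) lebesgue_measure (A i))%E.
Proof.
elim: d A => [|d IH] A mA.
  rewrite big_ord0 /= diracE mem_set //; by case.
rewrite big_ord_recl /= /cons_measure /pushforward.
rewrite (_ : _ @^-1` _ = A ord0 `*` [set x | forall i, A (lift ord0 i) (tnth x i)]); last first.
  apply/seteqP; split => -[a b] /=.
    move=> h; split; first exact: (h ord0).
    by move=> i; have := h (lift ord0 i); rewrite tnthS.
  case=> h0 h i; case: (unliftP ord0 i) => [j ->|->]; last exact: h0.
  by rewrite tnthS; exact: h.
have mB : measurable [set x : Rd R d | forall i, A (lift ord0 i) (tnth x i)].
  rewrite (_ : [set x | _] = \bigcap_(i in [set: 'I_d])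
      ((fun x => tnth x i) @^-1` A (lift ord0 i))); last first.
    by apply/seteqP; split => x /= h i; [move=> _; exact: h|exact: (h i I)].
  apply: fin_bigcap_measurable => // i _; rewrite -[X in measurable X]setTI.
  exact: measurable_tnth.
by rewrite product_measure1E //=; congr (_ * _)%E; exact: IH.
Qed.

Section L2_space.
Context {R : realType} (d : nat).
Implicit Types (f g : Rd R d -> R[i]) (u v : nat -> Rd R d -> R[i]).

Local Notation mu := (lebesgue_Rd d).

Definition dotRd (x y : Rd R d) : R :=
  \sum_(i < d) (tnth x i : R) * (tnth y i : R).

Definition japanese_bracket (x : Rd R d) : R := Num.sqrt (1 + dotRd x x).

Definition cmeasurable f :=
  measurable_fun setT (fun x => complex.Re (f x)) /\
  measurable_fun setT (fun x => complex.Im (f x)).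

Definition cLnorm (p : \bar R) f : \bar R :=
  Lnorm mu p (fun x => (ComplexField.Normc.normc (f x))%:E).

(* Elements of the Lebesgue spaces are represented by functions; two functions
   represent the same element when they are equal almost everywhere. *)
Definition cLp (p : \bar R) : set (Rd R d -> R[i]) :=
  [set f | cmeasurable f /\ (cLnorm p f < +oo)%E].

Definition L2_cvg u f := cLnorm 2%:E (fun x => u n x - f x) @[n --> \oo] --> 0%E.

Definition L2_bounded u := exists M : R, forall n, (cLnorm 2%:E (u n) <= M%:E)%E.

Definition cintegral f : R[i] :=
  (\int[mu]_x complex.Re (f x)) +i* (\int[mu]_x complex.Im (f x)).

(* Unitary normalization, with kernel [exp (- i xi . x)]. *)
Definition fourier_L1 f (xi : Rd R d) : R[i] :=
  ((Num.sqrt (2 * pi)) ^- d)%:C *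
  cintegral (fun x => (cos (dotRd xi x) -i* sin (dotRd xi x)) * f x).

(* Graph of the Fourier transform on L^2, the extension by continuity of
   [fourier_L1] from the intersection of L^1 and L^2. *)
Definition fourier f g :=
  [/\ cLp 2%:E f, cLp 2%:E g &
    exists u, [/\ forall n, cLp 1%:E (u n) /\ cLp 2%:E (u n),
      L2_cvg u f & L2_cvg (fun n => fourier_L1 (u n)) g]].

(* Unbounded operators on L^2 are given by their graphs: [A f g] means that
   [f] is in the domain of [A] and [A f = g]. *)
Definition operator := (Rd R d -> R[i]) -> (Rd R d -> R[i]) -> Prop.
Implicit Types A B T : operator.

Definition dom A : set (Rd R d -> R[i]) := [set f | exists g, A f g].

Definition fourier_multiplier (m : Rd R d -> R) : operator := fun f g =>
  exists2 h, fourier f h & fourier g (fun xi => (m xi)%:C * h xi).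

Definition multiplication (W : Rd R d -> R) : operator := fun f g =>
  [/\ cLp 2%:E f, cLp 2%:E g & g = (fun x => (W x)%:C * f x) %[ae mu]].

(* Operator sum, with domain the intersection of the two domains. *)
Definition op_add A B : operator := fun f g =>
  cLp 2%:E g /\
  exists a b, [/\ A f a, B f b & g = (fun x => a x + b x) %[ae mu]].

(* [A] is [T]-compact (Kato, Perturbation Theory, IV.1.3). *)
Definition relatively_compact A T :=
  dom T `<=` dom A /\
  forall u v w, (forall n, T (u n) (v n)) -> L2_bounded u -> L2_bounded v ->
    (forall n, A (u n) (w n)) ->
    exists phi : nat -> nat, {homo phi : m n / (m < n)%N} /\
      exists2 l, cLp 2%:E l & L2_cvg (w \o phi) l.

Definition eigenspace A (lambda : R[i]) : set (Rd R d -> R[i]) :=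
  [set f | A f (fun x => lambda * f x)].

Definition point_spectrum A : set R[i] :=
  [set lambda | exists2 f, eigenspace A lambda f &
    ~ (f = (fun=> 0) %[ae mu])].

Definition finite_multiplicity A (lambda : R[i]) :=
  exists n (e : 'I_n -> Rd R d -> R[i]),
    (forall i, eigenspace A lambda (e i)) /\
    forall f, eigenspace A lambda f ->
      exists c : 'I_n -> R[i], f = (fun x => \sum_i c i * e i x) %[ae mu].

(* [Psi (p^2 / 2)] with [p = - i nabla]. *)
Definition free_hamiltonian (Psi : R -> R) : operator :=
  fourier_multiplier (fun xi => Psi (dotRd xi xi / 2)).

Definition hamiltonian (Psi : R -> R) (V : Rd R d -> R) : operator :=
  op_add (free_hamiltonian Psi) (multiplication V).

End L2_space.

(* Main.v *)
(* Let H f = l f with |f| = 1, and put h = F f, m(xi) = Psi(|xi|^2/2) and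
   W = <x> V.  In Fourier space the eigenvalue equation reads F(V f) = G with
   G = (l - m) h.  Multiplying by exp(- i e x_j) on the position side translates
   by e along xi_j on the Fourier side, so that |tau_e G - G| <= e |x_j V f|.
   Pairing G with xi_j tau_e h, subtracting the translated pairing and letting
   e -> 0 gives a virial inequality
     int xi_j^2 Psi'(|xi|^2/2) |h|^2 <= 2 |xi_j h| |x_j V f| + |V f| |h|
   without any commutator of unbounded operators.  Summing over j and using (H.4)
   on the left and (H.2) on the right, both <f, H_0 f> and |<f, V f>|, hence |l|,
   are at most C (|H_0 f| + 1) |W f|.  By (H.5), |H_0 f| stays bounded as long as
   l does.

   Along an orthonormal sequence of eigenfunctions with bounded eigenvalues,
   Bessel's inequality gives weak convergence to 0, and the compactness of W
   relative to H_0 upgrades it to |W f_n| -> 0 along a subsequence; hence no such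
   sequence has eigenvalues bounded away from 0.  A nonzero eigenvalue of infinite
   multiplicity, or a nonzero accumulation point, would provide one.

   Plancherel's identity is proved on the line by inserting the weight
   exp(- e |xi|), whose Fourier transform is the Poisson kernel, and in R^d by
   induction through partial transforms. *)
From HB Require Import structures.
Require Import Defs.
From mathcomp Require Import all_boot all_order all_algebra.
From mathcomp Require Import all_classical all_reals all_analysis.
From mathcomp Require Import measurable_realfun complex.
From mathcomp Require Import ring lra.
Import Order.TTheory GRing.Theory Num.Theory.
Import numFieldNormedType.Exports.
Local Open Scope classical_set_scope.
Local Open Scope ring_scope.
Set Implicit Arguments.
Unset Strict Implicit.
Unset Printing Implicit Defensive.

(** * Integrals and complex numbers *)

(** An eigenfunction f lies in the domain of H_0, but nothing makes x_j f square integrable, so the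
    generator of dilations cannot be applied to it. What (H.5) supplies is x_j V f, because <x> V f
    is defined on that domain; hence the Fourier transform of V f, and not h, has difference
    quotients bounded in L^2. The pairing is arranged so that l cancels and Psi enters only through
    xi_j (m(xi + e) - m(xi)) / e. (H.3) allows the limit e -> 0: a differential inequality in log u
    shows that Psi + 1 grows at most like a power, so this quotient is dominated by a multiple of m
    + 1, and m |h|^2 is integrable because h and m h are in L^2.

    The bound on |H_0 f| cannot be read off l f = H_0 f + V f, as V f is itself controlled only
    relative to H_0. It is obtained by contradiction: if |H_0 f_n| tends to infinity, then f_n /
    |H_0 f_n| tends to 0 in norm while its image under H_0 stays bounded, so compactness makes V f_n
    / |H_0 f_n| tend to 0 along a subsequence, against the equation. *)

Section integrable_toolkit.
Context {disp : measure_display} {T : measurableType disp} {R : realType}.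
Context (mu : {measure set T -> \bar R}).
Implicit Types f g : T -> R.

Local Notation integ f := (mu.-integrable setT (EFin \o f)).

Lemma integrable_mfun f : integ f -> measurable_fun setT f.
Proof. by move=> /integrableP[/measurable_EFinP]. Qed.

Lemma integrable_le f g : measurable_fun setT f -> integ g ->
  (forall x, `|f x| <= g x) -> integ f.
Proof.
move=> mf ig fg; apply: le_integrable ig => //.
  exact/measurable_EFinP.
by move=> x _ /=; rewrite lee_fin (le_trans (fg x))// ler_norm.
Qed.

Lemma integrable_RD f g : integ f -> integ g -> integ (fun x => f x + g x).
Proof. by move=> hf hg; rewrite /comp; under eq_fun do rewrite EFinD; exact: integrableD. Qed.

Lemma integrable_RZ c f : integ f -> integ (fun x => c * f x).
Proof. by move=> hf; rewrite /comp; under eq_fun do rewrite EFinM; exact: integrableZl. Qed.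

Lemma ge0_integrable_Rlty f : measurable_fun setT f -> (forall x, 0 <= f x) ->
  (\int[mu]_x (f x)%:E < +oo)%E -> integ f.
Proof.
move=> mf f0 fo; apply/integrableP; split; first exact/measurable_EFinP.
by under eq_integral => x _ do rewrite /= ger0_norm//.
Qed.

Lemma integrable_Rlty f : integ f -> (forall x, 0 <= f x) ->
  (\int[mu]_x (f x)%:E < +oo)%E.
Proof.
by move=> /integrableP[_] + f0; under eq_integral => x _ do rewrite /= ger0_norm//.
Qed.

Lemma EFin_Rintegral f : integ f -> (\int[mu]_x f x)%:E = (\int[mu]_x (f x)%:E)%E.
Proof. by move=> hf; rewrite /Rintegral fineK//; exact: integrable_fin_num. Qed.

Lemma Rdominated_cvg (f_ : nat -> T -> R) f g :
  (forall n, measurable_fun setT (f_ n)) -> measurable_fun setT f ->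
  {ae mu, forall x, f_ ^~ x @ \oo --> f x} ->
  integ g -> (forall n x, `|f_ n x| <= g x) ->
  \int[mu]_x f_ n x @[n --> \oo] --> \int[mu]_x f x.
Proof.
move=> mf_ mf f_f ig fg.
have [] := @dominated_convergence _ _ _ mu setT measurableT
  (fun n => EFin \o f_ n) (EFin \o f) (EFin \o g).
- by move=> n; exact/measurable_EFinP.
- exact/measurable_EFinP.
- by apply: filterS f_f => x h _; apply/cvg_EFin; [near=> n|exact: h].
- exact: ig.
- by apply: aeW => x n _; rewrite /= lee_fin.
move=> iF _ h; apply/fine_cvg; rewrite /= fineK; first exact: h.
exact: integrable_fin_num.
Unshelve. all: by end_near. Qed.

End integrable_toolkit.

Section complex_parts.
Context {R : realType}.
Implicit Types z w : R[i].

Lemma ReD z w : complex.Re (z + w) = complex.Re z + complex.Re w.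
Proof. by case: z; case: w. Qed.
Lemma ImD z w : complex.Im (z + w) = complex.Im z + complex.Im w.
Proof. by case: z; case: w. Qed.
Lemma ReN z : complex.Re (- z) = - complex.Re z.
Proof. by case: z. Qed.
Lemma ImN z : complex.Im (- z) = - complex.Im z.
Proof. by case: z. Qed.
Lemma ReM z w :
  complex.Re (z * w) = complex.Re z * complex.Re w - complex.Im z * complex.Im w.
Proof. by case: z; case: w. Qed.
Lemma ImM z w :
  complex.Im (z * w) = complex.Re z * complex.Im w + complex.Im z * complex.Re w.
Proof. by case: z => a b; case: w => c e /=. Qed.

Definition reim := (ReD, ImD, ReN, ImN, ReM, ImM).

(** Squared modulus, kept free of square roots so that identities reduce to [ring] on real and
    imaginary parts. *)
Definition sqc z := complex.Re z ^+ 2 + complex.Im z ^+ 2.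

(** Real part of z times the conjugate of w, the Euclidean inner product of C = R^2. *)
Definition reip z w := complex.Re z * complex.Re w + complex.Im z * complex.Im w.

Lemma sqc_ge0 z : 0 <= sqc z.
Proof. by rewrite addr_ge0// sqr_ge0. Qed.

Lemma sqcM z w : sqc (z * w) = sqc z * sqc w.
Proof. by rewrite /sqc !reim; ring. Qed.

Lemma sqc_real (a : R) : sqc a%:C%C = a ^+ 2.
Proof. by rewrite /sqc/= expr0n/= addr0. Qed.

Lemma sqc_eq0 z : sqc z = 0 -> z = 0.
Proof.
case: z => a b; rewrite /sqc/= => /eqP.
by rewrite paddr_eq0 ?sqr_ge0// !sqrf_eq0 => /andP[/eqP-> /eqP->].
Qed.

Lemma normc_sqr z : ComplexField.Normc.normc z ^+ 2 = sqc z.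
Proof. by case: z => a b; rewrite /= sqr_sqrtr// addr_ge0// sqr_ge0. Qed.

Lemma normc_ge0' z : 0 <= ComplexField.Normc.normc z.
Proof. by case: z => a b; rewrite /= sqrtr_ge0. Qed.

Lemma reip_bound z w : `|reip z w| <= (sqc z + sqc w) / 2.
Proof.
rewrite /reip /sqc; case: z => a b; case: w => c e /=.
have := (sqr_ge0 (a - c), sqr_ge0 (a + c), sqr_ge0 (b - e), sqr_ge0 (b + e)).
by rewrite ler_norml !expr2 => -[[[]]] ? ? ? ?; apply/andP; split; lra.
Qed.

End complex_parts.

(** * The Hilbert space L^2 *)

Section L2_theory.
Context {R : realType} (d : nat).
Implicit Types (f g k : Rd R d -> R[i]).

Local Notation mu := (@lebesgue_Rd R d).
Local Notation integ f := (mu.-integrable setT (EFin \o f)).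
Local Notation L2 := (cLp 2%:E).

Definition csq f : \bar R := (\int[mu]_x (sqc (f x))%:E)%E.

(** [fine] sends an infinite integral to 0, so this is the L^2 norm only for members of [cLp 2];
    hence the membership hypotheses below. *)
Definition N2 f : R := Num.sqrt (fine (csq f)).

(* The inner product of L^2 as a real Hilbert space: this is enough for Bessel's
   inequality, and for bounding the number of independent eigenfunctions. *)
Definition rip f g : R := \int[mu]_x reip (f x) (g x).

Lemma csq_ge0 f : (0 <= csq f)%E.
Proof. by apply: integral_ge0 => x _; rewrite lee_fin sqc_ge0. Qed.

Lemma measurable_sqc f : cmeasurable f -> measurable_fun setT (fun x => sqc (f x)).
Proof.
by move=> [? ?]; apply: measurable_funD; exact: measurable_funX.
Qed.

Lemma measurable_reip f g : cmeasurable f -> cmeasurable g ->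
  measurable_fun setT (fun x => reip (f x) (g x)).
Proof.
by move=> [? ?] [? ?]; apply: measurable_funD; exact: measurable_funM.
Qed.

Lemma cLnorm2E f : cLnorm 2%:E f = (csq f `^ 2^-1)%E.
Proof.
rewrite /cLnorm unlock /csq; congr (_ `^ _)%E; apply: eq_integral => x _ /=.
by rewrite -normc_sqr ger0_norm ?normc_ge0' ?powR_mulrn ?normc_ge0'.
Qed.

Lemma cLnorm2_fin f : (csq f < +oo)%E -> cLnorm 2%:E f = (N2 f)%:E.
Proof.
move=> fo; rewrite cLnorm2E /N2 -[in LHS](@fineK _ (csq f)) ?ge0_fin_numE ?csq_ge0//.
by rewrite poweR_EFin powR12_sqrt// fine_ge0// csq_ge0.
Qed.

Lemma L2P f : L2 f <-> cmeasurable f /\ (csq f < +oo)%E.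
Proof.
split=> -[mf h]; split=> //; last by rewrite /mkset cLnorm2_fin// ltry.
by move: h; rewrite cLnorm2E => /lty_poweRy; apply; rewrite invr_neq0.
Qed.

Lemma L2_meas f : L2 f -> cmeasurable f.
Proof. by case. Qed.

Lemma L2_lty f : L2 f -> (csq f < +oo)%E.
Proof. by case/L2P. Qed.

Lemma cLnorm2_L2 f : L2 f -> cLnorm 2%:E f = (N2 f)%:E.
Proof. by move=> /L2_lty; exact: cLnorm2_fin. Qed.

Lemma N2_ge0 f : 0 <= N2 f.
Proof. exact: sqrtr_ge0. Qed.

Lemma csqE f : L2 f -> csq f = (N2 f ^+ 2)%:E.
Proof.
move=> /L2_lty fo; rewrite /N2 sqr_sqrtr ?fine_ge0 ?csq_ge0// fineK//.
by rewrite ge0_fin_numE// csq_ge0.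
Qed.

Lemma L2_sqc_integ f : L2 f -> integ (fun x => sqc (f x)).
Proof.
move=> /L2P[mf fo]; apply: ge0_integrable_Rlty fo; first exact: measurable_sqc.
by move=> x; exact: sqc_ge0.
Qed.

Lemma reip_integ f g : L2 f -> L2 g -> integ (fun x => reip (f x) (g x)).
Proof.
move=> Lf Lg; apply: (@integrable_le _ _ _ _ _ (fun x => 2^-1 * (sqc (f x) + sqc (g x)))).
- by apply: measurable_reip; exact: L2_meas.
- by apply: integrable_RZ; apply: integrable_RD; exact: L2_sqc_integ.
- by move=> x; rewrite mulrC reip_bound.
Qed.

Lemma sqc_reip (z : R[i]) : reip z z = sqc z.
Proof. by rewrite /reip /sqc !expr2. Qed.

Lemma rip_id f : L2 f -> rip f f = N2 f ^+ 2.
Proof.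
move=> Lf; rewrite /rip /Rintegral; apply: EFin_inj; rewrite -csqE//.
rewrite fineK; last by apply: integrable_fin_num => //; exact: reip_integ.
by apply: eq_integral => x _; rewrite sqc_reip.
Qed.

Lemma ripC f g : rip f g = rip g f.
Proof. by apply: eq_Rintegral => x _; rewrite /reip mulrC [X in _ + X]mulrC. Qed.

Lemma L2_dom f g (C : R) : cmeasurable g -> L2 f ->
  {ae mu, forall x, sqc (g x) <= C ^+ 2 * sqc (f x)} -> L2 g.
Proof.
move=> mg Lf gf; apply/L2P; split => //.
have mf := L2_meas Lf.
apply: (@le_lt_trans _ _ (\int[mu]_x ((C ^+ 2 * sqc (f x))%:E))%E).
  apply: ae_ge0_le_integral => //.
  - by move=> x _; rewrite lee_fin sqc_ge0.
  - by apply/measurable_EFinP; exact: measurable_sqc.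
  - by move=> x _; rewrite lee_fin mulr_ge0 ?sqc_ge0 ?sqr_ge0.
  - by apply/measurable_EFinP; apply: measurable_funM => //; exact: measurable_sqc.
  - by apply: filterS gf => x h _; rewrite lee_fin.
apply: integrable_Rlty; last by move=> x; rewrite mulr_ge0 ?sqc_ge0 ?sqr_ge0.
by apply: integrable_RZ; exact: L2_sqc_integ.
Qed.

Lemma N2_dom f g (C : R) : 0 <= C -> cmeasurable g -> L2 f ->
  {ae mu, forall x, sqc (g x) <= C ^+ 2 * sqc (f x)} -> N2 g <= C * N2 f.
Proof.
move=> C0 mg Lf gf; have Lg := L2_dom mg Lf gf.
have mf := L2_meas Lf.
rewrite -(@ler_pXn2r _ 2)// ?nnegrE ?N2_ge0 ?mulr_ge0 ?N2_ge0//.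
rewrite exprMn -lee_fin [leRHS]EFinM -!csqE// /csq -ge0_integralZl//; last 3 first.
- by apply/measurable_EFinP; exact: measurable_sqc.
- by move=> x _; rewrite lee_fin sqc_ge0.
- by rewrite lee_fin sqr_ge0.
apply: ae_ge0_le_integral => //.
- by move=> x _; rewrite lee_fin sqc_ge0.
- by apply/measurable_EFinP; exact: measurable_sqc.
- by move=> x _; rewrite -EFinM lee_fin mulr_ge0 ?sqc_ge0 ?sqr_ge0.
- by apply/measurable_EFinP; apply: measurable_funM => //; exact: measurable_sqc.
- by apply: filterS gf => x h _; rewrite -EFinM lee_fin.
Qed.

Lemma cmeasurableD f g : cmeasurable f -> cmeasurable g ->
  cmeasurable (fun x => f x + g x).
Proof.
by move=> [? ?] [? ?]; split; under eq_fun do rewrite reim; exact: measurable_funD.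
Qed.

Lemma cmeasurableM f g : cmeasurable f -> cmeasurable g ->
  cmeasurable (fun x => f x * g x).
Proof.
move=> [? ?] [? ?]; split; under eq_fun do rewrite reim.
  by apply: measurable_funB; exact: measurable_funM.
by apply: measurable_funD; exact: measurable_funM.
Qed.

Lemma cmeasurable_cst (c : R[i]) : cmeasurable (fun _ : Rd R d => c).
Proof. by split; exact: measurable_cst. Qed.

Lemma cmeasurable_real (a : Rd R d -> R) : measurable_fun setT a ->
  cmeasurable (fun x => (a x)%:C%C).
Proof. by move=> ma; split => //=; exact: measurable_cst. Qed.

Lemma cmeasurableZ (c : R[i]) f : cmeasurable f -> cmeasurable (fun x => c * f x).
Proof. by apply: cmeasurableM; exact: cmeasurable_cst. Qed.

Lemma L2Z (c : R[i]) f : L2 f -> L2 (fun x => c * f x).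
Proof.
move=> Lf; apply: (L2_dom (C := Num.sqrt (sqc c))) (Lf) _.
  by apply: cmeasurableZ; exact: L2_meas.
by apply: aeW => x; rewrite sqcM sqr_sqrtr ?sqc_ge0.
Qed.

Lemma L2D f g : L2 f -> L2 g -> L2 (fun x => f x + g x).
Proof.
move=> Lf Lg; have mfg := cmeasurableD (L2_meas Lf) (L2_meas Lg).
apply/L2P; split; first exact: mfg.
have ifg : integ (fun x => 2 * (sqc (f x) + sqc (g x))).
  by apply: integrable_RZ; apply: integrable_RD; exact: L2_sqc_integ.
apply: integrable_Rlty; last by move=> x; exact: sqc_ge0.
apply: integrable_le ifg _; first exact: measurable_sqc.
move=> x; rewrite ger0_norm ?sqc_ge0// /sqc !reim.
have := sqr_ge0 (complex.Re (f x) - complex.Re (g x)).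
have := sqr_ge0 (complex.Im (f x) - complex.Im (g x)).
rewrite !expr2; lra.
Qed.

Lemma mulN1_fun f : (fun x => -1 * f x) = (fun x => - f x).
Proof. by apply/funext => x; rewrite mulN1r. Qed.

Lemma L2N f : L2 f -> L2 (fun x => - f x).
Proof. by move=> /(L2Z (-1)); rewrite mulN1_fun. Qed.

Lemma L2B f g : L2 f -> L2 g -> L2 (fun x => f x - g x).
Proof. by move=> Lf Lg; apply: L2D => //; exact: L2N. Qed.

Lemma L2_ae f g : cmeasurable g -> L2 f -> g = f %[ae mu] -> L2 g.
Proof.
move=> mg Lf gf; apply: (L2_dom (C := 1)) mg Lf _.
by apply: filterS gf => x /(_ Logic.I) ->; rewrite expr1n mul1r.
Qed.

Lemma ripDl f g k : L2 f -> L2 g -> L2 k ->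
  rip (fun x => f x + g x) k = rip f k + rip g k.
Proof.
move=> Lf Lg Lk; rewrite /rip -RintegralD//; [|exact: reip_integ..].
by apply: eq_Rintegral => x _; rewrite /reip !reim; ring.
Qed.

Lemma ripZl (c : R) f g : L2 f -> L2 g ->
  rip (fun x => c%:C%C * f x) g = c * rip f g.
Proof.
move=> Lf Lg; rewrite /rip -RintegralZl//; last exact: reip_integ.
by apply: eq_Rintegral => x _; rewrite /reip !reim/=; ring.
Qed.

Lemma ripDr f g k : L2 f -> L2 g -> L2 k ->
  rip k (fun x => f x + g x) = rip k f + rip k g.
Proof. by move=> Lf Lg Lk; rewrite ![rip k _]ripC ripDl. Qed.

Lemma ripZr (c : R) f g : L2 f -> L2 g ->
  rip g (fun x => c%:C%C * f x) = c * rip g f.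
Proof. by move=> Lf Lg; rewrite ![rip g _]ripC ripZl. Qed.

Lemma ripNl f g : L2 f -> L2 g -> rip (fun x => - f x) g = - rip f g.
Proof.
move=> Lf Lg; rewrite -[RHS]mulN1r -ripZl//; congr rip; apply/funext => x.
by rewrite rmorphN1 mulN1r.
Qed.

Lemma ripBl f g k : L2 f -> L2 g -> L2 k ->
  rip (fun x => f x - g x) k = rip f k - rip g k.
Proof. by move=> Lf Lg Lk; rewrite ripDl ?ripNl//; exact: L2N. Qed.

Lemma ripBr f g k : L2 f -> L2 g -> L2 k ->
  rip k (fun x => f x - g x) = rip k f - rip k g.
Proof. by move=> Lf Lg Lk; rewrite ![rip k _]ripC ripBl. Qed.

Lemma rip_ae f f' g g' : L2 f -> L2 g -> L2 f' -> L2 g' ->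
  f = f' %[ae mu] -> g = g' %[ae mu] ->
  rip f g = rip f' g'.
Proof.
move=> Lf Lg Lf' Lg' ff' gg'; congr fine.
apply: ae_eq_integral => //.
- by apply/measurable_EFinP; apply: measurable_reip; exact: L2_meas.
- by apply/measurable_EFinP; apply: measurable_reip; exact: L2_meas.
apply: filterS2 ff' gg' => x + + _.
by move=> /(_ Logic.I) -> /(_ Logic.I) ->.
Qed.

Lemma N2_ae f g : L2 f -> L2 g -> f = g %[ae mu] -> N2 f = N2 g.
Proof.
move=> Lf Lg fg; apply/eqP; rewrite -(@eqrXn2 _ 2)// ?N2_ge0//; apply/eqP.
by rewrite -!rip_id//; exact: rip_ae.
Qed.

Lemma N2Z (c : R[i]) f : L2 f -> N2 (fun x => c * f x) = Num.sqrt (sqc c) * N2 f.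
Proof.
move=> Lf; rewrite /N2 -sqrtrM ?sqc_ge0//; congr Num.sqrt.
apply: EFin_inj; have LZ := L2Z c Lf.
rewrite EFinM !fineK ?ge0_fin_numE ?csq_ge0 ?L2_lty//.
rewrite /csq -ge0_integralZl//.
- by apply: eq_integral => x _; rewrite sqcM EFinM.
- by apply/measurable_EFinP; apply: measurable_sqc; exact: L2_meas.
- by move=> x _; rewrite lee_fin sqc_ge0.
- by rewrite lee_fin sqc_ge0.
Qed.

Lemma N2N f : N2 (fun x => - f x) = N2 f.
Proof.
rewrite /N2 /csq; congr (Num.sqrt (fine _)); apply: eq_integral => x _.
by rewrite /sqc !reim !sqrrN.
Qed.

Lemma N2_sub_sym f g : N2 (fun x => f x - g x) = N2 (fun x => g x - f x).
Proof. by rewrite -N2N; congr N2; apply/funext => x; rewrite opprB. Qed.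

Lemma N2D_sqr f g : L2 f -> L2 g ->
  N2 (fun x => f x + g x) ^+ 2 = N2 f ^+ 2 + 2 * rip f g + N2 g ^+ 2.
Proof.
move=> Lf Lg; have Lfg := L2D Lf Lg.
by rewrite -!rip_id// ripDl// !ripDr// (ripC g f); ring.
Qed.

Lemma cauchy_schwarz f g : L2 f -> L2 g -> `|rip f g| <= N2 f * N2 g.
Proof.
move=> Lf Lg.
have q t : 0 <= N2 f ^+ 2 + 2 * t * rip f g + t ^+ 2 * N2 g ^+ 2.
  have Lt := L2Z t%:C%C Lg.
  rewrite (le_trans (sqr_ge0 (N2 (fun x => f x + t%:C%C * g x))))//.
  rewrite N2D_sqr// ripZr// N2Z// exprMn sqc_real (sqr_sqrtr (sqr_ge0 t)).
  by rewrite mulrA.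
rewrite -(@ler_pXn2r _ 2)// ?nnegrE ?mulr_ge0 ?N2_ge0// real_normK ?num_real// exprMn.
have [C0|C0] := eqVneq (N2 g ^+ 2) 0.
  rewrite C0 mulr0; have [->|B0] := eqVneq (rip f g) 0; first by rewrite expr0n.
  (* The polynomial is affine in t here, and this t gives it the value -1. *)
  have := q (- (N2 f ^+ 2 + 1) / (2 * rip f g)).
  rewrite C0 mulr0 addr0.
  have -> : N2 f ^+ 2 + 2 * (- (N2 f ^+ 2 + 1) / (2 * rip f g)) * rip f g = -1.
    by field.
  by rewrite ler0N1.
have Cp : 0 < N2 g ^+ 2 by rewrite lt_neqAle eq_sym C0 sqr_ge0.
(* The minimizer of the polynomial; nonnegativity of the minimum is the inequality. *)
have := q (- rip f g / N2 g ^+ 2).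
have -> : N2 f ^+ 2 + 2 * (- rip f g / N2 g ^+ 2) * rip f g +
    (- rip f g / N2 g ^+ 2) ^+ 2 * N2 g ^+ 2 = N2 f ^+ 2 - rip f g ^+ 2 / N2 g ^+ 2.
  by field; move: C0; rewrite sqrf_eq0.
by rewrite subr_ge0 ler_pdivrMr.
Qed.

Lemma N2D_le f g : L2 f -> L2 g -> N2 (fun x => f x + g x) <= N2 f + N2 g.
Proof.
move=> Lf Lg; rewrite -(@ler_pXn2r _ 2)// ?nnegrE ?addr_ge0 ?N2_ge0//.
rewrite N2D_sqr// sqrrD lerD2r lerD2l -[leRHS]mulr_natl ler_wpM2l//.
exact: le_trans (ler_norm _) (cauchy_schwarz Lf Lg).
Qed.

Lemma N2B_le f g : L2 f -> L2 g -> N2 (fun x => f x - g x) <= N2 f + N2 g.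
Proof. by move=> Lf Lg; rewrite -(N2N g) N2D_le//; exact: L2N. Qed.

Lemma N2_le_sub f g : L2 f -> L2 g -> N2 f <= N2 (fun x => f x - g x) + N2 g.
Proof.
move=> Lf Lg; have := N2D_le (L2B Lf Lg) Lg.
by under [in X in X <= _]eq_fun do rewrite subrK.
Qed.

Lemma N2_eq0 f : L2 f -> N2 f = 0 -> f = (fun=> 0) %[ae mu].
Proof.
move=> Lf Nf; have := csqE Lf; rewrite Nf expr0n/=.
have mf : measurable_fun setT (EFin \o (fun x => sqc (f x))).
  by apply/measurable_EFinP; apply: measurable_sqc; exact: L2_meas.
move=> f0; have /(ae_eq_integral_abs mu measurableT mf) : (\int[mu]_x `|(EFin \o (fun x => sqc (f x))) x| = 0)%E.
  by rewrite -[RHS]f0; apply: eq_integral => x _; rewrite /= ger0_norm ?sqc_ge0.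
by apply: filterS => x h _; apply: sqc_eq0; exact: EFin_inj (h Logic.I).
Qed.

Lemma L2_cvgP u f : (forall n, L2 (u n)) -> L2 f ->
  L2_cvg u f <-> N2 (fun x => u n x - f x) @[n --> \oo] --> 0.
Proof.
move=> Lu Lf; rewrite /L2_cvg.
have -> : (fun n => cLnorm 2%:E (fun x => u n x - f x)) =
          (fun n => (N2 (fun x => u n x - f x))%:E).
  by apply/funext => n; rewrite cLnorm2_L2//; exact: L2B.
by split=> [/fine_cvg|h] //; apply/cvg_EFin => //; exact: nearW.
Qed.

End L2_theory.

(** * Changes of variables *)

Section affine_change.
Context {R : realType}.
Local Notation leb := (@lebesgue_measure R).

Section fixed_map.
Variables (a b : R) (a0 : a != 0).

Let phi (x : measurableTypeR R) : measurableTypeR R := a * x + b.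

Let mphi : measurable_fun setT phi.
Proof. by apply: measurable_funD => //; exact: measurable_funM. Qed.

Let image : {measure set (measurableTypeR R) -> \bar R} :=
  measure_function_pushforward__canonical__measure_function_Measure leb mphi.

(** Both sides are measures, so comparison on half-open intervals is enough. For a < 0 the preimage
    is closed at the other end, which does not change its length. *)
Lemma lebesgue_measure_affine (A : set (measurableTypeR R)) : measurable A ->
  leb A = (`|a|%:E * leb (phi @^-1` A))%E.
Proof.
move=> mA; have k0 : 0 <= `|a| by [].
pose nu := mscale (NngNum k0) image.
have -> : (`|a|%:E * leb (phi @^-1` A))%E = nu A by [].
apply: lebesgue_measure_unique => // _ [[u v]] _ <-.
rewrite /= -[RHS]/(`|a|%:E * leb (phi @^-1` `]u, v]%classic))%E.
have [ap|an] := ltP 0 a.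
  have -> : phi @^-1` `]u, v]%classic = `](u - b) / a, (v - b) / a]%classic.
    apply/seteqP; split => x /=; rewrite !in_itv/= /phi.
      by rewrite ltr_pdivrMr// ler_pdivlMr// ltrBlDr lerBrDr mulrC.
    by rewrite ltr_pdivrMr// ler_pdivlMr// ltrBlDr lerBrDr mulrC.
  rewrite !lebesgue_measure_itv/= !lte_fin ltr_pM2r ?invr_gt0// ltrD2r.
  case: ifPn => uv; last by rewrite mule0.
  by rewrite -!EFinB -EFinM gtr0_norm//; congr EFin; field.
have {an} an : a < 0 by rewrite lt_neqAle a0.
have -> : phi @^-1` `]u, v]%classic = `[(v - b) / a, (u - b) / a[%classic.
  apply/seteqP; split => x /=; rewrite !in_itv/= /phi.
    by rewrite ltr_ndivlMr// ler_ndivrMr// ltrBlDr lerBrDr mulrC andbC.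
  by rewrite ltr_ndivlMr// ler_ndivrMr// ltrBlDr lerBrDr mulrC andbC.
rewrite !lebesgue_measure_itv/= !lte_fin ltr_nM2r ?invr_lt0// ltrD2r.
case: ifPn => uv; last by rewrite mule0.
by rewrite -!EFinB -EFinM ltr0_norm//; congr EFin; field.
Qed.

Lemma ge0_integral_affine (f : measurableTypeR R -> \bar R) : measurable_fun setT f ->
  (forall x, (0 <= f x)%E) ->
  (\int[leb]_x f x = `|a|%:E * \int[leb]_x f (a * x + b)%R)%E.
Proof.
move=> mf f0; have k0 : 0 <= `|a| by [].
pose nu := mscale (NngNum k0) image.
transitivity (\int[nu]_x f x)%E.
  by apply: eq_measure_integral => A mA _; exact: lebesgue_measure_affine.
rewrite ge0_integral_mscale//= ge0_integral_pushforward//=.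
Qed.

End fixed_map.

Lemma ge0_integral_translation (b : R) (f : measurableTypeR R -> \bar R) : measurable_fun setT f ->
  (forall x, (0 <= f x)%E) ->
  (\int[leb]_x f x = \int[leb]_x f (x + b)%R)%E.
Proof.
move=> mf f0; rewrite (ge0_integral_affine b (oner_neq0 R))// normr1 mul1e.
by under eq_integral do rewrite mul1r.
Qed.

Lemma ge0_integral_reflection (f : measurableTypeR R -> \bar R) : measurable_fun setT f ->
  (forall x, (0 <= f x)%E) ->
  (\int[leb]_x f x = \int[leb]_x f (- x)%R)%E.
Proof.
move=> mf f0; have n10 : (-1 : R) != 0 by rewrite oppr_eq0 oner_neq0.
rewrite (ge0_integral_affine 0 n10)// normrN1 mul1e.
by under eq_integral do rewrite mulN1r addr0.
Qed.

End affine_change.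

(** * Splitting off the first coordinate of R^d *)

Section Rd_split.
Context {R : realType} (d : nat).
Local Notation leb := (@lebesgue_measure R).
Local Notation mu := (@lebesgue_Rd R d).
Local Notation muS := (@lebesgue_Rd R d.+1).

Definition consRd (p : measurableTypeR R * Rd R d) : Rd R d.+1 :=
  [tuple of p.1 :: p.2].

Lemma measurable_consRd : measurable_fun setT consRd.
Proof. exact: measurable_cons. Qed.

Lemma ge0_integral_consRd (f : Rd R d.+1 -> \bar R) : measurable_fun setT f ->
  (forall x, (0 <= f x)%E) ->
  (\int[muS]_x f x = \int[leb \x mu]_p f (consRd p))%E.
Proof.
move=> mf f0.
rewrite -[RHS](@ge0_integral_pushforward _ _ _ _ _ consRd measurable_consRd _ setT f)//.
Qed.

Lemma integrable_consRd (f : Rd R d.+1 -> \bar R) : muS.-integrable setT f ->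
  (leb \x mu)%E.-integrable setT (f \o consRd).
Proof.
move=> /integrableP[mf fo]; apply/integrableP; split.
  exact: measurableT_comp mf measurable_consRd.
by move: fo; rewrite ge0_integral_consRd//; exact: measurableT_comp.
Qed.

Lemma integral_consRd (f : Rd R d.+1 -> \bar R) : muS.-integrable setT f ->
  (\int[muS]_x f x = \int[leb \x mu]_p f (consRd p))%E.
Proof.
move=> fi; have mf := measurable_int _ fi.
rewrite integralE [RHS]integralE.
rewrite !ge0_integral_consRd//; [|exact: measurable_funeneg|exact: measurable_funepos].
congr (_ - _)%E; apply: eq_integral => p _.
  by rewrite !funeposE.
by rewrite !funenegE.
Qed.

End Rd_split.

Section Rd_translation.
Context {R : realType}.

Definition shiftRd d (a x : Rd R d) : Rd R d :=
  [tuple (tnth x i + tnth a i : R) | i < d].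

Lemma measurable_shiftRd d (a : Rd R d) : measurable_fun setT (shiftRd a).
Proof.
apply/measurable_fun_tnthP => i.
rewrite (_ : _ \o _ = (fun x : Rd R d => (tnth x i : R) + (tnth a i : R))).
  by apply: measurable_funD => //; exact: measurable_tnth.
by apply/funext => x; rewrite /= tnth_mktuple.
Qed.

(** Tonelli splits off the first coordinate, where the invariance is that of the line; the other
    coordinates are left to the induction hypothesis. *)
Lemma ge0_integral_shiftRd d (a : Rd R d) (f : Rd R d -> \bar R) :
  measurable_fun setT f -> (forall x, (0 <= f x)%E) ->
  (\int[lebesgue_Rd d]_x f x = \int[lebesgue_Rd d]_x f (shiftRd a x))%E.
Proof.
elim: d a f => [|d IH] a f mf f0.
  by apply: eq_integral => x _; congr f; rewrite tuple0 [RHS]tuple0.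
have mfs : measurable_fun setT (f \o shiftRd a).
  exact: measurableT_comp mf (measurable_shiftRd a).
rewrite !ge0_integral_consRd// !fubini_tonelli1//; last 2 first.
  exact: measurableT_comp mfs (@measurable_consRd R d).
  exact: measurableT_comp mf (@measurable_consRd R d).
have mfc : measurable_fun setT (f \o @consRd R d).
  exact: measurableT_comp mf (@measurable_consRd R d).
rewrite /fubini_F.
rewrite (ge0_integral_translation (thead a)); last 2 first.
- have h := @measurable_fun_fubini_tonelli_F _ _ _ _ _ (lebesgue_Rd d) _ mfc (fun p => f0 _).
  exact h.
- by move=> x; apply: integral_ge0.
apply: eq_integral => x _; rewrite (IH [tuple of behead a])//; last first.
  exact: (measurable_fun_pair2 (x + thead a) mfc).
apply: eq_integral => y _; congr f; apply: eq_from_tnth => i.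
rewrite [RHS]tnth_mktuple; case: (unliftP ord0 i) => [j ->|->].
  rewrite !tnthS tnth_mktuple; congr (_ + _).
  by rewrite [in RHS](tuple_eta a) tnthS.
by rewrite !tnth0.
Qed.

End Rd_translation.

(** * The Poisson kernel *)

Section Rintegral_param.
Context d1 d2 (T1 : measurableType d1) (T2 : measurableType d2) (R : realType).

(** Tonelli gives measurability for nonnegative integrands, hence the split into positive and
    negative parts. Parameters at which the inner integral is a default value are thereby covered
    too. *)
Lemma measurable_Rintegral (m2 : {sigma_finite_measure set T2 -> \bar R})
    (f : T1 * T2 -> R) : measurable_fun setT f ->
  measurable_fun setT (fun x => \int[m2]_y f (x, y)).
Proof.
move=> /measurable_EFinP mf.
rewrite /Rintegral; apply: (measurableT_comp (f := fine)) => //.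
rewrite (_ : (fun x => _) = (fun x => \int[m2]_y (EFin \o f)^\+ (x, y) -
  \int[m2]_y (EFin \o f)^\- (x, y))%E); last first.
  apply/funext => x; rewrite integralE; congr (_ - _)%E; apply: eq_integral => y _.
    by rewrite !funeposE.
  by rewrite !funenegE.
apply: emeasurable_funB.
  have mp := measurable_funepos mf.
  exact: (@measurable_fun_fubini_tonelli_F _ _ _ _ _ m2 _ mp (fun p => funepos_ge0 _ _)).
have mp := measurable_funeneg mf.
exact: (@measurable_fun_fubini_tonelli_F _ _ _ _ _ m2 _ mp (fun p => funeneg_ge0 _ _)).
Qed.

Variables (m1 : {sigma_finite_measure set T1 -> \bar R}).
Variables (m2 : {sigma_finite_measure set T2 -> \bar R}).

(** The real-valued inner integral agrees with the extended one only where the latter is finite,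
    that is almost everywhere; both conclusions are transferred along this equality. *)
Lemma Rintegral_fubini1 (f : T1 * T2 -> R) :
  (m1 \x m2)%E.-integrable setT (EFin \o f) ->
  m1.-integrable setT (EFin \o (fun x => \int[m2]_y f (x, y))) /\
  \int[m1]_x \int[m2]_y f (x, y) = \int[(m1 \x m2)%E]_p f p.
Proof.
move=> fi.
have iF := integrable_fubini_F fi.
have mF : measurable_fun setT (fun x => \int[m2]_y f (x, y)).
  by apply: measurable_Rintegral; exact: integrable_mfun fi.
have FE : {ae m1, forall x, setT x -> (\int[m2]_y f (x, y))%:E = fubini_F m2 (EFin \o f) x}.
  have := integrable_ae measurableT iF; apply: filterS => x h _.
  by rewrite /Rintegral fineK//; exact: h.
split; last first.
  rewrite [RHS]/Rintegral -[in RHS]integral12_prod_meas1//.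
  rewrite [LHS]/Rintegral; congr fine; apply: ae_eq_integral => //.
    exact/measurable_EFinP.
  by case/integrableP : iF.
move/integrableP : (iF) => [mFF Foo]; apply/integrableP; split.
  exact/measurable_EFinP.
rewrite (le_lt_trans _ Foo)//; apply: ae_ge0_le_integral => //.
- by apply: measurableT_comp => //; exact/measurable_EFinP.
- exact: measurableT_comp.
by apply: filterS FE => x h _; rewrite /= -h.
Qed.

End Rintegral_param.

Lemma Rintegral_fubini2 d1 d2 (T1 : measurableType d1) (T2 : measurableType d2)
  (R : realType) (m1 : {sigma_finite_measure set T1 -> \bar R})
  (m2 : {sigma_finite_measure set T2 -> \bar R}) (f : T1 * T2 -> R) :
  (m1 \x m2)%E.-integrable setT (EFin \o f) ->
  m2.-integrable setT (EFin \o (fun y => \int[m1]_x f (x, y))) /\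
  \int[m2]_y \int[m1]_x f (x, y) = \int[(m1 \x m2)%E]_p f p.
Proof.
move=> fi.
have mf : measurable_fun setT (EFin \o f) := measurable_int _ fi.
have mabs : measurable_fun setT (fun p => `|(EFin \o f) p|)%E by exact: measurableT_comp.
have iG : m2.-integrable setT (fubini_G m1 (EFin \o f)).
  apply/integrableP; split; first exact: (measurable_fubini_G fi).
  rewrite (le_lt_trans _ ((integrable21ltyP m1 m2 mf).1 fi))//.
  apply: ge0_le_integral => //.
  - by apply: measurableT_comp => //; exact: (measurable_fubini_G fi).
  - exact: (@measurable_fun_fubini_tonelli_G _ _ _ _ _ m1 _ mabs (fun p => abse_ge0 _)).
  - move=> y _; apply: le_abse_integral => //.
    exact: (measurable_fun_pair1 y mf).
have mG : measurable_fun setT (fun y => \int[m1]_x f (x, y)).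
  apply: (measurable_Rintegral m1 (f := f \o (fun p => (p.2, p.1)))).
  apply: (measurableT_comp (f := f)); first exact: integrable_mfun fi.
  exact: measurable_fun_pair.
have GE : {ae m2, forall y, setT y -> (\int[m1]_x f (x, y))%:E = fubini_G m1 (EFin \o f) y}.
  have := integrable_ae measurableT iG; apply: filterS => x h _.
  by rewrite /Rintegral fineK//; exact: h.
split; last first.
  rewrite [RHS]/Rintegral -[in RHS]integral21_prod_meas1//.
  rewrite [LHS]/Rintegral; congr fine; apply: ae_eq_integral => //.
    exact/measurable_EFinP.
  by case/integrableP : iG.
move/integrableP : (iG) => [mGG Goo]; apply/integrableP; split.
  exact/measurable_EFinP.
rewrite (le_lt_trans _ Goo)//; apply: ae_ge0_le_integral => //.
- by apply: measurableT_comp => //; exact/measurable_EFinP.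
- exact: measurableT_comp.
by apply: filterS GE => x h _; rewrite /= -h.
Qed.

Section poisson.
Context {R : realType}.
Local Notation leb := (@lebesgue_measure R).

Lemma ge0_integral_atan : (\int[leb]_x ((1 + x ^+ 2)^-1)%:E = pi%:E)%E.
Proof.
have c : continuous (fun x : R => (1 + x ^+ 2)^-1).
  move=> x; apply: cvgV; first by rewrite gt_eqF// ltr_pwDl// sqr_ge0.
  by apply: cvgD; [exact: cvg_cst|exact: exprn_continuous].
rewrite ge0_symfun_integralT//; last 2 first.
- by move=> x; rewrite invr_ge0 addr_ge0// sqr_ge0.
- by move=> x /=; rewrite sqrrN.
rewrite -set_itvcy (@ge0_continuous_FTC2y _ _ (@atan R) _ (pi / 2)).
- by rewrite atan0 sube0 -EFinM; congr EFin; field.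
- by move=> x _; rewrite invr_ge0 addr_ge0// sqr_ge0.
- exact: continuous_subspaceT.
- exact: cvgy_atan.
- by move=> x _; exact: derivable_atan.
- by apply/cvg_at_right_filter; exact: continuous_atan.
- by move=> x _; rewrite derive1_atan.
Qed.

(** Adding 1 to the cosine makes the integrand nonnegative, so the fundamental theorem of calculus
    on a half-line applies before integrability is known; the extra term contributes 2 / e. *)
Let expcos_aux (e z : R) : 0 < e ->
  (\int[leb]_x (expR (- (e * `|x|)) * (1 + cos (x * z)))%:E =
   (2 / e + 2 * e / (e ^+ 2 + z ^+ 2))%:E)%E.
Proof.
move=> e0.
have q0 : 0 < e ^+ 2 + z ^+ 2 by rewrite ltr_pwDl ?exprn_gt0// sqr_ge0.
have ge (x : R) : 0 <= expR (- (e * `|x|)) * (1 + cos (x * z)).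
  by rewrite mulr_ge0 ?expR_ge0// -lerBlDl sub0r cos_geN1.
have c : continuous (fun x : R => expR (- (e * `|x|)) * (1 + cos (x * z))).
  move=> x; apply: cvgM.
    apply: continuous_comp; last exact: continuous_expR.
    by apply: cvgN; apply: cvgM; [exact: cvg_cst|exact: norm_continuous].
  apply: cvgD; first exact: cvg_cst.
  apply: continuous_comp; last exact: continuous_cos.
  by apply: cvgM; [exact: cvg_id|exact: cvg_cst].
rewrite ge0_symfun_integralT//; last first.
  by move=> x /=; rewrite normrN mulNr cosN.
(* Antiderivative of exp (- e x) (1 + cos (x z)), found by two integrations by parts. It vanishes at
   infinity, so the integral over the whole line is - 2 F 0. *)
pose F (x : R) := expR (- (e * x)) *
  ((z * sin (x * z) - e * cos (x * z)) * (e ^+ 2 + z ^+ 2)^-1 - e^-1).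
have dF (x : R) : is_derive x (1 : R) F (expR (- (e * x)) * (1 + cos (x * z))).
  apply: is_derive_eq; rewrite /GRing.scale/= !(mulr0, mul0r, add0r, addr0, mulr1).
  field.
  by rewrite !gt_eqF.
rewrite -set_itvcy (@ge0_continuous_FTC2y _ _ F _ 0); last 6 first.
- by move=> x _; exact: ge.
- exact: continuous_subspaceT.
- apply/cvgr0Pnorm_le => eps eps0.
  pose C := `|z| * (e ^+ 2 + z ^+ 2)^-1 + e * (e ^+ 2 + z ^+ 2)^-1 + e^-1.
  have C0 : 0 < C.
    by rewrite ltr_wpDl ?invr_gt0// addr_ge0// mulr_ge0// ?invr_ge0 ltW.
  have hexp : expR (- (e * x)) @[x --> +oo] --> (0 : R).
    rewrite (_ : (fun x => _) = (fun z => expR (- z)) \o (fun z => e * z))//.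
    apply: (@cvg_comp _ _ _ _ _ _ (pinfty_nbhs R)); last exact: cvgr_expR.
    exact: gt0_cvgMry.
  have /cvgr0Pnorm_le/(_ (eps / C)) := hexp.
  rewrite divr_gt0// => /(_ isT); apply: filterS => x.
  rewrite ler_pdivlMr// => h; apply: le_trans h.
  rewrite /F normrM ler_wpM2l// (le_trans (ler_normB _ _))//.
  rewrite [X in _ + X]ger0_norm ?invr_ge0 ?(ltW e0)// lerD2r.
  rewrite normrM [X in _ * X]ger0_norm ?invr_ge0 ?(ltW q0)// -mulrDl.
  rewrite ler_wpM2r ?invr_ge0 ?(ltW q0)// (le_trans (ler_normB _ _))//.
  rewrite lerD// normrM.
    by rewrite ler_piMr// ler_norml sin_le1 sin_geN1.
  by rewrite gtr0_norm// ler_piMr ?(ltW e0)// ler_norml cos_le1 cos_geN1.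
- by move=> x _; exact: ex_derive.
- by apply/cvg_at_right_filter; apply: differentiable_continuous; apply/derivable1_diffP; exact: ex_derive.
- move=> x; rewrite in_itv/= andbT => x0.
  by rewrite derive1E derive_val ger0_norm// ltW.
rewrite /F mulr0 oppr0 expR0 mul0r sin0 cos0 -EFinB -EFinM; congr EFin.
by field; rewrite !gt_eqF.
Qed.

Lemma integrable_exp_norm (e : R) : 0 < e ->
  leb.-integrable setT (EFin \o (fun x => expR (- (e * `|x|)))) .
Proof.
move=> e0; apply: ge0_integrable_Rlty => [| |].
- apply: continuous_measurable_fun => x.
  apply: continuous_comp; last exact: continuous_expR.
  by apply: cvgN; apply: cvgM; [exact: cvg_cst|exact: norm_continuous].
- by move=> x; exact: expR_ge0.
have h : (\int[leb]_x (expR (- (e * `|x|)) * (1 + 1))%:E < +oo)%E.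
  rewrite [ltLHS](_ : _ = (2 / e + 2 * e / (e ^+ 2 + 0 ^+ 2))%:E) ?ltry//.
  by rewrite -(expcos_aux 0 e0); apply: eq_integral => x _; rewrite mulr0 cos0.
apply: (@le_lt_trans _ _ (\int[leb]_x (expR (- (e * `|x|)) * (1 + 1))%:E)%E).
  apply: ge0_le_integral => //.
  - apply/measurable_EFinP; apply: continuous_measurable_fun => x.
    apply: continuous_comp; last exact: continuous_expR.
    by apply: cvgN; apply: cvgM; [exact: cvg_cst|exact: norm_continuous].
  - apply/measurable_EFinP; apply: continuous_measurable_fun => x.
    apply: cvgM; last exact: cvg_cst.
    apply: continuous_comp; last exact: continuous_expR.
    by apply: cvgN; apply: cvgM; [exact: cvg_cst|exact: norm_continuous].
  - by move=> x _; rewrite lee_fin ler_peMr ?expR_ge0// lerDl.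
exact: h.
Qed.

Lemma Rintegral_exp_cos (e z : R) : 0 < e ->
  \int[leb]_x (expR (- (e * `|x|)) * cos (x * z)) = 2 * e / (e ^+ 2 + z ^+ 2).
Proof.
move=> e0; have iE := integrable_exp_norm e0.
have iC (w : R) : leb.-integrable setT (EFin \o (fun x => expR (- (e * `|x|)) * cos (x * w))).
  apply: (@integrable_le _ _ _ leb _ (fun x => expR (- (e * `|x|)))) => //.
    apply: measurable_funM; first exact: (integrable_mfun iE).
    apply: continuous_measurable_fun => x.
    apply: continuous_comp; last exact: continuous_cos.
    by apply: cvgM; [exact: cvg_id|exact: cvg_cst].
  move=> x; rewrite normrM ger0_norm ?expR_ge0// ler_piMr ?expR_ge0//.
  by rewrite ler_norml cos_le1 cos_geN1.
have key w : \int[leb]_x expR (- (e * `|x|)) + \int[leb]_x (expR (- (e * `|x|)) * cos (x * w)) =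
   2 / e + 2 * e / (e ^+ 2 + w ^+ 2).
  rewrite -RintegralD//; have /(congr1 fine)/= <- := expcos_aux w e0.
  by apply: eq_Rintegral => x _; rewrite mulrDr mulr1.
(* At z = 0 the two integrals on the left coincide, which isolates the integral of the
   exponential. *)
have kz := key z; have k0 := key 0; move: k0.
have -> : \int[leb]_x (expR (- (e * `|x|)) * cos (x * 0)) = \int[leb]_x expR (- (e * `|x|)).
  by apply: eq_Rintegral => x _; rewrite mulr0 cos0 mulr1.
rewrite expr0n/= addr0 => k0.
have E0 : \int[leb]_x expR (- (e * `|x|)) = 2 / e.
  have e1 : 2 * e / e ^+ 2 = 2 / e by field; rewrite gt_eqF.
  by move: k0; rewrite e1; lra.
by move: kz; rewrite E0 => /addrI.
Qed.

End poisson.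

(** * Continuity of translations in L^2 *)

Section translation_continuity.
Context {R : realType}.
Local Notation leb := (@lebesgue_measure R).
Implicit Types (a b g : measurableTypeR R -> R).

(** Squared L^2 modulus of continuity at z, extended-valued so that it makes sense for every
    function. *)
Definition shift_defect a (z : R) : \bar R :=
  (\int[leb]_x ((a x - a ((x : R) - z)) ^+ 2)%:E)%E.

Let shift (z : R) : measurableTypeR R -> measurableTypeR R := fun x => (x : R) - z.

Let mshift (z : R) : measurable_fun setT (shift z).
Proof. by apply: measurable_funB. Qed.

Let mcomp a (z : R) : measurable_fun setT a -> measurable_fun setT (fun x : measurableTypeR R => a ((x : R) - z)).
Proof. by move=> ma; exact: (measurableT_comp ma (mshift z)). Qed.

Let msqr a : measurable_fun setT a -> measurable_fun setT (fun x : measurableTypeR R => (a x ^+ 2)%:E).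
Proof. by move=> ma; apply/measurable_EFinP; exact: measurable_funX. Qed.

Lemma shift_defect_ge0 a z : (0 <= shift_defect a z)%E.
Proof. by apply: integral_ge0 => x _; rewrite lee_fin sqr_ge0. Qed.

(** From (p - q)^2 <= 2 p^2 + 2 q^2 and translation invariance. Being uniform in z, the bound later
    serves for domination. *)
Lemma shift_defect_le a z : measurable_fun setT a ->
  (shift_defect a z <= 4%:E * \int[leb]_x (a x ^+ 2)%:E)%E.
Proof.
move=> ma; have maz := mcomp z ma.
apply: (@le_trans _ _ (\int[leb]_x (2%:E * (a x ^+ 2)%:E + 2%:E * (a ((x : R) - z) ^+ 2)%:E))%E).
  apply: ge0_le_integral => //.
  - by move=> x _; rewrite lee_fin sqr_ge0.
  - by apply: msqr; exact: measurable_funB.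
  - by apply: emeasurable_funD; apply: measurable_funeM; exact: msqr.
  move=> x _; rewrite -!EFinM -EFinD lee_fin.
  by have := sqr_ge0 (a x + a ((x : R) - z)); rewrite !expr2; lra.
rewrite ge0_integralD//; last 4 first.
- by move=> x _; rewrite -EFinM lee_fin mulr_ge0// sqr_ge0.
- by apply: measurable_funeM; exact: msqr.
- by move=> x _; rewrite -EFinM lee_fin mulr_ge0// sqr_ge0.
- by apply: measurable_funeM; exact: msqr.
rewrite !ge0_integralZl//; last 4 first.
- exact: msqr.
- by move=> x _; rewrite lee_fin sqr_ge0.
- exact: msqr.
- by move=> x _; rewrite lee_fin sqr_ge0.
rewrite -(@ge0_integral_translation _ (- z) (fun x : measurableTypeR R => (a x ^+ 2)%:E)); last 2 first.
- exact: msqr.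
- by move=> x; rewrite lee_fin sqr_ge0.
rewrite -ge0_muleDl// ?lee_fin// -EFinD le_eqVlt; apply/orP; left; apply/eqP.
by congr (_%:E * _)%E; ring.
Qed.

Lemma shift_defectD a b (z : R) : measurable_fun setT a -> measurable_fun setT b ->
  (shift_defect (fun x => a x + b x)%R z <=
   2%:E * shift_defect a z + 2%:E * shift_defect b z)%E.
Proof.
move=> ma mb; have maz := mcomp z ma; have mbz := mcomp z mb.
have ha : measurable_fun setT (fun x : measurableTypeR R => ((a x - a ((x : R) - z)) ^+ 2)%:E).
  by apply: msqr; exact: measurable_funB.
have hb : measurable_fun setT (fun x : measurableTypeR R => ((b x - b ((x : R) - z)) ^+ 2)%:E).
  by apply: msqr; exact: measurable_funB.
rewrite /shift_defect -!ge0_integralZl//; try by move=> x _; rewrite lee_fin sqr_ge0.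
rewrite -ge0_integralD//; last 4 first.
- by move=> x _; rewrite -EFinM lee_fin mulr_ge0// sqr_ge0.
- exact: measurable_funeM.
- by move=> x _; rewrite -EFinM lee_fin mulr_ge0// sqr_ge0.
- exact: measurable_funeM.
apply: ge0_le_integral => //.
- by move=> x _; rewrite lee_fin sqr_ge0.
- by apply: msqr; apply: measurable_funB; exact: measurable_funD.
- by apply: emeasurable_funD; exact: measurable_funeM.
move=> x _; rewrite -!EFinM -EFinD lee_fin.
set p := a x - a ((x : R) - z); set q := b x - b ((x : R) - z).
have -> : a x + b x - (a ((x : R) - z) + b ((x : R) - z)) = p + q by rewrite /p /q; ring.
by have := sqr_ge0 (p - q); rewrite !expr2; lra.
Qed.

(** As |z_n| <= B, all the differences vanish outside [-(K + B), K + B] and are at most 2 M in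
    modulus, which gives one dominating function for all n. *)
Lemma shift_defect_cont_compact (g : R -> R) (M K B : R) (z_ : nat -> R) :
  continuous (g : R -> R) -> (forall x, `|g x| <= M) ->
  (forall x : R, K < `|x : R| -> g x = 0) ->
  z_ n @[n --> \oo] --> 0 -> (forall n, `|z_ n| <= B) ->
  shift_defect g (z_ n) @[n --> \oo] --> 0%E.
Proof.
move=> cg gM gK z0 zB.
have mg : measurable_fun setT g by exact: continuous_measurable_fun.
have B0 : 0 <= B by exact: le_trans (zB 0%N).
pose E : set (measurableTypeR R) := `[- (K + B), K + B]%classic.
pose D (x : measurableTypeR R) : R := 4 * M ^+ 2 * \1_E x.
have mE : measurable E by exact: measurable_itv.
have iD : leb.-integrable setT (EFin \o D).
  have hE : leb.-integrable setT (EFin \o \1_E).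
    exact: integrable_indic_itv.
  exact: (integrable_RZ (4 * M ^+ 2) hE).
have [] := @dominated_convergence _ _ _ leb setT measurableT
  (fun n (x : measurableTypeR R) => ((g x - g ((x : R) - z_ n)) ^+ 2)%:E) (cst 0%E) (EFin \o D).
- by move=> n; apply: msqr; apply: measurable_funB => //; exact: mcomp.
- exact: measurable_cst.
- apply: aeW => x _; apply: cvg_EFin; first exact: nearW.
  rewrite /comp/= [X in _ --> X](_ : 0 = (g x - g ((x : R) - 0)) ^+ 2); last first.
    by rewrite subr0 subrr expr0n.
  have h : g ((x : R) - z_ n) @[n --> \oo] --> g ((x : R) - 0).
    apply: (@cvg_comp _ _ _ (fun n => (x : R) - z_ n) g); last exact: cg.
    by apply: cvgB => //; exact: cvg_cst.
  by rewrite expr2; apply: cvgM; apply: cvgB => //; exact: cvg_cst.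
- exact: iD.
- apply: aeW => x n _; rewrite gee0_abs ?lee_fin ?sqr_ge0// /D indicE.
  have [xE|xE] := boolP (x \in E).
    rewrite mulr1 -real_normK ?num_real//.
    have -> : 4 * M ^+ 2 = (M + M) ^+ 2 by ring.
    rewrite lerXn2r ?nnegrE ?addr_ge0// ?(le_trans (normr_ge0 (g 0)))//.
    by rewrite (le_trans (ler_normB _ _))// lerD.
  have hx : K + B < `|x : R|.
    rewrite ltNge; apply/negP => h; move/negP: xE; apply; rewrite inE /E/= in_itv/=.
    by rewrite -ler_norml.
  rewrite !gK ?subrr ?expr0n ?mulr0//; last by rewrite (le_lt_trans _ hx)// lerDl.
  rewrite -(ltrD2r B) (lt_le_trans hx)//.
  rewrite (le_trans _ (lerD (lexx _) (zB n)))//.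
  by rewrite (le_trans _ (ler_normD _ _))// subrK.
move=> _ _; rewrite integral_cst// mul0e; exact.
Qed.

End translation_continuity.

Lemma ereal_cvg0_small (R : realType) (F : nat -> \bar R) (e : R) : 0 < e ->
  F n @[n --> \oo] --> 0%E -> \forall n \near \oo, (F n < e%:E)%E.
Proof.
move=> e0 F0; have : nbhs (0 : \bar R)%E [set y | (y < e%:E)%E].
  by apply: open_nbhs_nbhs; split; [exact: open_ereal_lt_ereal|rewrite /= lte_fin].
by move/F0.
Qed.

(** * Approximation in L^2 of the line by continuous functions of compact support *)

Section L2_approximation.
Context {R : realType}.
Local Notation leb := (@lebesgue_measure R).

(** For M >= 0, [clip M] is the truncation to [-M, M]; for K >= 0, [tent K] is 1 on [-K, K], 0
    beyond K + 1 and affine between. Written with absolute values, both are visibly continuous. *)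
Let clip (M y : R) : R := (`|y + M| - `|y - M|) / 2.
Let tent (K x : R) : R := (1 + `|K + 1 - `|x| | - `|K - `|x| |) / 2.

Let clip_le M y : 0 <= M -> `|clip M y| <= M.
Proof.
rewrite /clip => M0; rewrite ler_norml.
by case: (ger0P (y + M)) => ?; case: (ger0P (y - M)) => ?; apply/andP; split; lra.
Qed.

Let tent01 K x : 0 <= tent K x <= 1.
Proof.
rewrite /tent; have := normr_ge0 x; set t := `|x| => t0.
by case: (ger0P (K + 1 - t)) => ?; case: (ger0P (K - t)) => ?; apply/andP; split; lra.
Qed.

Let tent1 K x : `|x| <= K -> tent K x = 1.
Proof.
rewrite /tent; set t := `|x| => tK.
by rewrite (@ger0_norm _ (K + 1 - t)) ?(@ger0_norm _ (K - t)); lra.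
Qed.

Let tent0 K x : K + 1 < `|x| -> tent K x = 0.
Proof.
rewrite /tent; set t := `|x| => tK.
by rewrite (@ltr0_norm _ (K + 1 - t)) ?(@ltr0_norm _ (K - t)); lra.
Qed.

(** Of the two factors of the square, one is bounded by |v - y| and the other by 2 M, which turns
    closeness in L^1 into closeness in L^2. The alternative on c covers the collar K < |x| <= K + 1,
    where the cutoff may be below 1 but the truncated function is 0. *)
Let clip_close M v y c : 0 <= M -> `|v| <= M -> 0 <= c <= 1 -> (c = 1 \/ v = 0) ->
  (v - c * clip M y) ^+ 2 <= 2 * M * `|v - y|.
Proof.
move=> M0 vM /andP[c0 c1] cv.
have cl : `|clip M y - v| <= `|v - y|.
  have /andP[? ?] : - M <= v <= M by rewrite -ler_norml.
  rewrite /clip [leRHS]distrC ler_norml.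
  by case: (ger0P (y + M)) => ?; case: (ger0P (y - M)) => ?;
     case: (ger0P (y - v)) => ?; apply/andP; split; lra.
have h1 : `|v - c * clip M y| <= `|v - y|.
  case: cv => [->|v0]; first by rewrite mul1r distrC.
  rewrite v0 !sub0r !normrN in cl *; move: cl; rewrite subr0 => cl.
  rewrite normrM (ger0_norm c0) (le_trans _ cl)// ler_piMl//.
have h2 : `|v - c * clip M y| <= 2 * M.
  rewrite (le_trans (ler_normB _ _))// mulr_natl mulr2n lerD//.
  by rewrite normrM (ger0_norm c0) (le_trans _ (clip_le y M0))// ler_piMl.
by rewrite -real_normK ?num_real// expr2 ler_pM.
Qed.

Let cont_clip M : continuous (clip M).
Proof.
move=> y; apply: cvgM; last exact: cvg_cst.
apply: cvgB; apply: cvg_norm.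
  by apply: cvgD; [exact: cvg_id|exact: cvg_cst].
by apply: cvgB; [exact: cvg_id|exact: cvg_cst].
Qed.

Let cont_tent K : continuous (tent K).
Proof.
move=> y; apply: cvgM; last exact: cvg_cst.
apply: cvgB.
  apply: cvgD; first exact: cvg_cst.
  by apply: cvg_norm; apply: cvgB; [exact: cvg_cst|exact: norm_continuous].
by apply: cvg_norm; apply: cvgB; [exact: cvg_cst|exact: norm_continuous].
Qed.

Variables (a : R -> R) (ma : measurable_fun setT a).
Hypothesis a2 : (\int[leb]_x (a x ^+ 2)%:E < +oo)%E.

Let S n : set R := [set x | `|x| <= n%:R /\ `|a x| <= n%:R].

Let mS n : measurable (S n).
Proof.
have h (f : R -> R) : measurable_fun setT f -> measurable [set x | `|f x| <= n%:R].
  move=> mf; rewrite (_ : [set x | _] = (Num.norm \o f) @^-1` `]-oo, n%:R]%classic); last first.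
    by apply/seteqP; split => x /=; rewrite in_itv.
  by rewrite -[X in measurable X]setTI; apply: measurableT_comp => //; exact: measurable_itv.
by apply: measurableI; exact: h.
Qed.

Let tr n (x : R) : R := a x * \1_(S n) x.

Let mtr n : measurable_fun setT (tr n).
Proof. by apply: measurable_funM. Qed.

Let tr_le n x : `|tr n x| <= n%:R.
Proof.
rewrite /tr indicE; case: (boolP (x \in S n)) => [|_]; last by rewrite mulr0 normr0.
by rewrite inE mulr1 => -[].
Qed.

Let tr_out n x : n%:R < `|x| -> tr n x = 0.
Proof.
rewrite /tr indicE; case: (boolP (x \in S n)) => [|_ _]; last by rewrite mulr0.
by rewrite inE => -[h _]; rewrite ltNge h.
Qed.

Let tr_cvg : (\int[leb]_x ((a x - tr n x) ^+ 2)%:E)%E @[n --> \oo] --> 0%E.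
Proof.
have ia : leb.-integrable setT (EFin \o (fun x => a x ^+ 2)).
  apply: ge0_integrable_Rlty a2; first exact: measurable_funX.
  by move=> x; exact: sqr_ge0.
have [] := @dominated_convergence _ _ _ leb setT measurableT
  (fun n (x : measurableTypeR R) => ((a x - tr n x) ^+ 2)%:E) (cst 0%E)
  (EFin \o (fun x => a x ^+ 2)).
- move=> n; have mt := mtr n.
  by apply/measurable_EFinP; apply: measurable_funX; exact: measurable_funB.
- exact: measurable_cst.
- apply: aeW => x _; apply: cvg_near_cst.
  near=> n; rewrite /tr indicE mem_set ?mulr1 ?subrr ?expr0n//.
  by split; near: n; exact: nbhs_infty_ger.
- exact: ia.
- apply: aeW => x n _; rewrite gee0_abs ?lee_fin ?sqr_ge0// /tr indicE.
  by case: (_ \in _); rewrite ?mulr1 ?mulr0 ?subr0// subrr expr0n/= sqr_ge0.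
by move=> _ _; rewrite integral_cst// mul0e; exact.
Unshelve. all: by end_near. Qed.

Lemma L2_dense_continuous (e : R) : 0 < e -> exists g : R -> R, exists M K : R,
  [/\ continuous g, forall x, `|g x| <= M, forall x, K < `|x| -> g x = 0 &
   (\int[leb]_x ((a x - g x) ^+ 2)%:E <= e%:E)%E].
Proof.
move=> e0.
have [N _ /(_ N (leqnn N)) /= hN] := ereal_cvg0_small (divr_gt0 e0 (ltr0n _ 4)) tr_cvg.
pose K : R := N%:R.
have mt := mtr N.
have K0 : 0 <= K by [].
pose E : set R := `[- (K + 1), K + 1]%classic.
have mE : measurable (E : set (measurableTypeR R)) by exact: measurable_itv.
have Efin : (leb E < +oo)%E.
  by rewrite /E lebesgue_measure_itv/=; case: ifPn => _; rewrite ?ltry// -EFinB ltry.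
have itr : leb.-integrable E (EFin \o tr N).
  apply: measurable_bounded_integrable => //; first exact: measurable_funTS.
  by exists K; split; [exact: num_real|move=> y Ky x _ /=; rewrite (le_trans (tr_le _ _))// ltW].
have [g_ [cg _ gcvg]] := approximation_continuous_integrable (measurable_itv _) Efin itr.
(* This tolerance absorbs the factor 2 K of [clip_close]; the + 1 keeps the denominator positive
   when K = 0. *)
have e1 : 0 < e / 4 / (2 * K + 1) by rewrite !divr_gt0// ltr_wpDl// mulr_ge0.
have [n _ /(_ n (leqnn n)) /= hn] := ereal_cvg0_small e1 gcvg.
pose g x := tent K x * clip K (g_ n x).
have contg : continuous g.
  move=> x; apply: cvgM; first exact: cont_tent.
  by apply: continuous_comp; [exact: cg|exact: cont_clip].
have mg : measurable_fun setT g by exact: continuous_measurable_fun.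
have mgn : measurable_fun setT (g_ n) by exact: continuous_measurable_fun.
exists g, K, (K + 1); split => //.
- move=> x; rewrite normrM; have /andP[t0 t1] := tent01 K x.
  by rewrite (ger0_norm t0) (le_trans _ (clip_le (g_ n x) K0))// ler_piMl.
- by move=> x xK; rewrite /g tent0// mul0r.
have tg : (\int[leb]_x ((tr N x - g x) ^+ 2)%:E <= (e / 4)%:E)%E.
  have mabs : measurable_fun E (fun x => `|(tr N x - g_ n x)%:E|%E).
    apply: measurableT_comp => //; apply/measurable_EFinP.
    by apply: measurable_funTS; exact: measurable_funB.
  apply: (@le_trans _ _ (\int[leb]_(x in E) ((2 * K)%:E * `|(tr N x - g_ n x)%:E|))%E).
    rewrite [leRHS]integral_mkcond/=; apply: ge0_le_integral => //.
    - by move=> x _; rewrite lee_fin sqr_ge0.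
    - by apply/measurable_EFinP; apply: measurable_funX; exact: measurable_funB.
    - apply/(measurable_restrictT _ _).1 => //.
      exact: measurable_funeM.
    move=> x _; rewrite patchE; case: ifPn => [_|xE].
      rewrite /= -EFinM lee_fin; apply: clip_close => //.
      have [xK|xK] := leP `|x| K; first by left; exact: tent1.
      by right; exact: tr_out.
    have xK : K + 1 < `|x|.
      rewrite ltNge; apply/negP => h; move/negP: xE; apply; rewrite inE /E/= in_itv/=.
      by rewrite -ler_norml.
    rewrite tr_out; last by rewrite (le_lt_trans _ xK)// lerDl.
    by rewrite /g tent0// mul0r subrr expr0n.
  rewrite ge0_integralZl//; last by rewrite lee_fin mulr_ge0.
  apply: (@le_trans _ _ ((2 * K)%:E * (e / 4 / (2 * K + 1))%:E)%E).
    by rewrite lee_wpmul2l ?lee_fin ?mulr_ge0// ltW.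
  rewrite -EFinM lee_fin mulrA ler_pdivrMr; last by rewrite ltr_wpDl// mulr_ge0.
  by rewrite mulrC ler_wpM2l ?divr_ge0 ?(ltW e0)// lerDl.
apply: (@le_trans _ _ (\int[leb]_x (2%:E * ((a x - tr N x) ^+ 2)%:E + 2%:E * ((tr N x - g x) ^+ 2)%:E))%E).
  apply: ge0_le_integral => //.
  - by move=> x _; rewrite lee_fin sqr_ge0.
  - by apply/measurable_EFinP; apply: measurable_funX; exact: measurable_funB.
  - by apply: emeasurable_funD; apply: measurable_funeM; apply/measurable_EFinP;
      apply: measurable_funX; exact: measurable_funB.
  move=> x _; rewrite -!EFinM -EFinD lee_fin.
  by have := sqr_ge0 ((a x - tr N x) - (tr N x - g x)); rewrite !expr2; lra.
have m1 : measurable_fun setT (fun x : R => ((a x - tr N x) ^+ 2)%:E).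
  by apply/measurable_EFinP; apply: measurable_funX; exact: measurable_funB.
have m2 : measurable_fun setT (fun x : R => ((tr N x - g x) ^+ 2)%:E).
  by apply/measurable_EFinP; apply: measurable_funX; exact: measurable_funB.
rewrite ge0_integralD//; last 4 first.
- by move=> x _; rewrite -EFinM lee_fin mulr_ge0// sqr_ge0.
- exact: measurable_funeM.
- by move=> x _; rewrite -EFinM lee_fin mulr_ge0// sqr_ge0.
- exact: measurable_funeM.
rewrite !ge0_integralZl//; try by move=> x _; rewrite lee_fin sqr_ge0.
apply: (@le_trans _ _ (2%:E * (e / 4)%:E + 2%:E * (e / 4)%:E)%E).
  by apply: leeD; apply: lee_wpmul2l => //; exact: ltW.
by rewrite -!EFinM -EFinD lee_fin; lra.
Qed.

End L2_approximation.

Lemma ereal_cvg0_of_small (R : realType) (F : nat -> \bar R) :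
  (forall n, (0 <= F n)%E) ->
  (forall e : R, 0 < e -> \forall n \near \oo, (F n <= e%:E)%E) ->
  F n @[n --> \oo] --> 0%E.
Proof.
move=> F0 Fs; apply: cvg_EFin.
  have := Fs 1 ltr01; apply: filterS => n h.
  by rewrite ge0_fin_numE// (le_lt_trans h)// ltry.
apply/cvgr0Pnorm_le => e e0; have := Fs e e0; apply: filterS => n h.
rewrite /= ger0_norm ?fine_ge0// -lee_fin fineK//.
by rewrite ge0_fin_numE// (le_lt_trans h)// ltry.
Qed.

(** * Exchange of integrals for bounded kernels *)

Section bounded_kernel.
Context d1 d2 (T1 : measurableType d1) (T2 : measurableType d2) (R : realType).
Variables (m1 : {sigma_finite_measure set T1 -> \bar R}).
Variables (m2 : {sigma_finite_measure set T2 -> \bar R}).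

Lemma integrable_bounded_kernel (k : T1 -> R) (a : T2 -> R) (phi : T1 * T2 -> R) (M : R) :
  m1.-integrable setT (EFin \o k) -> m2.-integrable setT (EFin \o a) ->
  measurable_fun setT phi -> (forall p, `|phi p| <= M) ->
  (m1 \x m2)%E.-integrable setT (EFin \o (fun p => k p.1 * a p.2 * phi p)).
Proof.
move=> ik ia mphi phiM.
have mk := integrable_mfun ik; have ma := integrable_mfun ia.
have mkp : measurable_fun setT (k \o fst : T1 * T2 -> R) by exact: measurableT_comp.
have map : measurable_fun setT (a \o snd : T1 * T2 -> R) by exact: measurableT_comp.
have mf : measurable_fun setT (fun p => k p.1 * a p.2 * phi p).
  by apply: measurable_funM => //; exact: measurable_funM.
have /integrableP[_ koo] := ik; have /integrableP[_ aoo] := ia.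
apply/integrable12ltyP; first exact/measurable_EFinP.
have M0 (p : T1 * T2) : 0 <= M by rewrite (le_trans (normr_ge0 (phi p))).
pose A := (\int[m2]_y `|(EFin \o a) y|)%E.
have A0 : (0 <= A)%E by apply: integral_ge0.
have Afin : A \is a fin_num by rewrite ge0_fin_numE.
apply: (@le_lt_trans _ _ (\int[m1]_x ((`|M|)%:E * (A * `|(EFin \o k) x|)))%E).
  apply: ge0_le_integral => //.
  - by move=> x _; exact: integral_ge0.
  - have mabs : measurable_fun setT (fun p => `|(EFin \o (fun p => (k p.1 * a p.2 * phi p)%R)) p|)%E.
      by apply: measurableT_comp => //; exact/measurable_EFinP.
    exact: (@measurable_fun_fubini_tonelli_F _ _ _ _ _ m2 _ mabs (fun p => abse_ge0 _)).
  - by apply: measurable_funeM; apply: measurable_funeM; apply: measurableT_comp => //;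
      exact/measurable_EFinP.
  move=> x _.
  apply: (@le_trans _ _ (\int[m2]_y ((`|M| * `|k x|)%:E * `|(EFin \o a) y|))%E).
    apply: ge0_le_integral => //.
    - apply: measurableT_comp => //; apply/measurable_EFinP.
      exact: (measurable_fun_pair2 x mf).
    - by apply: measurable_funeM; apply: measurableT_comp => //; exact/measurable_EFinP.
    move=> y _; rewrite /= -!EFinM lee_fin !normrM mulrC -mulrA.
    by rewrite ler_wpM2r ?mulr_ge0// (le_trans (phiM _))// ler_norm.
  rewrite ge0_integralZl//; last first.
    by apply: measurableT_comp => //; exact/measurable_EFinP.
  by rewrite EFinM -muleA [X in (_ * X <= _)%E]muleC.
rewrite ge0_integralZl//; last 2 first.
- by apply: measurable_funeM; apply: measurableT_comp => //; exact/measurable_EFinP.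
- by move=> x _; exact: mule_ge0.
rewrite ge0_integralZl//; last by apply: measurableT_comp => //; exact/measurable_EFinP.
rewrite lte_mul_pinfty// lte_mul_pinfty//.
Qed.

Lemma Rintegral_bounded_kernel (k : T1 -> R) (a : T2 -> R) (phi : T1 * T2 -> R) (M : R) :
  m1.-integrable setT (EFin \o k) -> m2.-integrable setT (EFin \o a) ->
  measurable_fun setT phi -> (forall p, `|phi p| <= M) ->
  \int[m1]_x \int[m2]_y (k x * a y * phi (x, y)) =
  \int[m2]_y \int[m1]_x (k x * a y * phi (x, y)).
Proof.
move=> ik ia mphi phiM; have i12 := integrable_bounded_kernel ik ia mphi phiM.
have [_ h1] := Rintegral_fubini1 i12; have [_ h2] := Rintegral_fubini2 i12.
by rewrite [LHS]h1 [RHS]h2.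
Qed.

End bounded_kernel.

Section shift_defect_limit.
Context {R : realType}.
Local Notation leb := (@lebesgue_measure R).

Lemma shift_defect_cvg0 (a : R -> R) (z_ : nat -> R) :
  measurable_fun setT a -> (\int[leb]_x (a x ^+ 2)%:E < +oo)%E ->
  z_ n @[n --> \oo] --> 0 -> shift_defect a (z_ n) @[n --> \oo] --> 0%E.
Proof.
move=> ma a2 z0.
have [B [_ hB]] : bounded_fun z_ by apply: cvg_seq_bounded; apply/cvg_ex; exists 0.
have zB n : `|z_ n| <= `|B| + 1.
  by apply: hB => //; rewrite (le_lt_trans (ler_norm B))// ltrDl.
apply: ereal_cvg0_of_small => [n|e e0]; first exact: shift_defect_ge0.
(* The contributions 2 (e / 10) of g and 2 * 4 (e / 10) of a - g add up to e. *)
have e1 : 0 < e / 10 by rewrite divr_gt0.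
have [g [M [K [cg gM gK ag]]]] := L2_dense_continuous ma a2 e1.
have mg : measurable_fun setT g by exact: continuous_measurable_fun.
have mag : measurable_fun setT (fun x => a x - g x) by exact: measurable_funB.
have := ereal_cvg0_small e1 (shift_defect_cont_compact cg gM gK z0 zB).
apply: filterS => n hn.
have -> : a = (fun x => g x + (a x - g x)) by apply/funext => x; rewrite addrC subrK.
apply: (le_trans (shift_defectD (z_ n) mg mag)).
apply: (@le_trans _ _ (2%:E * (e / 10)%:E + 2%:E * (4%:E * (e / 10)%:E))%E).
  apply: leeD; apply: lee_wpmul2l => //; first exact: ltW.
  by apply: (le_trans (shift_defect_le _ mag)); exact: lee_wpmul2l.
by rewrite -!EFinM -EFinD lee_fin; lra.
Qed.

End shift_defect_limit.

(** * Plancherel's identity on the line *)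

Lemma integrable_Rnorm d (T : measurableType d) (R : realType)
    (mu : {measure set T -> \bar R}) (f : T -> R) :
  mu.-integrable setT (EFin \o f) -> mu.-integrable setT (EFin \o (fun x => `|f x|)).
Proof. by move=> /integrable_abse; apply: eq_integrable. Qed.

Section plancherel_line.
Context {R : realType}.
Local Notation leb := (@lebesgue_measure R).
Variable a : R -> R.
Hypothesis ia : leb.-integrable setT (EFin \o a).
Hypothesis ia2 : leb.-integrable setT (EFin \o (fun x => a x ^+ 2)).

Let ma : measurable_fun setT a. Proof. exact: integrable_mfun ia. Qed.

(** The unnormalized transform of the real function [a] is C - i S; its two parts are handled as
    real functions. *)
Definition cos_transform (xi : R) : R := \int[leb]_x (a x * cos (xi * x)).
Definition sin_transform (xi : R) : R := \int[leb]_x (a x * sin (xi * x)).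

Local Notation C := cos_transform.
Local Notation S := sin_transform.

Let mphi (f : R -> R) : continuous f -> measurable_fun setT (fun p : R * R => f (p.1 * p.2)).
Proof.
move=> cf; apply: (measurableT_comp (f := f)); first exact: continuous_measurable_fun.
exact: measurable_funM.
Qed.

Lemma measurable_cos_transform : measurable_fun setT C.
Proof.
apply: (@measurable_Rintegral _ _ _ _ _ leb (fun p : R * R => a p.2 * cos (p.1 * p.2))).
apply: measurable_funM; first exact: measurableT_comp.
by apply: mphi; exact: continuous_cos.
Qed.

Lemma measurable_sin_transform : measurable_fun setT S.
Proof.
apply: (@measurable_Rintegral _ _ _ _ _ leb (fun p : R * R => a p.2 * sin (p.1 * p.2))).
apply: measurable_funM; first exact: measurableT_comp.
by apply: mphi; exact: continuous_sin.
Qed.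

Let iaM (f : R -> R) : measurable_fun setT f -> (forall x, `|f x| <= 1) ->
  leb.-integrable setT (EFin \o (fun x => a x * f x)).
Proof.
move=> mf f1.
apply: (@integrable_le _ _ _ leb _ (fun x => `|a x|)).
- exact: measurable_funM.
- exact: integrable_Rnorm.
- by move=> x; rewrite normrM ler_piMr.
Qed.

Let mcosx (xi : R) : measurable_fun setT (fun x : R => cos (xi * x)).
Proof.
apply: (measurableT_comp (f := @cos R)); last exact: measurable_funM.
by apply: continuous_measurable_fun; exact: continuous_cos.
Qed.

Let msinx (xi : R) : measurable_fun setT (fun x : R => sin (xi * x)).
Proof.
apply: (measurableT_comp (f := @sin R)); last exact: measurable_funM.
by apply: continuous_measurable_fun; exact: continuous_sin.
Qed.

Let icos xi : leb.-integrable setT (EFin \o (fun x => a x * cos (xi * x))).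
Proof. by apply: iaM => // x; exact: cos_max. Qed.

Let isin xi : leb.-integrable setT (EFin \o (fun x => a x * sin (xi * x))).
Proof. by apply: iaM => // x; exact: sin_max. Qed.

Let A := \int[leb]_x `|a x|.

Let transform_le (f : R -> R) : measurable_fun setT f -> (forall x, `|f x| <= 1) ->
  `|\int[leb]_x (a x * f x)| <= A.
Proof.
move=> mf f1; have iaf := iaM mf f1.
rewrite (le_trans (le_normr_Rintegral _ _))//; apply: le_Rintegral => //.
- exact: integrable_Rnorm.
- exact: integrable_Rnorm.
- by move=> x _; rewrite normrM ler_piMr.
Qed.

Let Cb xi : `|C xi| <= A. Proof. by apply: transform_le => // x; exact: cos_max. Qed.
Let Sb xi : `|S xi| <= A. Proof. by apply: transform_le => // x; exact: sin_max. Qed.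

Let A0 : 0 <= A. Proof. by apply: Rintegral_ge0. Qed.

Let w (e xi : R) := expR (- (e * `|xi|)).

Let mw e : measurable_fun setT (w e).
Proof.
apply: continuous_measurable_fun => x.
apply: continuous_comp; last exact: continuous_expR.
by apply: cvgN; apply: cvgM; [exact: cvg_cst|exact: norm_continuous].
Qed.

(* The Fourier transform of [w e]; [T_ e] is the Plancherel integral regularized by
   [w e], after exchanging the integrals. *)
Let K (e z : R) : R := 2 * e / (e ^+ 2 + z ^+ 2).

Let regularized e : \bar R := (\int[leb]_xi (w e xi * (C xi ^+ 2 + S xi ^+ 2))%:E)%E.

Let T_ e : R := \int[leb]_x (a x * \int[leb]_y (a y * K e (x - y))).

Let regularized_integrable e : 0 < e ->
  leb.-integrable setT (EFin \o (fun xi => w e xi * (C xi ^+ 2 + S xi ^+ 2))).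
Proof.
move=> e0; have iw := integrable_exp_norm e0.
apply: (@integrable_le _ _ _ leb _ (fun xi => (A ^+ 2 + A ^+ 2) * w e xi)).
- apply: measurable_funM; first exact: mw.
  apply: measurable_funD; apply: measurable_funX.
    exact: measurable_cos_transform.
  exact: measurable_sin_transform.
- exact: integrable_RZ.
move=> xi; rewrite mulrC ger0_norm ?mulr_ge0 ?expR_ge0 ?addr_ge0 ?sqr_ge0//.
rewrite ler_wpM2r ?expR_ge0// lerD// -[leLHS]real_normK ?num_real//.
  by rewrite lerXn2r ?nnegrE.
by rewrite lerXn2r ?nnegrE.
Qed.

Let mH : measurable_fun setT (fun p : R * R => C p.1 * cos (p.1 * p.2) + S p.1 * sin (p.1 * p.2)).
Proof.
apply: measurable_funD; apply: measurable_funM.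
- by apply: (measurableT_comp (f := C)) => //; exact: measurable_cos_transform.
- by apply: mphi; exact: continuous_cos.
- by apply: (measurableT_comp (f := S)) => //; exact: measurable_sin_transform.
- by apply: mphi; exact: continuous_sin.
Qed.

(** C^2 + S^2 is the double integral of a(x) a(y) cos (xi (x - y)), by the addition formula for the
    cosine. The weight makes each exchange with the xi-integral absolutely convergent; the
    xi-integral is moved past x, then past y, where it becomes the Poisson kernel. *)
Let regularizedE e : 0 < e -> regularized e = (T_ e)%:E.
Proof.
move=> e0; have iw := integrable_exp_norm e0.
rewrite /regularized -EFin_Rintegral; last exact: regularized_integrable.
congr EFin.
transitivity (\int[leb]_xi \int[leb]_x (w e xi * a x *
    (C xi * cos (xi * x) + S xi * sin (xi * x)))).
  apply: eq_Rintegral => xi _.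
  have -> : (fun x => w e xi * a x * (C xi * cos (xi * x) + S xi * sin (xi * x))) =
            (fun x => w e xi * C xi * (a x * cos (xi * x)) + w e xi * S xi * (a x * sin (xi * x))).
    by apply/funext => x; ring.
  rewrite RintegralD//; [|exact: integrable_RZ..].
  rewrite !RintegralZl// -/(C xi) -/(S xi); ring.
have Hb (p : R * R) : `|C p.1 * cos (p.1 * p.2) + S p.1 * sin (p.1 * p.2)| <= A + A.
  rewrite (le_trans (ler_normD _ _))// lerD// normrM.
    by rewrite -[leRHS]mulr1 ler_pM// cos_max.
  by rewrite -[leRHS]mulr1 ler_pM// sin_max.
apply: (etrans (Rintegral_bounded_kernel iw ia mH Hb)).
apply: eq_Rintegral => x _ /=.
transitivity (\int[leb]_xi (a x * \int[leb]_y (w e xi * a y * cos (xi * (x - y))))).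
  apply: eq_Rintegral => xi _; rewrite [w e xi * a x]mulrC -mulrA; congr (_ * _).
  have -> : (fun y => w e xi * a y * cos (xi * (x - y))) =
            (fun y => w e xi * cos (xi * x) * (a y * cos (xi * y)) +
                      w e xi * sin (xi * x) * (a y * sin (xi * y))).
    by apply/funext => y; rewrite mulrBr cosB; ring.
  rewrite RintegralD//; [|exact: integrable_RZ..].
  rewrite !RintegralZl// -/(C xi) -/(S xi); ring.
have mcosB : measurable_fun setT (fun p : R * R => cos (p.1 * (x - p.2))).
  apply: (measurableT_comp (f := @cos R)).
    by apply: continuous_measurable_fun; exact: continuous_cos.
  by apply: measurable_funM => //; exact: measurable_funB.
have cosB1 (p : R * R) : `|cos (p.1 * (x - p.2))| <= 1 by exact: cos_max.
have [iI _] := Rintegral_fubini1 (integrable_bounded_kernel iw ia mcosB cosB1).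
rewrite RintegralZl//; congr (_ * _).
apply: (etrans (Rintegral_bounded_kernel iw ia mcosB cosB1)).
apply: eq_Rintegral => y _ /=; rewrite /K -(Rintegral_exp_cos (x - y) e0).
rewrite -RintegralZl//; last first.
  apply: (@integrable_le _ _ _ leb _ (w e)) => //.
    apply: measurable_funM; first exact: mw.
    apply: (measurableT_comp (f := @cos R)).
      by apply: continuous_measurable_fun; exact: continuous_cos.
    exact: measurable_funM.
  by move=> xi; rewrite normrM ger0_norm ?expR_ge0// ler_piMr ?expR_ge0// cos_max.
by apply: eq_Rintegral => xi _; rewrite /w; ring.
Qed.

Let K0 e z : 0 < e -> 0 <= K e z.
Proof.
move=> e0; rewrite /K divr_ge0//; first by rewrite mulr_ge0// ltW.
by rewrite addr_ge0 ?sqr_ge0.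
Qed.

Let Kle e z : 0 < e -> K e z <= 2 / e.
Proof.
move=> e0; rewrite /K ler_pdivrMr; last by rewrite ltr_pwDl ?exprn_gt0 ?sqr_ge0.
have -> : 2 / e * (e ^+ 2 + z ^+ 2) = 2 * e + 2 / e * z ^+ 2 by field; rewrite gt_eqF.
by rewrite lerDl mulr_ge0 ?sqr_ge0// divr_ge0// ltW.
Qed.

Let mK e : 0 < e -> measurable_fun setT (K e).
Proof.
move=> e0; apply: continuous_measurable_fun => z; apply: cvgM; first exact: cvg_cst.
apply: cvgV; first by rewrite gt_eqF// ltr_pwDl ?exprn_gt0 ?sqr_ge0.
by apply: cvgD; [exact: cvg_cst|exact: exprn_continuous].
Qed.

Let mKB e : 0 < e -> measurable_fun setT (fun p : R * R => K e (p.1 - p.2)).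
Proof.
move=> e0; apply: (measurableT_comp (f := K e)); first exact: mK.
exact: measurable_funB.
Qed.

Let mKx e x : 0 < e -> measurable_fun setT (fun y : R => K e (x - y)).
Proof.
move=> e0; apply: (measurableT_comp (f := K e)); first exact: mK.
exact: measurable_funB.
Qed.

(** The substitution y = x - e s reduces the kernel to 2 / (1 + s^2), whence the same total mass for
    every e. *)
Let intK e x : 0 < e -> (\int[leb]_y (K e (x - y))%:E = (2 * pi)%:E)%E.
Proof.
move=> e0; have ne0 : - e != 0 by rewrite oppr_eq0 gt_eqF.
rewrite (@ge0_integral_affine _ (- e) x ne0 (fun y : R => (K e (x - y))%:E)); last 2 first.
- by apply/measurable_EFinP; exact: mKx.
- by move=> y; rewrite lee_fin K0.
rewrite -ge0_integralZl//; last 2 first.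
- apply/measurable_EFinP; apply: (measurableT_comp (f := fun y : R => K e (x - y))).
    exact: mKx.
  by apply: measurable_funD => //; exact: measurable_funM.
- by move=> y _; rewrite lee_fin K0.
under eq_integral => s _.
  rewrite -EFinM (_ : _ * _ = 2 * (1 + (s : R) ^+ 2)^-1); last first.
    rewrite normrN gtr0_norm// /K.
    have -> : x - (- e * s + x) = e * s by ring.
    by field; rewrite !gt_eqF// ltr_pwDl ?sqr_ge0// ?mulr_ge0 ?exprn_gt0 ?sqr_ge0.
  rewrite EFinM.
  over.
rewrite ge0_integralZl//.
- by rewrite ge0_integral_atan -EFinM.
- apply/measurable_EFinP; apply: continuous_measurable_fun => s.
  apply: cvgV; first by rewrite gt_eqF// ltr_pwDl ?sqr_ge0.
  by apply: cvgD; [exact: cvg_cst|exact: exprn_continuous].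
- by move=> s _; rewrite lee_fin invr_ge0 addr_ge0 ?sqr_ge0.
Qed.

(** Expanding the square gives 4 pi |a|^2 - 2 T_ e, so the limit of [T_] is equivalent to the
    vanishing of this nonnegative quantity, which involves only differences of values of [a]. *)
Let defect e : \bar R := (\int[leb]_x \int[leb]_y ((a x - a y) ^+ 2 * K e (x - y))%:E)%E.

Let mshift2 e : measurable_fun setT (fun p : R * R => ((a p.1 - a (p.1 - e * p.2)) ^+ 2 * (2 / (1 + p.2 ^+ 2)))).
Proof.
apply: measurable_funM.
  apply: measurable_funX; apply: measurable_funB; first exact: measurableT_comp.
  apply: (measurableT_comp (f := a)) => //.
  by apply: measurable_funB => //; exact: measurable_funM.
apply: (measurableT_comp (f := fun s : R => 2 / (1 + s ^+ 2))) => //.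
apply: continuous_measurable_fun => s; apply: cvgM; first exact: cvg_cst.
apply: cvgV; first by rewrite gt_eqF// ltr_pwDl ?sqr_ge0.
by apply: cvgD; [exact: cvg_cst|exact: exprn_continuous].
Qed.

(** After y = x - e s the kernel is free of e, which survives only as the translation e s of [a]. *)
Let defect_shift e : 0 < e ->
  defect e = (\int[leb]_s ((2 / (1 + (s : R) ^+ 2))%:E * shift_defect a (e * s)))%E.
Proof.
move=> e0; have ne0 : - e != 0 by rewrite oppr_eq0 gt_eqF.
have h0 (p : R * R) : (0 <= ((a p.1 - a (p.1 - e * p.2)) ^+ 2 * (2 / (1 + p.2 ^+ 2)))%:E)%E.
  by rewrite lee_fin mulr_ge0 ?sqr_ge0// divr_ge0 ?addr_ge0 ?sqr_ge0.
transitivity (\int[leb]_x \int[leb]_s ((a x - a ((x : R) - e * s)) ^+ 2 * (2 / (1 + (s : R) ^+ 2)))%:E)%E.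
  apply: eq_integral => x _.
  rewrite (@ge0_integral_affine _ (- e) x ne0 (fun y : R => ((a x - a y) ^+ 2 * K e ((x : R) - y))%:E)); last 2 first.
  - apply/measurable_EFinP; apply: measurable_funM; last exact: mKx.
    by apply: measurable_funX; exact: measurable_funB.
  - by move=> y; rewrite lee_fin mulr_ge0 ?sqr_ge0 ?K0.
  rewrite -ge0_integralZl//; last 2 first.
  - apply/measurable_EFinP.
    apply: (measurableT_comp (f := fun y : R => (a x - a y) ^+ 2 * K e ((x : R) - y))).
      apply: measurable_funM; last exact: mKx.
      by apply: measurable_funX; exact: measurable_funB.
    by apply: measurable_funD => //; exact: measurable_funM.
  - by move=> y _; rewrite lee_fin mulr_ge0 ?sqr_ge0 ?K0.
  apply: eq_integral => s _; rewrite -EFinM normrN gtr0_norm//; congr EFin.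
  rewrite /K.
  have -> : (x : R) - (- e * s + x) = e * s by ring.
  have -> : - e * s + x = (x : R) - e * s by ring.
  by field; rewrite !gt_eqF// ltr_pwDl ?sqr_ge0// ?mulr_ge0 ?exprn_gt0 ?sqr_ge0.
have mE : measurable_fun setT (fun p : R * R => ((a p.1 - a (p.1 - e * p.2)) ^+ 2 * (2 / (1 + p.2 ^+ 2)))%:E).
  by apply/measurable_EFinP; exact: mshift2.
apply: (etrans (@fubini_tonelli _ _ _ _ _ leb leb _ mE h0)).
apply: eq_integral => s _ /=; rewrite /shift_defect -ge0_integralZl//.
- by apply: eq_integral => x _; rewrite -EFinM mulrC.
- apply/measurable_EFinP; apply: measurable_funX; apply: measurable_funB => //.
  by apply: (measurableT_comp (f := a)) => //; exact: measurable_funB.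
- by move=> x _; rewrite lee_fin sqr_ge0.
- by rewrite lee_fin divr_ge0 ?addr_ge0 ?sqr_ge0.
Qed.

Let a2fin : (\int[leb]_x (a x ^+ 2)%:E < +oo)%E.
Proof. by apply: integrable_Rlty => // x; exact: sqr_ge0. Qed.

Let sq := \int[leb]_x (a x ^+ 2).

Let defectE e : 0 < e -> defect e = (4 * pi * sq - 2 * T_ e)%:E.
Proof.
move=> e0.
have KB (p : R * R) : `|K e (p.1 - p.2)| <= 2 / e by rewrite ger0_norm ?K0 ?Kle.
have iK x : leb.-integrable setT (EFin \o (fun y => K e (x - y))).
  apply: ge0_integrable_Rlty; [exact: mKx|by move=> y; exact: K0|].
  by rewrite intK// ltry.
have ibK (b : R -> R) x : leb.-integrable setT (EFin \o b) ->
    leb.-integrable setT (EFin \o (fun y => b y * K e (x - y))).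
  move=> ib; have mb := integrable_mfun ib.
  apply: (@integrable_le _ _ _ leb _ (fun y => (2 / e) * `|b y|)).
  - by apply: measurable_funM => //; exact: mKx.
  - by apply: integrable_RZ; exact: integrable_Rnorm.
  - move=> y; rewrite normrM mulrC ler_wpM2r//.
    exact: (KB (x, y)).
pose P x := \int[leb]_y (a y ^+ 2 * K e (x - y)).
pose Q x := \int[leb]_y (a y * K e (x - y)).
have inner x : (\int[leb]_y ((a x - a y) ^+ 2 * K e (x - y))%:E =
    (2 * pi * a x ^+ 2 + P x - 2 * (a x * Q x))%:E)%E.
  have E y : (a x - a y) ^+ 2 * K e (x - y) =
     (a x ^+ 2 * K e (x - y) + a y ^+ 2 * K e (x - y)) + - 2 * a x * (a y * K e (x - y)) by ring.
  under eq_integral do rewrite E.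
  have i1 : leb.-integrable setT (EFin \o (fun y => a x ^+ 2 * K e (x - y) + a y ^+ 2 * K e (x - y))).
    by apply: integrable_RD; [apply: integrable_RZ; exact: iK|exact: (ibK (fun y => a y ^+ 2) x ia2)].
  have i2 : leb.-integrable setT (EFin \o (fun y => - 2 * a x * (a y * K e (x - y)))).
    exact: (integrable_RZ (- 2 * a x) (ibK a x ia)).
  rewrite -EFin_Rintegral; last exact: integrable_RD.
  congr EFin; rewrite RintegralD// RintegralD//; last 2 first.
  - by apply: integrable_RZ; exact: iK.
  - exact: (ibK (fun y => a y ^+ 2) x ia2).
  rewrite RintegralZl//.
  rewrite (@RintegralZl _ _ _ leb setT (fun y => a y * K e (x - y)) (- 2 * a x) measurableT (ibK a x ia)).
  have -> : \int[leb]_y K e (x - y) = 2 * pi by rewrite /Rintegral intK.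
  by rewrite -/(P x) -/(Q x); ring.
rewrite /defect; under eq_integral do rewrite inner.
have mP : measurable_fun setT (fun p : R * R => a p.2 ^+ 2 * K e (p.1 - p.2)).
  by apply: measurable_funM; [apply: measurable_funX; exact: measurableT_comp|exact: mKB].
have iP : (leb \x leb)%E.-integrable setT (EFin \o (fun p : R * R => a p.2 ^+ 2 * K e (p.1 - p.2))).
  apply/(integrable21ltyP leb leb); first exact/measurable_EFinP.
  have sw y : (\int[leb]_x `|(EFin \o (fun p : R * R => (a p.2 ^+ 2 * K e (p.1 - p.2))%R)) (x, y)| =
      (2 * pi)%:E * (a y ^+ 2)%:E)%E.
    rewrite muleC -(intK y e0) -ge0_integralZl//.
    - apply: eq_integral => x _; rewrite -EFinM /= ger0_norm; last first.
        by apply: mulr_ge0; [exact: sqr_ge0|exact: K0].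
      by rewrite /K -[in RHS]opprB sqrrN.
    all: try by rewrite lee_fin sqr_ge0.
    all: try by move=> x _; rewrite lee_fin K0.
    by apply/measurable_EFinP; exact: mKx.
  under eq_integral do rewrite sw.
  rewrite ge0_integralZl//.
  - by rewrite lte_mul_pinfty// lee_fin mulr_ge0// pi_ge0.
  - by apply/measurable_EFinP; exact: measurable_funX.
  - by move=> y _; rewrite lee_fin sqr_ge0.
  - by rewrite lee_fin mulr_ge0// pi_ge0.
have [iP1 P1] := Rintegral_fubini1 iP; have [_ P2] := Rintegral_fubini2 iP.
have intP : \int[leb]_x P x = 2 * pi * sq.
  rewrite [LHS]P1 -P2 -RintegralZl//; apply: eq_Rintegral => y _ /=.
  have -> : (fun x => a y ^+ 2 * K e ((x : R) - y)) = (fun x => a y ^+ 2 * K e ((y : R) - x)).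
    by apply/funext => x; rewrite /K -[in RHS]opprB sqrrN.
  rewrite RintegralZl//.
  by rewrite /Rintegral intK//= mulrC.
have iaQ : leb.-integrable setT (EFin \o (fun x => a x * Q x)).
  have [+ _] := Rintegral_fubini1 (integrable_bounded_kernel ia ia (mKB e0) KB).
  apply: eq_integrable => // x _ /=; congr EFin.
  rewrite /Q -RintegralZl//; last exact: (ibK a x ia).
  by apply: eq_Rintegral => y _; rewrite mulrA.
have i1 : leb.-integrable setT (EFin \o (fun x => 2 * pi * a x ^+ 2)) by exact: integrable_RZ.
have i3 : leb.-integrable setT (EFin \o (fun x => 2 * (a x * Q x))) by exact: integrable_RZ.
have i12 : leb.-integrable setT (EFin \o (fun x => 2 * pi * a x ^+ 2 + P x)).
  exact: integrable_RD.
rewrite -EFin_Rintegral; last first.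
  have -> : (fun x => 2 * pi * a x ^+ 2 + P x - 2 * (a x * Q x)) =
    (fun x => 2 * pi * a x ^+ 2 + P x + -1 * (2 * (a x * Q x))).
    by apply/funext => x; rewrite mulN1r.
  by apply: integrable_RD => //; exact: integrable_RZ.
congr EFin; rewrite RintegralB// RintegralD// !RintegralZl// intP -/sq /T_ -/Q.
ring.
Qed.

Let en (n : nat) : R := n.+1%:R^-1.

Let en0 n : 0 < en n. Proof. by rewrite /en invr_gt0. Qed.

Let en_cvg (z : R) : en n * z @[n --> \oo] --> 0.
Proof.
rewrite -[X in _ --> X](mul0r z); apply: cvgM; last exact: cvg_cst.
exact: cvg_harmonic.
Qed.

(** Dominated convergence in s: each translation defect tends to 0 and is at most 4 |a|^2, against
    the integrable weight 2 / (1 + s^2). *)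
Let defect_cvg : defect (en n) @[n --> \oo] --> 0%E.
Proof.
have c : continuous (fun s : R => 2 * (1 + s ^+ 2)^-1).
  move=> s; apply: cvgM; first exact: cvg_cst.
  apply: cvgV; first by rewrite gt_eqF// ltr_pwDl ?sqr_ge0.
  by apply: cvgD; [exact: cvg_cst|exact: exprn_continuous].
have k0 (s : R) : 0 <= 2 / (1 + s ^+ 2) by rewrite divr_ge0 ?addr_ge0 ?sqr_ge0.
under eq_fun do rewrite defect_shift//.
have sqE : (\int[leb]_x (a x ^+ 2)%:E)%E = sq%:E by rewrite EFin_Rintegral.
have [] := @dominated_convergence _ _ _ leb setT measurableT
  (fun n (s : R) => ((2 / (1 + s ^+ 2))%:E * shift_defect a (en n * s))%E) (cst 0%E)
  (EFin \o (fun s => 4 * sq * (2 / (1 + s ^+ 2)))).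
- move=> n; apply: emeasurable_funM.
    by apply/measurable_EFinP; exact: continuous_measurable_fun.
  have mF : measurable_fun setT (fun p : R * R => ((a p.2 - a (p.2 - en n * p.1)) ^+ 2)%:E).
    apply/measurable_EFinP; apply: measurable_funX; apply: measurable_funB.
      exact: measurableT_comp.
    apply: (measurableT_comp (f := a)) => //.
    by apply: measurable_funB => //; exact: measurable_funM.
  have F0 (p : R * R) : (0 <= ((a p.2 - a (p.2 - en n * p.1)) ^+ 2)%:E)%E.
    by rewrite lee_fin sqr_ge0.
  have h := @measurable_fun_fubini_tonelli_F _ _ _ _ _ leb _ mF F0.
  exact: h.
- exact: measurable_cst.
- apply: aeW => s _; rewrite -[X in _ --> X](mule0 (2 / (1 + s ^+ 2))%:E).
  apply: cvgeZl => //; apply: shift_defect_cvg0 => //.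
- apply: ge0_integrable_Rlty => [||].
  + by apply: measurable_funM => //; exact: continuous_measurable_fun.
  + by move=> s; rewrite mulr_ge0// mulr_ge0// Rintegral_ge0// => x _; exact: sqr_ge0.
  have -> : (\int[leb]_s (4 * sq * (2 / (1 + s ^+ 2)))%:E =
      \int[leb]_s ((4 * sq * 2)%:E * ((1 + s ^+ 2)^-1)%:E))%E.
    by apply: eq_integral => s _; rewrite -EFinM !mulrA.
  rewrite ge0_integralZl//.
  + by rewrite ge0_integral_atan -EFinM ltry.
  + apply/measurable_EFinP; apply: continuous_measurable_fun => s.
    apply: cvgV; first by rewrite gt_eqF// ltr_pwDl ?sqr_ge0.
    by apply: cvgD; [exact: cvg_cst|exact: exprn_continuous].
  + by move=> s _; rewrite lee_fin invr_ge0 addr_ge0 ?sqr_ge0.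
  + by rewrite lee_fin mulr_ge0// mulr_ge0// Rintegral_ge0// => x _; exact: sqr_ge0.
- apply: aeW => s n _; rewrite gee0_abs; last first.
    by apply: mule_ge0; [rewrite lee_fin|exact: shift_defect_ge0].
  rewrite (_ : (EFin \o _) s = (2 / (1 + s ^+ 2))%:E * (4%:E * sq%:E))%E; last first.
    by rewrite /= -!EFinM; congr EFin; exact: mulrC.
  by apply: lee_wpmul2l; [rewrite lee_fin|rewrite -sqE; exact: shift_defect_le].
by move=> _ _; rewrite integral_cst// mul0e; exact.
Qed.

(** The regularized integral has two limits as e decreases to 0: the Plancherel integral, by
    monotone convergence, and 2 pi |a|^2, by [defectE] and [defect_cvg]. *)
Theorem plancherel_line_real :
  (\int[leb]_xi (C xi ^+ 2 + S xi ^+ 2)%:E = (2 * pi * \int[leb]_x (a x ^+ 2))%:E)%E.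
Proof.
have mCS : measurable_fun setT (fun xi => C xi ^+ 2 + S xi ^+ 2).
  apply: measurable_funD; apply: measurable_funX.
    exact: measurable_cos_transform.
  exact: measurable_sin_transform.
have CS0 xi : 0 <= C xi ^+ 2 + S xi ^+ 2 by rewrite addr_ge0 ?sqr_ge0.
have h1 : regularized (en n) @[n --> \oo] --> (\int[leb]_xi (C xi ^+ 2 + S xi ^+ 2)%:E)%E.
  have := @cvg_monotone_convergence _ _ _ leb setT measurableT
    (fun n xi => (w (en n) xi * (C xi ^+ 2 + S xi ^+ 2))%:E).
  rewrite (_ : (\int[leb]_x limn _)%E = (\int[leb]_xi (C xi ^+ 2 + S xi ^+ 2)%:E)%E); last first.
    apply: eq_integral => xi _; apply/cvg_lim => //.
    apply: cvg_EFin; first exact: nearW.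
    rewrite /comp/= -[X in _ --> X]mul1r; apply: cvgM; last exact: cvg_cst.
    rewrite /w -[X in _ --> X]expR0 -[in X in _ --> X]oppr0.
    apply: (@cvg_comp _ _ _ (fun n => - (en n * `|xi|)) expR); last exact: continuous_expR.
    by apply: cvgN; exact: en_cvg.
  apply.
  - by move=> n; apply/measurable_EFinP; apply: measurable_funM => //; exact: mw.
  - by move=> n xi _; rewrite lee_fin mulr_ge0 ?expR_ge0.
  - move=> xi _ m n mn; rewrite lee_fin ler_wpM2r// ler_expR lerN2 ler_wpM2r//.
    by rewrite /en lef_pV2 ?posrE// ler_nat ltnS.
have h2 : regularized (en n) @[n --> \oo] --> (2 * pi * sq)%:E.
  have -> : (fun n => regularized (en n)) = (fun n => ((2 * pi * sq) - fine (defect (en n)) / 2)%:E).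
    by apply/funext => n; rewrite regularizedE// defectE//=; congr EFin; field.
  apply: cvg_EFin; first exact: nearW.
  rewrite /comp/= -[X in _ --> X]subr0 -[in X in _ --> X](mul0r (2^-1)).
  apply: cvgB; first exact: cvg_cst.
  by apply: cvgM; [exact: (fine_cvg defect_cvg)|exact: cvg_cst].
exact: (cvg_unique _ h1 h2).
Qed.

End plancherel_line.

(** * From real to complex functions on the line *)

Section plancherel_line_complex.
Context {R : realType}.
Local Notation leb := (@lebesgue_measure R).
Variables a b : R -> R.
Hypothesis ia : leb.-integrable setT (EFin \o a).
Hypothesis ia2 : leb.-integrable setT (EFin \o (fun x => a x ^+ 2)).
Hypothesis ib : leb.-integrable setT (EFin \o b).
Hypothesis ib2 : leb.-integrable setT (EFin \o (fun x => b x ^+ 2)).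

(** For a + i b the cross terms C_a S_b - C_b S_a are odd in xi. They are not integrated: the
    integrand [P] is added to its reflection [M], which has the same integral, and in P + M they
    cancel pointwise. *)
Lemma plancherel_line_pair :
  (\int[leb]_xi ((cos_transform a xi + sin_transform b xi) ^+ 2 +
                 (cos_transform b xi - sin_transform a xi) ^+ 2)%:E =
   (2 * pi * (\int[leb]_x (a x ^+ 2) + \int[leb]_x (b x ^+ 2)))%:E)%E.
Proof.
have mCa := measurable_cos_transform ia; have mSa := measurable_sin_transform ia.
have mCb := measurable_cos_transform ib; have mSb := measurable_sin_transform ib.
have even f xi : cos_transform f (- xi) = cos_transform f xi.
  by apply: eq_Rintegral => x _; rewrite mulNr cosN.
have odd f xi : leb.-integrable setT (EFin \o f) -> sin_transform f (- xi) = - sin_transform f xi.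
  move=> jf; rewrite -[RHS]mulN1r /sin_transform -RintegralZl//.
    by apply: eq_Rintegral => x _; rewrite mulNr sinN mulN1r mulrN.
  apply: (@integrable_le _ _ _ leb _ (fun x => `|f x|)).
  - apply: measurable_funM; first exact: integrable_mfun jf.
    apply: (measurableT_comp (f := @sin R)); last exact: measurable_funM.
    by apply: continuous_measurable_fun; exact: continuous_sin.
  - exact: integrable_Rnorm.
  - by move=> x; rewrite normrM ler_piMr// sin_max.
set P := fun xi => (cos_transform a xi + sin_transform b xi) ^+ 2 +
                 (cos_transform b xi - sin_transform a xi) ^+ 2.
pose M xi := (cos_transform a xi - sin_transform b xi) ^+ 2 +
                 (cos_transform b xi + sin_transform a xi) ^+ 2.
have mP : measurable_fun setT (fun xi => (P xi)%:E).
  by apply/measurable_EFinP; apply: measurable_funD; apply: measurable_funX;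
    [exact: measurable_funD|exact: measurable_funB].
have mM : measurable_fun setT (fun xi => (M xi)%:E).
  by apply/measurable_EFinP; apply: measurable_funD; apply: measurable_funX;
    [exact: measurable_funB|exact: measurable_funD].
have P0 xi : (0 <= (P xi)%:E)%E by rewrite lee_fin addr_ge0 ?sqr_ge0.
have M0 xi : (0 <= (M xi)%:E)%E by rewrite lee_fin addr_ge0 ?sqr_ge0.
have PM : (\int[leb]_xi (P xi)%:E = \int[leb]_xi (M xi)%:E)%E.
  rewrite (ge0_integral_reflection mP P0); apply: eq_integral => xi _.
  by rewrite /P /M !even !odd// opprK.
have two : (\int[leb]_xi (P xi)%:E + \int[leb]_xi (P xi)%:E =
   (2 * (2 * pi * (\int[leb]_x (a x ^+ 2) + \int[leb]_x (b x ^+ 2))))%:E)%E.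
  rewrite {2}PM -ge0_integralD//.
  transitivity (\int[leb]_xi (2%:E * ((cos_transform a xi ^+ 2 + sin_transform a xi ^+ 2)%:E +
     (cos_transform b xi ^+ 2 + sin_transform b xi ^+ 2)%:E)))%E.
    apply: eq_integral => xi _; rewrite -!EFinD -EFinM; congr EFin.
    by rewrite /P /M; ring.
  have m1 : measurable_fun setT (fun xi => (cos_transform a xi ^+ 2 + sin_transform a xi ^+ 2)%:E).
    by apply/measurable_EFinP; apply: measurable_funD; exact: measurable_funX.
  have m2 : measurable_fun setT (fun xi => (cos_transform b xi ^+ 2 + sin_transform b xi ^+ 2)%:E).
    by apply/measurable_EFinP; apply: measurable_funD; exact: measurable_funX.
  rewrite ge0_integralZl//; last 2 first.
  - exact: emeasurable_funD.
  - by move=> xi _; rewrite -EFinD lee_fin !addr_ge0 ?sqr_ge0.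
  rewrite ge0_integralD//; last 2 first.
  - by move=> xi _; rewrite lee_fin addr_ge0 ?sqr_ge0.
  - by move=> xi _; rewrite lee_fin addr_ge0 ?sqr_ge0.
  rewrite !plancherel_line_real// -EFinD -EFinM; congr EFin; ring.
have Pge : (0 <= \int[leb]_xi (P xi)%:E)%E by exact: integral_ge0.
move: two Pge; case: (\int[leb]_xi (P xi)%:E)%E => // r [] two _.
by congr EFin; move: two; lra.
Qed.

End plancherel_line_complex.

(** * Plancherel's identity in R^d *)

Section complex_integral.
Context {disp : measure_display} {T : measurableType disp} {R : realType}.
Context (mu : {measure set T -> \bar R}).
Implicit Types f g : T -> R[i].

(** [cintegral] over an arbitrary measure, because partial transforms integrate over the line
    alone. *)
Definition cint f : R[i] :=
  ((\int[mu]_x complex.Re (f x)) +i* (\int[mu]_x complex.Im (f x)))%C.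

Definition cmeas f := measurable_fun setT (fun x => complex.Re (f x)) /\
  measurable_fun setT (fun x => complex.Im (f x)).

Definition cinteg f :=
  mu.-integrable setT (EFin \o (fun x => complex.Re (f x))) /\
  mu.-integrable setT (EFin \o (fun x => complex.Im (f x))).

Lemma cinteg_meas f : cinteg f -> cmeas f.
Proof. by move=> [h1 h2]; split; [exact: integrable_mfun h1|exact: integrable_mfun h2]. Qed.

Lemma cmeasM f g : cmeas f -> cmeas g -> cmeas (fun x => f x * g x).
Proof.
move=> [? ?] [? ?]; split; under eq_fun do rewrite reim.
  by apply: measurable_funB; exact: measurable_funM.
by apply: measurable_funD; exact: measurable_funM.
Qed.

Lemma cintegD f g : cinteg f -> cinteg g -> cinteg (fun x => f x + g x).
Proof.
by move=> [? ?] [? ?]; split; under eq_fun do rewrite reim; exact: integrable_RD.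
Qed.

Lemma integrable_RB (f g : T -> R) : mu.-integrable setT (EFin \o f) ->
  mu.-integrable setT (EFin \o g) ->
  mu.-integrable setT (EFin \o (fun x => f x - g x)).
Proof.
move=> hf hg; have -> : (fun x => f x - g x) = (fun x => f x + -1 * g x).
  by apply/funext => x; rewrite mulN1r.
by apply: integrable_RD => //; exact: integrable_RZ.
Qed.

Lemma cintegZ c f : cinteg f -> cinteg (fun x => c * f x).
Proof.
move=> [? ?]; split; under eq_fun do rewrite reim.
  by apply: integrable_RB; exact: integrable_RZ.
by apply: integrable_RD; exact: integrable_RZ.
Qed.

Lemma cintD f g : cinteg f -> cinteg g -> cint (fun x => f x + g x) = cint f + cint g.
Proof.
move=> [? ?] [? ?]; rewrite /cint.
under eq_Rintegral do rewrite reim.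
under [X in (_ +i* X)%C]eq_Rintegral do rewrite reim.
by rewrite !RintegralD.
Qed.

Lemma cintZ c f : cinteg f -> cint (fun x => c * f x) = c * cint f.
Proof.
move=> [? ?]; rewrite /cint.
under eq_Rintegral do rewrite reim.
under [X in (_ +i* X)%C]eq_Rintegral do rewrite reim.
rewrite RintegralB//; [|exact: integrable_RZ..].
rewrite RintegralD//; [|exact: integrable_RZ..].
by rewrite !RintegralZl//; case: c.
Qed.

Lemma cinteg_bounded f g : cmeas g -> cinteg f ->
  (forall x, `|complex.Re (g x)| <= 1) -> (forall x, `|complex.Im (g x)| <= 1) ->
  cinteg (fun x => g x * f x).
Proof.
move=> mg cf g1 g2; have [f1 f2] := cf.
have [m1 m2] := cmeasM mg (cinteg_meas cf).
have iN : mu.-integrable setT (EFin \o (fun x => `|complex.Re (f x)| + `|complex.Im (f x)|)).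
  by apply: integrable_RD; exact: integrable_Rnorm.
split; apply: (integrable_le _ iN) => // x; rewrite !reim.
  by rewrite (le_trans (ler_normB _ _))// !normrM lerD// ler_piMl.
rewrite (le_trans (ler_normD _ _))// !normrM addrC lerD//; by rewrite ler_piMl.
Qed.

Lemma cint_ae f g : cmeas f -> cmeas g -> {ae mu, forall x, f x = g x} -> cint f = cint g.
Proof.
move=> [? ?] [? ?] fg; rewrite /cint; congr (_ +i* _)%C; rewrite /Rintegral; congr fine;
  apply: ae_eq_integral => //; try exact/measurable_EFinP;
  by apply: filterS fg => x /= ->.
Qed.

End complex_integral.

Definition cexpN {R : realType} (t : R) : R[i] := (cos t -i* sin t)%C.

Lemma cexpND (R : realType) (s t : R) : cexpN (s + t) = cexpN s * cexpN t.
Proof.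
apply/eqP; rewrite /cexpN eq_complex/= cosD sinD; apply/andP; split; apply/eqP; ring.
Qed.

Lemma sqc_cexpN (R : realType) (t : R) : sqc (cexpN t) = 1.
Proof. by rewrite /sqc/= sqrrN cos2Dsin2. Qed.

Lemma Re_cexpN_le1 (R : realType) (t : R) : `|complex.Re (cexpN t)| <= 1.
Proof. exact: cos_max. Qed.

Lemma Im_cexpN_le1 (R : realType) (t : R) : `|complex.Im (cexpN t)| <= 1.
Proof. by rewrite /= normrN sin_max. Qed.

Lemma cmeas_cexpN d (T : measurableType d) (R : realType) (f : T -> R) :
  measurable_fun setT f -> cmeas (fun x => cexpN (f x)).
Proof.
move=> mf; split => /=.
  apply: (measurableT_comp (f := @cos R)) => //.
  by apply: continuous_measurable_fun; exact: continuous_cos.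
apply: measurableT_comp => //; apply: (measurableT_comp (f := @sin R)) => //.
by apply: continuous_measurable_fun; exact: continuous_sin.
Qed.

Section dotRd_facts.
Context {R : realType}.

Lemma measurable_dotRd2 d (T : measurableType d) n (f g : T -> Rd R n) :
  measurable_fun setT f -> measurable_fun setT g ->
  measurable_fun setT (fun x => dotRd (f x) (g x)).
Proof.
move=> mf mg; apply: measurable_sum => i; apply: measurable_funM.
  exact: (measurableT_comp (measurable_tnth i) mf).
exact: (measurableT_comp (measurable_tnth i) mg).
Qed.

Lemma dotRd_cons n (a b : R) (x y : Rd R n) :
  dotRd (consRd (a, x)) (consRd (b, y)) = a * b + dotRd x y.
Proof.
rewrite /dotRd big_ord_recl !tnth0; congr (_ + _).
by apply: eq_bigr => i _; rewrite !tnthS.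
Qed.

Lemma fourier_L1E d (f : Rd R d -> R[i]) xi : fourier_L1 f xi =
  ((Num.sqrt (2 * pi)) ^- d)%:C%C *
  cint (lebesgue_Rd d) (fun x => cexpN (dotRd xi x) * f x).
Proof. by []. Qed.

Lemma cmeasurable_fourier_L1 d (f : Rd R d -> R[i]) : cmeasurable f ->
  cmeasurable (fourier_L1 f).
Proof.
move=> [m1 m2].
have mf : cmeas (fun p : Rd R d * Rd R d => f p.2).
  by split; [exact: (measurableT_comp m1 measurable_snd)|exact: (measurableT_comp m2 measurable_snd)].
have mc : cmeas (fun p : Rd R d * Rd R d => cexpN (dotRd p.1 p.2)).
  by apply: cmeas_cexpN; exact: measurable_dotRd2.
have [h1 h2] := cmeasM mc mf.
apply: cmeasurableZ; split.
  exact: (measurable_Rintegral (lebesgue_Rd d) h1).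
exact: (measurable_Rintegral (lebesgue_Rd d) h2).
Qed.

End dotRd_facts.

Section plancherel_complex_line.
Context {R : realType}.
Local Notation leb := (@lebesgue_measure R).

Lemma integrable_of_sqc disp (T : measurableType disp) (mu : {measure set T -> \bar R})
    (u : T -> R[i]) : cmeas u -> (\int[mu]_x (sqc (u x))%:E < +oo)%E ->
  mu.-integrable setT (EFin \o (fun x => complex.Re (u x) ^+ 2)) /\
  mu.-integrable setT (EFin \o (fun x => complex.Im (u x) ^+ 2)).
Proof.
move=> [m1 m2] uoo.
have hs : mu.-integrable setT (EFin \o (fun x => sqc (u x))).
  apply: ge0_integrable_Rlty uoo => [|x]; last exact: sqc_ge0.
  by apply: measurable_funD; exact: measurable_funX.
split; apply: (integrable_le _ hs).
- exact: measurable_funX.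
- by move=> x; rewrite ger0_norm ?sqr_ge0// /sqc lerDl sqr_ge0.
- exact: measurable_funX.
- by move=> x; rewrite ger0_norm ?sqr_ge0// /sqc lerDr sqr_ge0.
Qed.

Lemma plancherel_line (u : R -> R[i]) : cinteg leb u ->
  (\int[leb]_x (sqc (u x))%:E < +oo)%E ->
  (\int[leb]_xi (sqc (cint leb (fun x => cexpN (xi * x) * u x)))%:E =
   (2 * pi)%:E * \int[leb]_x (sqc (u x))%:E)%E.
Proof.
move=> cu uoo; have [ia ib] := cu.
have [ia2 ib2] := integrable_of_sqc (cinteg_meas cu) uoo.
have h := plancherel_line_pair ia ia2 ib ib2.
have -> : (\int[leb]_x (sqc (u x))%:E =
  (\int[leb]_x (complex.Re (u x) ^+ 2) + \int[leb]_x (complex.Im (u x) ^+ 2))%:E)%E.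
  by rewrite -RintegralD// -EFin_Rintegral//; exact: integrable_RD.
rewrite -EFinM -h; apply: eq_integral => xi _; congr EFin.
have mc : cmeas (fun x : R => cexpN (xi * x)).
  by apply: cmeas_cexpN; exact: measurable_funM.
have [mc1 mc2] := mc.
have b1 (f : R -> R) : leb.-integrable setT (EFin \o f) ->
    leb.-integrable setT (EFin \o (fun x => f x * cos (xi * x))).
  move=> jf; apply: (integrable_le _ (integrable_Rnorm jf)).
    by apply: measurable_funM => //; exact: integrable_mfun jf.
  by move=> x; rewrite normrM ler_piMr// cos_max.
have b2 (f : R -> R) : leb.-integrable setT (EFin \o f) ->
    leb.-integrable setT (EFin \o (fun x => f x * sin (xi * x))).
  move=> jf; apply: (integrable_le _ (integrable_Rnorm jf)).
    apply: measurable_funM; first exact: integrable_mfun jf.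
    apply: (measurableT_comp (f := @sin R)); last exact: measurable_funM.
    by apply: continuous_measurable_fun; exact: continuous_sin.
  by move=> x; rewrite normrM ler_piMr// sin_max.
rewrite /sqc /cint /=; congr (_ ^+ 2 + _ ^+ 2).
  rewrite -RintegralD//; [|exact: (b1 _ ia)|exact: (b2 _ ib)].
  by apply: eq_Rintegral => x _; rewrite !reim/=; ring.
rewrite -RintegralB//; [|exact: (b1 _ ib)|exact: (b2 _ ia)].
by apply: eq_Rintegral => x _; rewrite !reim/=; ring.
Qed.

End plancherel_complex_line.

Section plancherel_Rd.
Context {R : realType}.
Local Notation leb := (@lebesgue_measure R).

Lemma cinteg_consRd d (f : Rd R d.+1 -> R[i]) : cinteg (lebesgue_Rd d.+1) f ->
  cinteg (leb \x lebesgue_Rd d)%E (fun p => f (consRd p)).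
Proof. by move=> [h1 h2]; split; [exact: (integrable_consRd h1)|exact: (integrable_consRd h2)]. Qed.

Lemma cint_consRd d (f : Rd R d.+1 -> R[i]) : cinteg (lebesgue_Rd d.+1) f ->
  cinteg (lebesgue_Rd d) (fun y => cint leb (fun x => f (consRd (x, y)))) /\
  cint (lebesgue_Rd d.+1) f =
  cint (lebesgue_Rd d) (fun y => cint leb (fun x => f (consRd (x, y)))).
Proof.
move=> cf; have [h1 h2] := cinteg_consRd cf; have [f1 f2] := cf.
have [i1 e1] := Rintegral_fubini2 h1; have [i2 e2] := Rintegral_fubini2 h2.
split; first by split.
rewrite /cint; congr (_ +i* _)%C.
  by apply: (etrans _ (esym e1)); rewrite /Rintegral (integral_consRd f1).
by apply: (etrans _ (esym e2)); rewrite /Rintegral (integral_consRd f2).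
Qed.

Variable d : nat.
Local Notation mu := (@lebesgue_Rd R d).

Lemma ge0_integral_consRd_iter1 (F : Rd R d.+1 -> \bar R) : measurable_fun setT F ->
  (forall x, (0 <= F x)%E) ->
  (\int[lebesgue_Rd d.+1]_x F x = \int[leb]_a \int[mu]_y F (consRd (a, y)))%E.
Proof.
move=> mF F0; rewrite ge0_integral_consRd//.
have mFc : measurable_fun setT (F \o @consRd R d) := measurableT_comp mF (@measurable_consRd R d).
exact: (@fubini_tonelli1 _ _ _ _ _ leb mu _ mFc (fun p => F0 _)).
Qed.

Lemma ge0_integral_consRd_iter2 (F : Rd R d.+1 -> \bar R) : measurable_fun setT F ->
  (forall x, (0 <= F x)%E) ->
  (\int[lebesgue_Rd d.+1]_x F x = \int[mu]_y \int[leb]_a F (consRd (a, y)))%E.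
Proof.
move=> mF F0; rewrite ge0_integral_consRd//.
have mFc : measurable_fun setT (F \o @consRd R d) := measurableT_comp mF (@measurable_consRd R d).
exact: (@fubini_tonelli2 _ _ _ _ _ leb mu _ mFc (fun p => F0 _)).
Qed.

Variable u : Rd R d.+1 -> R[i].
Hypothesis cu : cinteg (lebesgue_Rd d.+1) u.
Hypothesis uoo : (csq u < +oo)%E.

Let c1 : R[i] := ((Num.sqrt (2 * pi))^-1)%:C%C.

(** Fourier transform in the first coordinate only, the others being parameters; its normalizing
    factor is kept apart as [c1]. *)
Let partial (p : measurableTypeR R * Rd R d) : R[i] :=
  cint leb (fun x => cexpN ((p.1 : R) * x) * u (consRd (x, p.2))).

Let mu2 : cmeas u := cinteg_meas cu.

Let mpartial : cmeas partial.
Proof.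
have mexp : cmeas (fun q : (measurableTypeR R * Rd R d) * measurableTypeR R =>
    cexpN ((q.1.1 : R) * q.2)).
  apply: cmeas_cexpN; apply: measurable_funM => //.
  exact: (measurableT_comp measurable_fst measurable_fst).
have mcons : measurable_fun setT
    (fun q : (measurableTypeR R * Rd R d) * measurableTypeR R => consRd (q.2, q.1.2)).
  apply: (measurableT_comp (f := @consRd R d)); first exact: measurable_consRd.
  apply: measurable_fun_pair => //.
  exact: (measurableT_comp measurable_snd measurable_fst).
have mu' : cmeas (fun q : (measurableTypeR R * Rd R d) * measurableTypeR R =>
    u (consRd (q.2, q.1.2))).
  by split; [exact: (measurableT_comp mu2.1 mcons)|exact: (measurableT_comp mu2.2 mcons)].
have [h1 h2] := cmeasM mexp mu'.
by split; [exact: (measurable_Rintegral leb h1)|exact: (measurable_Rintegral leb h2)].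
Qed.

Let cu_exp (xi0 : R) : cinteg (lebesgue_Rd d.+1) (fun x => cexpN (xi0 * thead x) * u x).
Proof.
apply: cinteg_bounded => //; last 2 first.
- by move=> x; exact: Re_cexpN_le1.
- by move=> x; exact: Im_cexpN_le1.
apply: cmeas_cexpN; apply: measurable_funM => //; exact: measurable_tnth.
Qed.

Let cpartial xi0 : cinteg mu (fun y => partial (xi0, y)).
Proof.
have [h _] := cint_consRd (cu_exp xi0); move: h.
congr cinteg.
Qed.

Let fourier_partial (xi0 : R) (eta : Rd R d) :
  fourier_L1 u (consRd (xi0, eta)) = fourier_L1 (fun y => c1 * partial (xi0, y)) eta.
Proof.
rewrite !fourier_L1E.
have ce : cinteg mu (fun y => cexpN (dotRd eta y) * partial (xi0, y)).
  apply: cinteg_bounded => //.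
  - by apply: cmeas_cexpN; exact: measurable_dotRd2.
  - by move=> x; exact: Re_cexpN_le1.
  - by move=> x; exact: Im_cexpN_le1.
rewrite (_ : (fun x => cexpN (dotRd eta x) * (c1 * partial (xi0, x))) =
   (fun x => c1 * (cexpN (dotRd eta x) * partial (xi0, x)))); last first.
  by apply/funext => x; rewrite mulrCA.
rewrite cintZ// mulrA; congr (_ * _).
  by rewrite /c1 -rmorphM/= -exprVn -[in RHS]exprVn exprSr.
have cE : cinteg (lebesgue_Rd d.+1) (fun x => cexpN (dotRd (consRd (xi0, eta)) x) * u x).
  apply: cinteg_bounded => //.
  - by apply: cmeas_cexpN; exact: measurable_dotRd2.
  - by move=> x; exact: Re_cexpN_le1.
  - by move=> x; exact: Im_cexpN_le1.
have [ci ->] := cint_consRd cE.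
apply: cint_ae; [exact: (cinteg_meas ci)|exact: (cinteg_meas ce)|].
(* Pulling the phase of the remaining coordinates out of the integral along the line requires
   integrable slices, which exist for almost every y. *)
have [h1 h2] := cinteg_consRd (cu_exp xi0).
apply: filterS2 (ae_integrable2 h1) (ae_integrable2 h2) => y k1 k2.
rewrite /partial -cintZ; last by split.
congr cint; apply/funext => x.
by rewrite dotRd_cons cexpND mulrA [cexpN (xi0 * x) * _]mulrC.
Qed.

Let sqc_c1 z : sqc (c1 * z) = (2 * pi)^-1 * sqc z.
Proof.
by rewrite sqcM /c1 sqc_real exprVn sqr_sqrtr// mulr_ge0// pi_ge0.
Qed.

Let measurable_sqc' disp (T : measurableType disp) (f : T -> R[i]) : cmeas f ->
  measurable_fun setT (fun x => (sqc (f x))%:E).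
Proof.
by move=> [? ?]; apply/measurable_EFinP; apply: measurable_funD; exact: measurable_funX.
Qed.

(** For almost every y the slice of u is both integrable and square integrable, so the
    one-dimensional identity applies to it, its factor 2 pi being absorbed by [c1]. *)
Let partial_sq : (\int[leb]_xi0 \int[mu]_y (sqc (c1 * partial (xi0, y)))%:E = csq u)%E.
Proof.
have mcp : cmeas (fun p => c1 * partial p).
  by apply: cmeasM => //; split; exact: measurable_cst.
have ms := measurable_sqc' mcp.
have s0 p : (0 <= (sqc (c1 * partial p))%:E)%E by rewrite lee_fin sqc_ge0.
apply: (etrans (@fubini_tonelli _ _ _ _ _ leb mu _ ms s0)).
have msu := measurable_sqc' mu2.
have su0 x : (0 <= (sqc (u x))%:E)%E by rewrite lee_fin sqc_ge0.
rewrite /csq (ge0_integral_consRd_iter2 msu su0).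
have msuc : measurable_fun setT (fun p => (sqc (u (@consRd R d p)))%:E).
  exact: (measurableT_comp msu (@measurable_consRd R d)).
have mfst : measurable_fun setT (fun y => \int[leb]_x (sqc (c1 * partial (x, y)))%:E)%E.
  exact: (@measurable_fun_fubini_tonelli_G _ _ _ _ _ leb _ ms s0).
have msnd : measurable_fun setT (fun y => \int[leb]_x (sqc (u (consRd (x, y))))%:E)%E.
  exact: (@measurable_fun_fubini_tonelli_G _ _ _ _ _ leb _ msuc (fun p => su0 _)).
have iprod : (leb \x mu)%E.-integrable setT (EFin \o (fun p => sqc (u (@consRd R d p)))).
  apply: ge0_integrable_Rlty => [|p|]; first exact/measurable_EFinP.
    exact: sqc_ge0.
  by move: uoo; rewrite /csq ge0_integral_consRd.
have [h1 h2] := cinteg_consRd cu.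
apply: ae_eq_integral => //.
apply: filterS3 (ae_integrable2 h1) (ae_integrable2 h2) (ae_integrable2 iprod) => y k1 k2 k3 _.
have ky : (\int[leb]_x (sqc (u (consRd (x, y))))%:E < +oo)%E.
  apply: (@integrable_Rlty _ _ _ leb (fun x => sqc (u (consRd (x, y))))) => //.
  by move=> x; exact: sqc_ge0.
have cuy : cinteg leb (fun x => u (consRd (x, y))) by split.
have pl := plancherel_line cuy ky.
have pi2 : 0 < 2 * pi :> R by rewrite mulr_gt0// pi_gt0.
have mxy : measurable_fun setT (fun x : measurableTypeR R => (sqc (partial (x, y)))%:E).
  exact: (measurable_fun_pair1 y (measurable_sqc' mpartial)).
under eq_integral do rewrite sqc_c1 EFinM.
rewrite ge0_integralZl//; last 2 first.
- by move=> x _; rewrite lee_fin sqc_ge0.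
- by rewrite lee_fin invr_ge0 ltW.
rewrite [X in (_ * X)%E](_ : _ = (2 * pi)%:E * \int[leb]_x (sqc (u (consRd (x, y))))%:E)%E.
  by rewrite muleA -EFinM mulVf ?mul1e// gt_eqF.
by rewrite -pl.
Qed.

(** By [partial_sq], the partial transform at almost every fixed xi0 is square integrable in the
    remaining coordinates, and the hypothesis in dimension d applies to it. *)
Lemma plancherel_step :
  (forall v : Rd R d -> R[i], cinteg mu v -> (csq v < +oo)%E -> csq (fourier_L1 v) = csq v) ->
  csq (fourier_L1 u) = csq u.
Proof.
move=> IH.
have mF := measurable_sqc' (cmeasurable_fourier_L1 mu2).
have F0 x : (0 <= (sqc (fourier_L1 u x))%:E)%E by rewrite lee_fin sqc_ge0.
rewrite [LHS](ge0_integral_consRd_iter1 mF F0).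
have mFc : measurable_fun setT (fun p => (sqc (fourier_L1 u (@consRd R d p)))%:E).
  exact: (measurableT_comp mF (@measurable_consRd R d)).
have mcp : cmeas (fun p => c1 * partial p).
  by apply: cmeasM => //; split; exact: measurable_cst.
have ms := measurable_sqc' mcp.
have s0 p : (0 <= (sqc (c1 * partial p))%:E)%E by rewrite lee_fin sqc_ge0.
have iprod : (leb \x mu)%E.-integrable setT (EFin \o (fun p => sqc (c1 * partial p))).
  apply: ge0_integrable_Rlty => [|p|]; first exact/measurable_EFinP.
    exact: sqc_ge0.
  rewrite (@fubini_tonelli1 _ _ _ _ _ leb mu _ ms s0).
  by rewrite (le_lt_trans _ uoo)// -partial_sq.
rewrite -partial_sq; apply: ae_eq_integral => //.
- exact: (@measurable_fun_fubini_tonelli_F _ _ _ _ _ mu _ mFc (fun p => F0 _)).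
- exact: (@measurable_fun_fubini_tonelli_F _ _ _ _ _ mu _ ms s0).
apply: filterS (ae_integrable1 iprod) => xi0 k _.
have vfin : (csq (fun y => c1 * partial (xi0, y))%R < +oo)%E.
  apply: (@integrable_Rlty _ _ _ mu (fun y => sqc (c1 * partial (xi0, y)))) => //.
  by move=> y; exact: sqc_ge0.
have := IH _ (cintegZ c1 (cpartial xi0)) vfin.
rewrite /csq => <-; apply: eq_integral => eta _.
by rewrite fourier_partial.
Qed.

End plancherel_Rd.

Theorem plancherel_L1 (R : realType) d (u : Rd R d -> R[i]) :
  cinteg (lebesgue_Rd d) u -> (csq u < +oo)%E -> csq (fourier_L1 u) = csq u.
Proof.
elim: d u => [|d IH] u cu uoo; last exact: plancherel_step.
(* In dimension 0 the measure is a unit mass at the empty tuple and the transform is the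
   identity. *)
have cexp0 (x y : Rd R 0) : cexpN (dotRd x y) = 1.
  by rewrite /dotRd big_ord0 /cexpN cos0 sin0 oppr0.
have [m1 m2] := cinteg_meas cu.
have diracE (f : Rd R 0 -> R) : measurable_fun setT f ->
    \int[lebesgue_Rd 0]_x f x = f [tuple].
  move=> mf; have /= h := @integral_dirac _ _ ([tuple] : Rd R 0) R setT measurableT (EFin \o f).
  by rewrite /Rintegral h ?diracT ?mul1e//; exact/measurable_EFinP.
apply: eq_integral => x _; congr (sqc _)%:E.
rewrite fourier_L1E expr0 invr1 rmorph1 mul1r.
under [X in cint _ X]eq_fun do rewrite cexp0 mul1r.
rewrite /cint !diracE// (tuple0 x).
by case: (u _).
Qed.

(** * The Fourier transform on L^2 *)

Section fourier_graph.
Context {R : realType} (d : nat).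
Implicit Types (f g h : Rd R d -> R[i]).
Local Notation mu := (@lebesgue_Rd R d).
Local Notation L2 := (cLp 2%:E).

Lemma Re_le_normc (z : R[i]) : `|complex.Re z| <= ComplexField.Normc.normc z.
Proof.
case: z => a b /=; rewrite -sqrtr_sqr ler_wsqrtr//.
by rewrite lerDl sqr_ge0.
Qed.

Lemma Im_le_normc (z : R[i]) : `|complex.Im z| <= ComplexField.Normc.normc z.
Proof.
case: z => a b /=; rewrite -[X in X <= _]sqrtr_sqr ler_wsqrtr//.
by rewrite lerDr sqr_ge0.
Qed.

Lemma normc_le (z : R[i]) :
  ComplexField.Normc.normc z <= `|complex.Re z| + `|complex.Im z|.
Proof.
case: z => a b /=.
rewrite -[leRHS](@ger0_norm _ (`|a| + `|b|)) ?addr_ge0// -sqrtr_sqr ler_wsqrtr//.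
rewrite sqrrD !real_normK ?num_real// lerD2r lerDl mulrn_wge0// mulr_ge0//.
Qed.

Lemma measurable_normc f : cmeasurable f ->
  measurable_fun setT (fun x => ComplexField.Normc.normc (f x)).
Proof.
move=> mf; rewrite (_ : (fun x => _) = (fun x => Num.sqrt (sqc (f x)))); last first.
  by apply/funext => x; case: (f x).
apply: (measurableT_comp (f := @Num.sqrt R)); last exact: measurable_sqc.
by apply: continuous_measurable_fun => x; exact: sqrt_continuous.
Qed.

Lemma cLp1P f : cLp 1%:E f <-> cinteg mu f.
Proof.
split=> [[mf]|cf].
  rewrite /cLnorm Lnorm1 => foo.
  have iN : mu.-integrable setT (EFin \o (fun x => ComplexField.Normc.normc (f x))).
    apply/integrableP; split => //; apply/measurable_EFinP; exact: measurable_normc.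
  split; apply: (integrable_le _ iN); [exact: mf.1| |exact: mf.2|].
    by move=> x; exact: Re_le_normc.
  by move=> x; exact: Im_le_normc.
have mf : cmeasurable f := cinteg_meas cf.
split => //; rewrite /mkset /cLnorm Lnorm1.
have [h1 h2] := cf.
have iN : mu.-integrable setT (EFin \o (fun x => `|complex.Re (f x)| + `|complex.Im (f x)|)).
  by apply: integrable_RD; exact: integrable_Rnorm.
have : mu.-integrable setT (EFin \o (fun x => ComplexField.Normc.normc (f x))).
  apply: (integrable_le _ iN); first exact: measurable_normc.
  by move=> x; rewrite ger0_norm ?normc_ge0'// normc_le.
by case/integrableP.
Qed.

Lemma cinteg_cexpN f (a : Rd R d) : cinteg mu f ->
  cinteg mu (fun x => cexpN (dotRd a x) * f x).
Proof.
move=> cf; apply: cinteg_bounded => //.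
- by apply: cmeas_cexpN; exact: measurable_dotRd2.
- by move=> x; exact: Re_cexpN_le1.
- by move=> x; exact: Im_cexpN_le1.
Qed.

Lemma fourier_L1D f g xi : cinteg mu f -> cinteg mu g ->
  fourier_L1 (fun x => f x + g x) xi = fourier_L1 f xi + fourier_L1 g xi.
Proof.
move=> cf cg; rewrite !fourier_L1E -mulrDr -cintD; try exact: cinteg_cexpN.
by congr (_ * cint _ _); apply/funext => x; rewrite mulrDr.
Qed.

Lemma fourier_L1Z c f xi : cinteg mu f ->
  fourier_L1 (fun x => c * f x) xi = c * fourier_L1 f xi.
Proof.
move=> cf; rewrite !fourier_L1E [RHS]mulrCA -[in RHS]cintZ; last exact: cinteg_cexpN.
by congr (_ * cint _ _); apply/funext => x; rewrite mulrCA.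
Qed.

Lemma dotRd_shift (a xi x : Rd R d) : dotRd (shiftRd a xi) x = dotRd a x + dotRd xi x.
Proof.
rewrite /dotRd -big_split/=; apply: eq_bigr => i _.
by rewrite tnth_mktuple mulrDl addrC.
Qed.

Lemma fourier_L1_modulation f (a xi : Rd R d) :
  fourier_L1 (fun x => cexpN (dotRd a x) * f x) xi = fourier_L1 f (shiftRd a xi).
Proof.
rewrite !fourier_L1E; congr (_ * cint _ _); apply/funext => x.
by rewrite dotRd_shift cexpND mulrA [cexpN (dotRd xi x) * _]mulrC.
Qed.

Lemma plancherel_L2 (u : Rd R d -> R[i]) : cLp 1%:E u -> L2 u ->
  L2 (fourier_L1 u) /\ N2 (fourier_L1 u) = N2 u.
Proof.
move=> /cLp1P cu Lu; have h := plancherel_L1 cu (L2_lty Lu).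
split; last by rewrite /N2 h.
by apply/L2P; split; [apply: cmeasurable_fourier_L1; exact: L2_meas|rewrite h; exact: L2_lty].
Qed.

Lemma cvg_N2 (u : nat -> Rd R d -> R[i]) f : (forall n, L2 (u n)) -> L2 f ->
  N2 (fun x => u n x - f x) @[n --> \oo] --> 0 -> N2 (u n) @[n --> \oo] --> N2 f.
Proof.
move=> Lu Lf; move/cvgr0Pnorm_le => h; apply/cvgrPdist_le => e e0.
have := h e e0; apply: filterS => n; rewrite ger0_norm ?N2_ge0// => hn.
rewrite (le_trans _ hn)// ler_norml; apply/andP; split.
  by rewrite lerNl opprB lerBlDr; exact: N2_le_sub.
by rewrite lerBlDr N2_sub_sym; exact: N2_le_sub.
Qed.

Lemma fourier_L2l f h : fourier f h -> L2 f. Proof. by case. Qed.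
Lemma fourier_L2r f h : fourier f h -> L2 h. Proof. by case. Qed.

Lemma fourierP f h : fourier f h <-> [/\ L2 f, L2 h &
  exists u : nat -> Rd R d -> R[i], [/\ forall n, cLp 1%:E (u n), forall n, L2 (u n),
    N2 (fun x => u n x - f x) @[n --> \oo] --> 0 &
    N2 (fun x => fourier_L1 (u n) x - h x) @[n --> \oo] --> 0]].
Proof.
split=> -[Lf Lh [u]].
  move=> [u12 uf uh]; split => //; exists u.
  have u1 n : cLp 1%:E (u n) by have [] := u12 n.
  have u2 n : L2 (u n) by have [] := u12 n.
  split => //; first by apply/L2_cvgP.
  by apply/L2_cvgP => // n; have [] := plancherel_L2 (u1 n) (u2 n).
move=> [u1 u2 uf uh]; split => //; exists u; split => //; first by apply/L2_cvgP.
by apply/L2_cvgP => // n; have [] := plancherel_L2 (u1 n) (u2 n).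
Qed.

Lemma fourier_N2 f h : fourier f h -> N2 h = N2 f.
Proof.
move=> /fourierP[Lf Lh [u [u1 u2 uf uh]]].
have h1 := cvg_N2 u2 Lf uf.
have Lu n : L2 (fourier_L1 (u n)) by have [] := plancherel_L2 (u1 n) (u2 n).
have h2 := cvg_N2 Lu Lh uh.
have E : (fun n => N2 (fourier_L1 (u n))) = (fun n => N2 (u n)).
  by apply/funext => n; have [] := plancherel_L2 (u1 n) (u2 n).
by rewrite E in h2; exact: (cvg_unique _ h2 h1).
Qed.

Lemma cvg0_le (x y : nat -> R) : (forall n, 0 <= x n <= y n) ->
  y n @[n --> \oo] --> 0 -> x n @[n --> \oo] --> 0.
Proof.
move=> xy y0; apply: (squeeze_cvgr _ (cvg_cst 0) y0).
by apply: nearW => n /=; exact: xy.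
Qed.

Lemma fourierD f h f' h' : fourier f h -> fourier f' h' ->
  fourier (fun x => f x + f' x) (fun x => h x + h' x).
Proof.
move=> /fourierP[Lf Lh [u [u1 u2 uf uh]]] /fourierP[Lf' Lh' [u' [u1' u2' uf' uh']]].
apply/fourierP; split; [exact: L2D|exact: L2D|].
have Lu n : L2 (fourier_L1 (u n)) by have [] := plancherel_L2 (u1 n) (u2 n).
have Lu' n : L2 (fourier_L1 (u' n)) by have [] := plancherel_L2 (u1' n) (u2' n).
exists (fun n x => u n x + u' n x); split.
- by move=> n; apply/cLp1P; apply: cintegD; apply/cLp1P.
- by move=> n; exact: L2D.
- apply: (@cvg0_le _ (fun n => N2 (fun x => u n x - f x) + N2 (fun x => u' n x - f' x))).
    move=> n; rewrite N2_ge0/=.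
    rewrite (le_trans _ (N2D_le (L2B (u2 n) Lf) (L2B (u2' n) Lf')))//.
    by rewrite le_eqVlt; apply/orP; left; apply/eqP; congr N2; apply/funext => x; ring.
  by rewrite -[X in _ --> X]addr0; exact: cvgD.
apply: (@cvg0_le _ (fun n => N2 (fun x => fourier_L1 (u n) x - h x) + N2 (fun x => fourier_L1 (u' n) x - h' x))).
  move=> n; rewrite N2_ge0/=.
  rewrite (le_trans _ (N2D_le (L2B (Lu n) Lh) (L2B (Lu' n) Lh')))//.
  rewrite le_eqVlt; apply/orP; left; apply/eqP; congr N2; apply/funext => x.
  by rewrite fourier_L1D; [ring|apply/cLp1P|apply/cLp1P].
by rewrite -[X in _ --> X]addr0; exact: cvgD.
Qed.

Lemma fourierZ c f h : fourier f h -> fourier (fun x => c * f x) (fun x => c * h x).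
Proof.
move=> /fourierP[Lf Lh [u [u1 u2 uf uh]]].
apply/fourierP; split; [exact: L2Z|exact: L2Z|].
have Lu n : L2 (fourier_L1 (u n)) by have [] := plancherel_L2 (u1 n) (u2 n).
exists (fun n x => c * u n x); split.
- by move=> n; apply/cLp1P; apply: cintegZ; apply/cLp1P.
- by move=> n; exact: L2Z.
- rewrite (_ : (fun n => _) = (fun n => Num.sqrt (sqc c) * N2 (fun x => u n x - f x))).
    by rewrite -[X in _ --> X](mulr0 (Num.sqrt (sqc c))); apply: cvgM => //; exact: cvg_cst.
  apply/funext => n; rewrite -N2Z; last exact: L2B.
  by congr N2; apply/funext => x; rewrite mulrBr.
rewrite (_ : (fun n => _) = (fun n => Num.sqrt (sqc c) * N2 (fun x => fourier_L1 (u n) x - h x))).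
  by rewrite -[X in _ --> X](mulr0 (Num.sqrt (sqc c))); apply: cvgM => //; exact: cvg_cst.
apply/funext => n; rewrite -N2Z; last exact: L2B.
by congr N2; apply/funext => x; rewrite fourier_L1Z ?mulrBr//; apply/cLp1P.
Qed.

Lemma fourierB f h f' h' : fourier f h -> fourier f' h' ->
  fourier (fun x => f x - f' x) (fun x => h x - h' x).
Proof.
move=> F F'; have := fourierD F (fourierZ (-1) F').
by congr fourier; apply/funext => x; rewrite mulN1r.
Qed.

(** [fourier] relates functions rather than classes, so a change of representatives has to be an
    explicit step. *)
Lemma fourier_ae f h f' h' : fourier f h -> cmeasurable f' -> cmeasurable h' ->
  f' = f %[ae mu] -> h' = h %[ae mu] -> fourier f' h'.
Proof.
move=> /fourierP[Lf Lh [u [u1 u2 uf uh]]] mf' mh' ff' hh'.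
have Lf' := L2_ae mf' Lf ff'; have Lh' := L2_ae mh' Lh hh'.
apply/fourierP; split => //; exists u; split => //.
  rewrite (_ : (fun n => _) = (fun n => N2 (fun x => u n x - f x)))//.
  apply/funext => n; apply: N2_ae; [exact: L2B|exact: L2B|].
  by apply: filterS ff' => x h1 _; rewrite h1.
have Lu n : L2 (fourier_L1 (u n)) by have [] := plancherel_L2 (u1 n) (u2 n).
rewrite (_ : (fun n => _) = (fun n => N2 (fun x => fourier_L1 (u n) x - h x)))//.
apply/funext => n; apply: N2_ae; [exact: L2B|exact: L2B|].
by apply: filterS hh' => x h1 _; rewrite h1.
Qed.

Lemma cmeasurable_shift f (a : Rd R d) : cmeasurable f ->
  cmeasurable (fun x => f (shiftRd a x)).
Proof.
by move=> [m1 m2]; split;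
  [exact: (measurableT_comp m1 (measurable_shiftRd a))
  |exact: (measurableT_comp m2 (measurable_shiftRd a))].
Qed.

Lemma csq_shift f (a : Rd R d) : cmeasurable f -> csq (fun x => f (shiftRd a x)) = csq f.
Proof.
move=> mf; rewrite /csq; apply/esym.
apply: (ge0_integral_shiftRd a (f := fun x => (sqc (f x))%:E)).
  by apply/measurable_EFinP; exact: measurable_sqc.
by move=> x; rewrite lee_fin sqc_ge0.
Qed.

Lemma N2_shift f (a : Rd R d) : cmeasurable f -> N2 (fun x => f (shiftRd a x)) = N2 f.
Proof. by move=> mf; rewrite /N2 csq_shift. Qed.

Lemma L2_shift f (a : Rd R d) : L2 f -> L2 (fun x => f (shiftRd a x)).
Proof.
move=> /L2P[mf foo]; apply/L2P; split; first exact: cmeasurable_shift.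
by rewrite csq_shift.
Qed.

Lemma cmeasurable_cexpN (a : Rd R d) : cmeasurable (fun x => cexpN (dotRd a x)).
Proof. by apply: cmeas_cexpN; exact: measurable_dotRd2. Qed.

Lemma L2_modulation f (a : Rd R d) : L2 f -> L2 (fun x => cexpN (dotRd a x) * f x).
Proof.
move=> Lf; apply: (L2_dom (C := 1)) (Lf) _.
  by apply: cmeasurableM; [exact: cmeasurable_cexpN|exact: (L2_meas Lf)].
by apply: aeW => x; rewrite sqcM sqc_cexpN mul1r expr1n mul1r.
Qed.

Lemma N2_modulation f (a : Rd R d) : N2 (fun x => cexpN (dotRd a x) * f x) = N2 f.
Proof.
rewrite /N2 /csq; congr (Num.sqrt (fine _)); apply: eq_integral => x _.
by rewrite sqcM sqc_cexpN mul1r.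
Qed.

Lemma fourier_modulation f h (a : Rd R d) : fourier f h ->
  fourier (fun x => cexpN (dotRd a x) * f x) (fun xi => h (shiftRd a xi)).
Proof.
move=> /fourierP[Lf Lh [u [u1 u2 uf uh]]].
apply/fourierP; split; [exact: L2_modulation|exact: L2_shift|].
have Lu n : L2 (fourier_L1 (u n)) by have [] := plancherel_L2 (u1 n) (u2 n).
exists (fun n x => cexpN (dotRd a x) * u n x); split.
- by move=> n; apply/cLp1P; apply: cinteg_cexpN; apply/cLp1P.
- by move=> n; exact: L2_modulation.
- rewrite (_ : (fun n => _) = (fun n => N2 (fun x => u n x - f x)))//.
  apply/funext => n; rewrite -[RHS](N2_modulation _ a); congr N2.
  by apply/funext => x; rewrite mulrBr.
have E n : N2 (fun xi => fourier_L1 (fun x => cexpN (dotRd a x) * u n x) xi - h (shiftRd a xi)) =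
    N2 (fun xi => fourier_L1 (u n) xi - h xi).
  have mB := L2_meas (L2B (Lu n) Lh).
  rewrite -(N2_shift a mB).
  by under eq_fun do rewrite fourier_L1_modulation.
by under eq_fun do rewrite E.
Qed.

(** Polarization of the isometry [fourier_N2]. *)
Lemma fourier_rip f h f' h' : fourier f h -> fourier f' h' -> rip h h' = rip f f'.
Proof.
move=> F F'; have := fourier_N2 (fourierD F F') => /(congr1 (fun x => x ^+ 2)).
rewrite (N2D_sqr (fourier_L2r F) (fourier_L2r F')) (N2D_sqr (fourier_L2l F) (fourier_L2l F')).
by rewrite (fourier_N2 F) (fourier_N2 F') => E; lra.
Qed.

End fourier_graph.

(** * Difference quotients of Psi *)

Section dispersion.
Context {R : realType}.
Variable Psi : R -> R.
Hypothesis mPsi : measurable_fun (`[0, +oo[ : set R) Psi.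
Hypothesis dPsi : forall u : R, 0 < u -> derivable Psi u 1.
Hypothesis Psi_ge0 : forall u : R, 0 <= u -> 0 <= Psi u.
Hypothesis dPsi_ge0 : forall u : R, 0 < u -> 0 <= derive1 Psi u.
Hypothesis Psi0 : Psi 0 = 0.
Variables c2 d2 : R.
Hypotheses (c20 : 0 <= c2) (d20 : 0 <= d2).
Hypothesis Psi_growth : forall u : R, 0 <= u -> u * derive1 Psi u <= c2 * Psi u + d2.

Let K := c2 + d2.

Let isdPsi (u : R) : 0 < u -> is_derive u (1 : R) Psi (derive1 Psi u).
Proof. by move=> u0; split; [exact: dPsi|rewrite derive1E]. Qed.

Let cPsi (u : R) : 0 < u -> {for u, continuous Psi}.
Proof.
by move=> u0; apply: differentiable_continuous; apply/derivable1_diffP; exact: dPsi.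
Qed.

(** Absorbs both constants into one multiple of Psi + 1, which is positive and so has a
    logarithm. *)
Let growth1 (u : R) : 0 < u -> u * derive1 Psi u <= K * (Psi u + 1).
Proof.
move=> u0; rewrite (le_trans (Psi_growth (ltW u0)))//.
have -> : K * (Psi u + 1) = c2 * Psi u + d2 + (d2 * Psi u + c2) by rewrite /K; ring.
by rewrite lerDl addr_ge0// mulr_ge0// Psi_ge0// ltW.
Qed.

Lemma Psi_nondecreasing (u v : R) : 0 <= u -> u <= v -> Psi u <= Psi v.
Proof.
move=> u0 uv; have [u1|u1] := ltP 0 u; last first.
  have -> : u = 0 by apply/eqP; rewrite eq_le u0 u1.
  by rewrite Psi0 Psi_ge0// (le_trans u0).
have h x : x \in `[u, v] -> 0 < x by rewrite in_itv/= => /andP[/(lt_le_trans u1)].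
have [||c cuv E] := @MVT_segment R Psi (derive1 Psi) u v uv.
- by move=> x xuv; apply: isdPsi; apply: h; exact: subset_itv_oo_cc.
- by apply: continuous_in_subspaceT => x; rewrite inE/= => /h /cPsi.
have := mulr_ge0 (dPsi_ge0 (h _ cuv)); rewrite -subr_ge0 E; apply.
by rewrite subr_ge0.
Qed.

(** By [growth1], the function ln (Psi + 1) - K ln has nonpositive derivative; equivalently, Psi + 1
    grows at most like the power u^K. *)
Lemma Psi_doubling (u v : R) : 0 < u -> u <= v ->
  Psi v + 1 <= expR (K * (ln v - ln u)) * (Psi u + 1).
Proof.
move=> u0 uv; have v0 : 0 < v by exact: lt_le_trans uv.
have h x : x \in `[u, v] -> 0 < x by rewrite in_itv/= => /andP[/(lt_le_trans u0)].
have P1 x : 0 < x -> 0 < Psi x + 1 by move=> x0; rewrite ltr_wpDl// Psi_ge0// ltW.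
pose L (x : R) := ln (Psi x + 1) - K * ln x.
pose dL (x : R) := derive1 Psi x / (Psi x + 1) - K / x.
have isdL (x : R) : 0 < x -> is_derive x (1 : R) L (dL x).
  move=> x0; have i1 := isdPsi x0; have i2 := is_derive1_ln x0.
  have i3 := is_derive1_ln (P1 x x0).
  have i4 : is_derive x (1 : R) (fun x => Psi x + 1) (derive1 Psi x).
    by apply: is_derive_eq; rewrite addr0.
  have i5 := @is_derive1_comp _ (@ln R) (fun x => Psi x + 1) x _ _ i3 i4.
  rewrite /L; apply: is_derive_eq; rewrite /GRing.scale/= /dL ?mulr0 ?addr0.
  by rewrite mulrC.
have [||c cuv E] := @MVT_segment R L dL u v uv.
- by move=> x xuv; apply: isdL; apply: h; exact: subset_itv_oo_cc.
- apply: continuous_in_subspaceT => x; rewrite inE/= => /h x0.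
  by apply: differentiable_continuous; apply/derivable1_diffP; have [] := isdL _ x0.
have c0 := h _ cuv.
have dLc : dL c <= 0.
  rewrite /dL subr_le0 ler_pdivrMr ?P1// mulrAC ler_pdivlMr// mulrC.
  exact: growth1.
have : L v - L u <= 0 by rewrite E mulr_le0_ge0// subr_ge0.
rewrite /L subr_le0 => hL.
have : ln (Psi v + 1) <= K * (ln v - ln u) + ln (Psi u + 1).
  by move: hL; rewrite mulrBr; lra.
rewrite -ler_expR expRD !lnK// posrE; exact: P1.
Qed.

Let C4 := expR (K * ln 4).

Let K0 : 0 <= K. Proof. by rewrite addr_ge0. Qed.

Let C41 : 1 <= C4.
Proof. by rewrite -expR0 ler_expR mulr_ge0// ln_ge0// ler1n. Qed.

Lemma Psi_doubling4 (u v : R) : 0 < u -> 0 <= v -> v <= 4 * u ->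
  Psi v + 1 <= C4 * (Psi u + 1).
Proof.
move=> u0 v0 vu.
have P1 : 0 <= Psi u + 1 by rewrite addr_ge0// Psi_ge0// ltW.
have u4 : u <= 4 * u by rewrite ler_peMl ?ler1n// ltW.
rewrite (@le_trans _ _ (Psi (4 * u) + 1))//.
  by rewrite lerD2r Psi_nondecreasing.
rewrite (le_trans (Psi_doubling u0 u4))//.
by rewrite lnM ?posrE// addrK.
Qed.

(** The first summand serves lengths r >= 2 e, through the mean value theorem and doubling; the
    second serves r < 2 e, where the energies before and after the move are at most 5. *)
Definition quotient_constant := 10 * (K * C4) + 2 * Psi 5.

Lemma quotient_constant_ge0 : 0 <= quotient_constant.
Proof.
rewrite /quotient_constant addr_ge0 ?mulr_ge0 ?Psi_ge0//.
by rewrite (le_trans _ C41).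
Qed.

(* [t] is one coordinate of a vector of length [r], and
   [r ^ 2 / 2 + e t + e ^ 2 / 2] is the kinetic energy after moving by [e] along it. *)
Lemma Psi_quotient_bound (r t e : R) : `|t| <= r -> 0 < e <= 1 ->
  `|t * (Psi (r ^+ 2 / 2 + e * t + e ^+ 2 / 2) - Psi (r ^+ 2 / 2))|
     <= e * (quotient_constant * (Psi (r ^+ 2 / 2) + 1)).
Proof.
move=> tr /andP[e0 e1].
have r0 : 0 <= r by exact: le_trans tr.
have /andP[t1 t2] : - r <= t <= r by rewrite -ler_norml.
set a := r ^+ 2 / 2; set b := a + e * t + e ^+ 2 / 2.
have a0 : 0 <= a by rewrite /a divr_ge0// sqr_ge0.
have bE : b = (r ^+ 2 + 2 * e * t + e ^+ 2) / 2 by rewrite /b /a; field.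
have b0 : 0 <= b.
  rewrite bE divr_ge0//; have : 0 <= (r - e) ^+ 2 by exact: sqr_ge0.
  by rewrite sqrrB !expr2 mulr2n => ?; nra.
have Pa := Psi_ge0 a0; have Pb := Psi_ge0 b0.
have CC : 0 <= 10 * (K * C4) by rewrite !mulr_ge0// (le_trans _ C41).
(* Near the origin Psi' is not controlled, but |t| <= r < 2 e already supplies the factor e, and
   monotonicity bounds the increment of Psi by Psi 5. *)
have [re|re] := ltP r (2 * e).
  have a5 : a <= 5 by rewrite /a ler_pdivrMr// expr2; nra.
  have b5 : b <= 5 by rewrite bE ler_pdivrMr// !expr2; nra.
  have P5 : `|Psi b - Psi a| <= Psi 5.
    rewrite ler_norml; apply/andP; split.
      by rewrite lerBrDr (le_trans _ Pb)// addrC subr_le0 Psi_nondecreasing.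
    by rewrite lerBlDr (le_trans (Psi_nondecreasing b0 b5))// lerDl.
  rewrite normrM (@le_trans _ _ (2 * e * Psi 5))//.
    by rewrite ler_pM// (le_trans tr)// ltW.
  rewrite [2 * e]mulrC -mulrA ler_wpM2l ?(ltW e0)//.
  rewrite (@le_trans _ _ (quotient_constant * 1))//.
    by rewrite mulr1 /quotient_constant lerDr.
  by rewrite ler_wpM2l ?quotient_constant_ge0// lerDr.
have rp : 0 < r by rewrite (lt_le_trans _ re)// mulr_gt0.
have ap : 0 < a by rewrite /a divr_gt0// exprn_gt0.
(* For r >= 2 e the move changes the length by at most r / 2, so b and all intermediate energies
   stay in [a / 4, 4 a]: away from 0, and within reach of the doubling bound. *)
have ab : a / 4 <= b.
  have : 0 <= (r - 2 * e) * (r - 2 * e) by rewrite -expr2 sqr_ge0.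
  by rewrite bE /a !expr2 => ?; nra.
have ba : b <= 4 * a by rewrite bE /a !expr2; nra.
have bp : 0 < b by rewrite (lt_le_trans _ ab)// divr_gt0.
have mvt : exists2 c, (a / 4 <= c) /\ (c <= 4 * a) &
    Psi b - Psi a = derive1 Psi c * (b - a).
  have a4 : a / 4 <= a by rewrite ler_pdivrMr// ler_peMr// ler1n.
  have a4' : a <= 4 * a by rewrite ler_peMl ?ler1n// ltW.
  have [abl|bal] := leP a b.
    have h x : x \in `[a, b] -> 0 < x by rewrite in_itv/= => /andP[/(lt_le_trans ap)].
    have [||c cuv E] := @MVT_segment R Psi (derive1 Psi) a b abl.
    - by move=> x xuv; apply: isdPsi; apply: h; exact: subset_itv_oo_cc.
    - by apply: continuous_in_subspaceT => x; rewrite inE/= => /h /cPsi.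
    exists c => //; move: cuv; rewrite in_itv/= => /andP[ac cb].
    by split; [exact: le_trans ac|exact: le_trans ba].
  have h x : x \in `[b, a] -> 0 < x by rewrite in_itv/= => /andP[/(lt_le_trans bp)].
  have [||c cuv E] := @MVT_segment R Psi (derive1 Psi) b a (ltW bal).
  - by move=> x xuv; apply: isdPsi; apply: h; exact: subset_itv_oo_cc.
  - by apply: continuous_in_subspaceT => x; rewrite inE/= => /h /cPsi.
  exists c; last by rewrite -opprB E -mulrN opprB.
  move: cuv; rewrite in_itv/= => /andP[ac cb].
  by split; [exact: le_trans ac|exact: le_trans a4'].
case: mvt => c [c1 cc4] ->.
have cp : 0 < c by rewrite (lt_le_trans _ c1)// divr_gt0.
have dc0 := dPsi_ge0 cp.
(* Here |t| <= r and |t + e / 2| <= 5 r / 4, while r^2 = 2 a <= 8 c; this is the origin of the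
   10. *)
have tb : `|t * (b - a)| <= e * (10 * c).
  have -> : b - a = e * (t + e / 2) by rewrite /b; ring.
  rewrite mulrCA normrM gtr0_norm// ler_wpM2l ?(ltW e0)// normrM.
  have -> : 10 * c = r * (5 / 4 * r) + (10 * c - 5 / 4 * r ^+ 2) by rewrite expr2; ring.
  rewrite (@le_trans _ _ (r * (5 / 4 * r)))//.
    rewrite ler_pM// ler_norml; apply/andP; split; lra.
  by rewrite lerDl; move: c1; rewrite /a; lra.
rewrite mulrCA normrM (ger0_norm dc0).
rewrite (@le_trans _ _ (derive1 Psi c * (e * (10 * c))))// ?ler_wpM2l//.
have -> : derive1 Psi c * (e * (10 * c)) = e * (10 * (c * derive1 Psi c)) by ring.
rewrite ler_wpM2l ?(ltW e0)//.
rewrite (@le_trans _ _ (10 * (K * (C4 * (Psi a + 1)))))//.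
  rewrite ler_wpM2l// (le_trans (growth1 cp))// ler_wpM2l//.
  exact: Psi_doubling4 (ltW cp) cc4.
have -> : 10 * (K * (C4 * (Psi a + 1))) = (10 * (K * C4)) * (Psi a + 1) by ring.
by rewrite ler_wpM2r ?addr_ge0// /quotient_constant lerDl mulr_ge0// Psi_ge0.
Qed.

(** Chain rule for Psi along s -> a + s t + s^2 / 2, whose derivative at 0 is t; the outer factor
    supplies the second t. *)
Lemma Psi_quotient_cvg (a t : R) (e_ : nat -> R) : 0 < a ->
  (forall n, 0 < e_ n) -> e_ n @[n --> \oo] --> 0 ->
  t * (Psi (a + e_ n * t + e_ n ^+ 2 / 2) - Psi a) / e_ n @[n --> \oo]
    --> t ^+ 2 * derive1 Psi a.
Proof.
move=> a0 e0 ecvg.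
pose f (s : R) := a + s * t + s ^+ 2 / 2.
have f0 : f 0 = a by rewrite /f mul0r expr0n/= mul0r !addr0.
have i1 : is_derive (0 : R) (1 : R) f t.
  rewrite /f; apply: is_derive_eq; rewrite /GRing.scale/=; ring.
have i2 : is_derive (f 0) (1 : R) Psi (derive1 Psi a) by rewrite f0; exact: isdPsi.
have [dF DF] := is_derive1_comp i2 i1.
have h : h^-1 *: ((Psi \o f) (h *: (1 : R) + 0) - (Psi \o f) 0) @[h --> (0 : R)^'] -->
    'D_1 (Psi \o f) 0 by exact: dF.
have ne0 n : e_ n != 0 by rewrite gt_eqF.
have {h} := (cvgr_dnbhsP _ _ _).1 h e_ (conj ne0 ecvg).
rewrite DF => h.
rewrite (_ : t ^+ 2 * _ = t * (derive1 Psi a * t)); last by ring.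
rewrite (_ : (fun n => _) = (fun n => t * ((e_ n)^-1 *: ((Psi \o f) (e_ n *: (1 : R) + 0) - (Psi \o f) 0)))).
  by apply: cvgM => //; exact: cvg_cst.
apply/funext => n; rewrite /GRing.scale/= mulr1 addr0 f0 /f; ring.
Qed.

End dispersion.

(** * The virial inequality *)

Section coordinate_translation.
Context {R : realType} (d : nat).
Implicit Types (f g h : Rd R d -> R[i]) (x xi : Rd R d) (j : 'I_d).
Local Notation mu := (@lebesgue_Rd R d).
Local Notation L2 := (cLp 2%:E).

Definition stepRd j (e : R) : Rd R d := [tuple (if i == j then e else 0 : R) | i < d].

Lemma dotRd_step j e x : dotRd (stepRd j e) x = e * (tnth x j : R).
Proof.
rewrite /dotRd (bigD1 j)//= tnth_mktuple eqxx big1 ?addr0// => i ij.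
by rewrite tnth_mktuple (negbTE ij) mul0r.
Qed.

Lemma dotRdC x y : dotRd x y = dotRd y x.
Proof. by apply: eq_bigr => i _; rewrite mulrC. Qed.

Lemma dotRd_ge0 x : 0 <= dotRd x x.
Proof. by apply: sumr_ge0 => i _; rewrite -expr2 sqr_ge0. Qed.

Lemma dotRd_shift_step j e xi :
  dotRd (shiftRd (stepRd j e) xi) (shiftRd (stepRd j e) xi) =
  dotRd xi xi + 2 * e * (tnth xi j : R) + e ^+ 2.
Proof.
rewrite dotRd_shift dotRd_step dotRdC dotRd_shift dotRd_step tnth_mktuple.
by rewrite tnth_mktuple eqxx; ring.
Qed.

Lemma tnth_shift_step j e xi :
  (tnth (shiftRd (stepRd j e) xi) j : R) = (tnth xi j : R) + e.
Proof. by rewrite !tnth_mktuple eqxx. Qed.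

Lemma coordinate_sqr_le j xi : (tnth xi j : R) ^+ 2 <= dotRd xi xi.
Proof.
rewrite /dotRd (bigD1 j)//= -expr2 lerDl sumr_ge0// => i _.
by rewrite -expr2 sqr_ge0.
Qed.

Lemma coordinate_le j xi : `|tnth xi j : R| <= Num.sqrt (dotRd xi xi).
Proof. by rewrite -sqrtr_sqr ler_wsqrtr// coordinate_sqr_le. Qed.

Lemma norm_sin_le (t : R) : `|sin t| <= `|t|.
Proof.
have pos (s : R) : 0 <= s -> `|sin s| <= s.
  move=> s0; have [|c _ E] := @MVT_segment R (@sin R) (@cos R) 0 s s0.
    by apply: continuous_subspaceT => x; exact: continuous_sin.
  move: E; rewrite sin0 !subr0 => ->.
  by rewrite normrM (ger0_norm s0) ler_piMl// cos_max.
have [t0|t0] := leP 0 t; first by rewrite (ger0_norm t0) pos.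
by rewrite -(opprK t) sinN normrN (@ler0_norm _ (- - t)) ?opprK ?pos ?oppr_ge0 ?ltW.
Qed.

Lemma sqc_cexpN_sub1 (t : R) : sqc (cexpN t - 1) <= t ^+ 2.
Proof.
have -> : sqc (cexpN t - 1) = 4 * sin (t / 2) ^+ 2.
  have E : cos t = 1 - 2 * sin (t / 2) ^+ 2.
    have -> : cos t = cos (t / 2 + t / 2) by congr cos; field.
    by rewrite cosD -!expr2; have := cos2Dsin2 (t / 2); lra.
  have -> : sqc (cexpN t - 1) = 2 - 2 * cos t.
    rewrite /sqc !reim /= subr0 sqrrN.
    have -> : (cos t - 1) ^+ 2 + sin t ^+ 2 = (cos t ^+ 2 + sin t ^+ 2) + 1 - 2 * cos t by ring.
    by rewrite cos2Dsin2; ring.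
  by rewrite E; ring.
have h := norm_sin_le (t / 2).
have h2 : sin (t / 2) ^+ 2 <= (t / 2) ^+ 2.
  by rewrite -[leLHS]real_normK ?num_real// -[leRHS]real_normK ?num_real// lerXn2r ?nnegrE.
move: h2; rewrite expr_div_n; lra.
Qed.

(** Isometry together with |exp (- i e x_j) - 1| <= e |x_j|. It is meant for V f, which has the
    required moment. *)
Lemma fourier_translation_le f h j e :
  fourier f h -> L2 (fun x => (tnth x j : R)%:C%C * f x) -> 0 <= e ->
  N2 (fun xi => h (shiftRd (stepRd j e) xi) - h xi) <=
  e * N2 (fun x => (tnth x j : R)%:C%C * f x).
Proof.
move=> F Lx e0; have F2 := fourierB (fourier_modulation (stepRd j e) F) F.
rewrite (fourier_N2 F2); apply: N2_dom => //.
  by apply: L2_meas; apply: L2B; [apply: L2_modulation|]; exact: (fourier_L2l F).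
apply: aeW => x.
have -> : cexpN (dotRd (stepRd j e) x) * f x - f x = (cexpN (dotRd (stepRd j e) x) - 1) * f x.
  by rewrite mulrBl mul1r.
rewrite !sqcM sqc_real mulrA ler_wpM2r ?sqc_ge0//.
by rewrite (le_trans (sqc_cexpN_sub1 _))// dotRd_step exprMn.
Qed.

(** The companion for the eigenfunction itself, where no moment gives a rate: dominated convergence
    with 4 |f|^2. *)
Lemma fourier_translation_cvg f h j (e_ : nat -> R) : fourier f h ->
  e_ n @[n --> \oo] --> 0 ->
  N2 (fun xi => h (shiftRd (stepRd j (e_ n)) xi) - h xi) @[n --> \oo] --> 0.
Proof.
move=> F ecvg.
have E n : N2 (fun xi => h (shiftRd (stepRd j (e_ n)) xi) - h xi) =
  Num.sqrt (\int[mu]_x (sqc (cexpN (e_ n * (tnth x j : R)) - 1) * sqc (f x))).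
  have F2 := fourierB (fourier_modulation (stepRd j (e_ n)) F) F.
  rewrite (fourier_N2 F2) /N2; congr (Num.sqrt (fine _)); apply: eq_integral => x _.
  by rewrite -sqcM mulrBl mul1r dotRd_step.
rewrite (_ : (fun n => N2 _) = (fun n =>
  Num.sqrt (\int[mu]_x (sqc (cexpN (e_ n * (tnth x j : R)) - 1) * sqc (f x))))); last first.
  by apply/funext => n; exact: E.
have Lf := fourier_L2l F.
have <- : Num.sqrt 0 = 0 :> R by exact: sqrtr0.
apply: (@cvg_comp _ _ _ (fun n => \int[mu]_x (sqc (cexpN (e_ n * (tnth x j : R)) - 1) * sqc (f x))) (@Num.sqrt R) _ (nbhs (0 : R))); last first.
  exact: sqrt_continuous.
have -> : (0 : R) = \int[mu]_x (fun _ : Rd R d => 0 : R) x.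
  by rewrite Rintegral_cst// mul0r.
apply: (@Rdominated_cvg _ _ _ mu _ _ (fun x => 4 * sqc (f x))).
- move=> n; apply: measurable_funM; last by apply: measurable_sqc; exact: L2_meas.
  apply: measurable_sqc; apply: cmeasurableD; last exact: cmeasurable_cst.
  apply: cmeas_cexpN; apply: measurable_funM => //; exact: measurable_tnth.
- exact: measurable_cst.
- apply: aeW => x; rewrite -[X in _ --> X](mul0r (sqc (f x))).
  apply: cvgM; last exact: cvg_cst.
  apply: (@cvg0_le R _ (fun n => (e_ n * (tnth x j : R)) ^+ 2)).
    by move=> n; rewrite sqc_ge0 sqc_cexpN_sub1.
  have h1 : e_ n * (tnth x j : R) @[n --> \oo] --> 0.
    by rewrite -[X in _ --> X](mul0r (tnth x j : R)); apply: cvgM => //; exact: cvg_cst.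
  rewrite -[X in _ --> X](mul0r (0 : R)).
  by under eq_fun do rewrite expr2; exact: cvgM.
- by apply: integrable_RZ; exact: L2_sqc_integ.
move=> n x; rewrite ger0_norm ?mulr_ge0 ?sqc_ge0// ler_wpM2r ?sqc_ge0//.
set t := e_ n * _.
rewrite /sqc !reim /= subr0 sqrrN.
have h1 := cos2Dsin2 t; have := cos_geN1 t.
have -> : (cos t - 1) ^+ 2 + sin t ^+ 2 = (cos t ^+ 2 + sin t ^+ 2) + 1 - 2 * cos t by ring.
by rewrite h1; lra.
Qed.

End coordinate_translation.

(** * The commutator identity and its limit *)

Section virial.
Context {R : realType} (d : nat).
Local Notation mu := (@lebesgue_Rd R d).
Local Notation L2 := (cLp 2%:E).
Variable Psi : R -> R.
Hypothesis mPsi : measurable_fun (`[0, +oo[ : set R) Psi.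
Hypothesis dPsi : forall u : R, 0 < u -> derivable Psi u 1.
Hypothesis Psi_ge0 : forall u : R, 0 <= u -> 0 <= Psi u.
Hypothesis dPsi_ge0 : forall u : R, 0 < u -> 0 <= derive1 Psi u.
Hypothesis Psi0 : Psi 0 = 0.
Variables c2 d2 : R.
Hypotheses (c20 : 0 <= c2) (d20 : 0 <= d2).
Hypothesis Psi_growth : forall u : R, 0 <= u -> u * derive1 Psi u <= c2 * Psi u + d2.

Let m (xi : Rd R d) : R := Psi (dotRd xi xi / 2).

Let dot2_ge0 (xi : Rd R d) : 0 <= dotRd xi xi / 2.
Proof. by rewrite divr_ge0// dotRd_ge0. Qed.

Lemma measurable_kinetic : measurable_fun setT m.
Proof.
apply: (@measurable_comp _ _ _ _ _ _ (`[0, +oo[%classic : set R) Psi setT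
  (fun xi : Rd R d => dotRd xi xi / 2)) => //.
- by move=> _ [xi _ <-] /=; rewrite in_itv/= andbT.
- by apply: measurable_funM => //; exact: measurable_dotRd2.
Qed.

Let m_ge0 xi : 0 <= m xi. Proof. exact: Psi_ge0. Qed.

Let CQ := quotient_constant Psi c2 d2.
Let CQ0 : 0 <= CQ. Proof. exact: quotient_constant_ge0. Qed.

(** Stands for the commutator: a difference quotient of the kinetic symbol along the j-th axis,
    weighted by xi_j. *)
Let q j (e : R) (xi : Rd R d) : R :=
  (tnth xi j : R) * (m (shiftRd (stepRd j e) xi) - m xi) / e.

Let m_shift j e xi : m (shiftRd (stepRd j e) xi) =
  Psi (dotRd xi xi / 2 + e * (tnth xi j : R) + e ^+ 2 / 2).
Proof. by rewrite /m dotRd_shift_step; congr Psi; field. Qed.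

Let measurable_q j e : measurable_fun setT (q j e).
Proof.
apply: measurable_funM => //; apply: measurable_funM; first exact: measurable_tnth.
apply: measurable_funB; last exact: measurable_kinetic.
exact: (measurableT_comp measurable_kinetic (measurable_shiftRd _)).
Qed.

Let q_le j e xi : 0 < e <= 1 -> `|q j e xi| <= CQ * (m xi + 1).
Proof.
move=> e01; have /andP[e0 _] := e01.
rewrite /q normrM normfV (gtr0_norm e0) ler_pdivrMr// [leRHS]mulrC.
have rE : Num.sqrt (dotRd xi xi) ^+ 2 = dotRd xi xi by rewrite sqr_sqrtr// dotRd_ge0.
have := Psi_quotient_bound dPsi Psi_ge0 dPsi_ge0 Psi0 c20 d20 Psi_growth (coordinate_le j xi) e01.
by rewrite rE m_shift.
Qed.

Let en (n : nat) : R := n.+1%:R^-1.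
Let en01 n : 0 < en n <= 1.
Proof. by rewrite /en invr_gt0 ltr0n/= invf_le1// ler1n. Qed.
Let en0 n : 0 < en n. Proof. by have /andP[] := en01 n. Qed.
Let en_cvg : en n @[n --> \oo] --> 0. Proof. exact: cvg_harmonic. Qed.

Let q_cvg j xi : q j (en n) xi @[n --> \oo] -->
  (tnth xi j : R) ^+ 2 * derive1 Psi (dotRd xi xi / 2).
Proof.
(* At the origin [derive1 Psi 0] carries no information, but its factor xi_j vanishes. *)
have [x0|x0] := eqVneq (dotRd xi xi) 0.
  have t0 : (tnth xi j : R) = 0.
    by apply/eqP; rewrite -sqrf_eq0 eq_le sqr_ge0 andbT -x0 coordinate_sqr_le.
  rewrite (_ : (fun n => _) = cst 0); first by rewrite t0 expr0n mul0r; exact: cvg_cst.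
  by apply/funext => n; rewrite /q t0 !mul0r.
have a0 : 0 < dotRd xi xi / 2 by rewrite divr_gt0// lt_neqAle eq_sym x0 dotRd_ge0.
have := @Psi_quotient_cvg R Psi dPsi _ (tnth xi j : R) en a0 en0 en_cvg.
rewrite (_ : (fun n => q j (en n) xi) = (fun n => (tnth xi j : R) *
  (Psi (dotRd xi xi / 2 + en n * (tnth xi j : R) + en n ^+ 2 / 2) - Psi (dotRd xi xi / 2)) / en n)) //.
by apply/funext => n; rewrite /q m_shift.
Qed.

Variables (f h b G : Rd R d -> R[i]) (lambda : R).
Hypotheses (Fh : fourier f h) (FG : fourier b G).
Hypothesis GE : forall xi, G xi = (lambda - m xi)%:C%C * h xi.
Hypothesis Lmh : L2 (fun xi => (m xi)%:C%C * h xi).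

Let Lh : L2 h. Proof. exact: fourier_L2r Fh. Qed.
Let LG : L2 G. Proof. exact: fourier_L2r FG. Qed.

Let m1h xi : R[i] := (m xi + 1)%:C%C * h xi.

Let Lm1h : L2 m1h.
Proof.
have := L2D Lmh Lh; congr cLp; apply/funext => xi.
by rewrite /m1h rmorphD/= mulrDl rmorph1 mul1r.
Qed.

Section coordinate.
Variable j : 'I_d.
Let xj (x : Rd R d) : R := (tnth x j : R).
Hypothesis Lxb : L2 (fun x => (xj x)%:C%C * b x).
Hypothesis Lxh : L2 (fun xi => (xj xi)%:C%C * h xi).

Let tau e g : Rd R d -> R[i] := fun xi => g (shiftRd (stepRd j e) xi).

Let qh e xi : R[i] := (q j e xi)%:C%C * h xi.

Let mqh e : cmeasurable (qh e).
Proof. by apply: cmeasurableM; [exact: cmeasurable_real|exact: L2_meas]. Qed.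

Let qh_ae e : 0 < e <= 1 -> {ae mu, forall xi, sqc (qh e xi) <= CQ ^+ 2 * sqc (m1h xi)}.
Proof.
move=> e01; apply: aeW => xi; rewrite /qh /m1h !sqcM !sqc_real mulrA ler_wpM2r ?sqc_ge0//.
rewrite -exprMn -[leLHS]real_normK ?num_real// lerXn2r ?nnegrE//; last exact: q_le.
by rewrite mulr_ge0// addr_ge0.
Qed.

Let Lqh e : 0 < e <= 1 -> L2 (qh e).
Proof. by move=> e01; apply: L2_dom (mqh e) Lm1h (qh_ae e01). Qed.

Let Nqh e : 0 < e <= 1 -> N2 (qh e) <= CQ * N2 m1h.
Proof. by move=> e01; apply: N2_dom (mqh e) Lm1h (qh_ae e01). Qed.

(* Discrete integration by parts: [G] only appears through [tau G - G], which is
   small because [x_j b] is square integrable. *)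
Let commutator_identity e : 0 < e <= 1 ->
  e * rip (qh e) (tau e h) =
  rip (fun xi => G xi - tau e G xi) (tau e (fun xi => (xj xi)%:C%C * h xi - e%:C%C * h xi))
  - rip (fun xi => (xj xi)%:C%C * h xi) (fun xi => tau e G xi - G xi)
  - e * rip G h.
Proof.
move=> e01; have /andP[e0 _] := e01.
(* The subtraction of e is compensated by the translation: [tau e k] is xi_j times [tau e h]. *)
set k := fun xi => (xj xi)%:C%C * h xi - e%:C%C * h xi.
have Leh : L2 (fun xi => e%:C%C * h xi) by exact: L2Z.
have Lk : L2 k by exact: L2B.
have Ltk : L2 (tau e k) by exact: L2_shift.
have LtG : L2 (tau e G) by exact: L2_shift.
have Lth : L2 (tau e h) by exact: L2_shift.
(* Translation preserves norms, hence pairings, by polarization. *)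
have shift_inv : rip (tau e G) (tau e k) = rip G k.
  have NN u v : L2 u -> L2 v -> rip u v = (N2 (fun x => u x + v x) ^+ 2 - N2 u ^+ 2 - N2 v ^+ 2) / 2.
    by move=> Lu Lv; rewrite N2D_sqr//; field.
  rewrite !NN// (N2_shift _ (L2_meas LG)) (N2_shift _ (L2_meas Lk)).
  by rewrite (N2_shift (stepRd j e) (L2_meas (L2D LG Lk))).
(* Pointwise cancellation: (lambda - m) - (lambda - tau m) leaves tau m - m, the numerator of
   [q]. *)
have step1 : e * rip (qh e) (tau e h) = rip G (tau e k) - rip (fun xi => (xj xi)%:C%C * h xi) (tau e G).
  rewrite /rip -RintegralZl//; last exact: reip_integ (Lqh e01) Lth.
  rewrite -RintegralB//; [|exact: reip_integ..].
  apply: eq_Rintegral => xi _.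
  rewrite /tau /k /qh /q /xj tnth_shift_step !GE /reip !reim/=.
  by field; rewrite gt_eqF.
have E1 := ripBl LG LtG Ltk; have E2 := ripBr LtG LG Lxh.
have E3 := ripBr Lxh Leh LG; have E4 := ripZr e Lh LG.
rewrite E4 in E3; rewrite -/k in E3; rewrite shift_inv E3 in E1.
rewrite step1 E1 E2 (ripC G (fun xi => (xj xi)%:C%C * h xi)); ring.
Qed.

(** After division by e the identity bounds the pairing of [qh] with [tau e h] uniformly, each
    difference of G costing e Y. Replacing [tau e h] by h costs |qh| D n, where |qh| is bounded
    through [q_le] and D n tends to 0; the same [q_le] dominates the integrand in the limit. *)
Lemma virial_coordinate :
  mu.-integrable setT
    (EFin \o (fun xi => xj xi ^+ 2 * derive1 Psi (dotRd xi xi / 2) * sqc (h xi))) /\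
  \int[mu]_xi (xj xi ^+ 2 * derive1 Psi (dotRd xi xi / 2) * sqc (h xi)) <=
  2 * N2 (fun xi => (xj xi)%:C%C * h xi) * N2 (fun x => (xj x)%:C%C * b x) + N2 b * N2 h.
Proof.
set X := N2 (fun xi => _); set Y := N2 (fun x => _).
have X0 : 0 <= X by exact: N2_ge0.
have Y0 : 0 <= Y by exact: N2_ge0.
have NGb : N2 G = N2 b by exact: fourier_N2.
pose D n := N2 (fun xi => tau (en n) h xi - h xi).
have Dcvg : D n @[n --> \oo] --> 0 by exact: (fourier_translation_cvg j Fh en_cvg).
have bound n : rip (qh (en n)) h <=
    (X * Y + (X + en n * N2 h) * Y + N2 b * N2 h) + CQ * N2 m1h * D n.
  have e01 := en01 n; have e0 := en0 n.
  have Leh : L2 (fun xi => (en n)%:C%C * h xi) by exact: L2Z.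
  have Lth : L2 (tau (en n) h) by exact: L2_shift.
  have LtG : L2 (tau (en n) G) by exact: L2_shift.
  have dG : N2 (fun xi => tau (en n) G xi - G xi) <= en n * Y.
    exact: (fourier_translation_le FG Lxb (ltW e0)).
  have Nk : N2 (tau (en n) (fun xi => (xj xi)%:C%C * h xi - (en n)%:C%C * h xi)) <= X + en n * N2 h.
    rewrite N2_shift; last by apply: L2_meas; exact: L2B.
    rewrite (le_trans (N2B_le Lxh Leh))// lerD2l N2Z// sqc_real sqrtr_sqr gtr0_norm//.
  have -> : rip (qh (en n)) h = rip (qh (en n)) (tau (en n) h) -
      rip (qh (en n)) (fun xi => tau (en n) h xi - h xi).
    by rewrite ripBr//; [ring|exact: Lqh].
  apply: lerD; last first.
    rewrite (le_trans (ler_norm _))// normrN (le_trans (cauchy_schwarz (Lqh e01) (L2B Lth Lh)))//.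
    by rewrite ler_wpM2r ?N2_ge0// Nqh.
  rewrite -(ler_pM2l e0) commutator_identity//.
  have h1 : rip (fun xi => G xi - tau (en n) G xi)
      (tau (en n) (fun xi => (xj xi)%:C%C * h xi - (en n)%:C%C * h xi)) <=
      (en n * Y) * (X + en n * N2 h).
    rewrite (le_trans (ler_norm _))// (le_trans (cauchy_schwarz _ _))//.
    - exact: L2B.
    - by apply: L2_shift; exact: L2B.
    by rewrite ler_pM ?N2_ge0// N2_sub_sym.
  have h2 : - rip (fun xi => (xj xi)%:C%C * h xi) (fun xi => tau (en n) G xi - G xi) <= X * (en n * Y).
    rewrite (le_trans (ler_norm _))// normrN (le_trans (cauchy_schwarz _ _))//; first exact: L2B.
    by rewrite ler_wpM2l.
  have h3 : - (en n * rip G h) <= en n * (N2 b * N2 h).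
    rewrite -mulrN ler_wpM2l ?(ltW e0)// (le_trans (ler_norm _))// normrN.
    by rewrite -NGb cauchy_schwarz.
  have -> : en n * (X * Y + (X + en n * N2 h) * Y + N2 b * N2 h) =
    (en n * Y) * (X + en n * N2 h) + X * (en n * Y) + en n * (N2 b * N2 h) by ring.
  by apply: lerD => //; exact: lerD.
have E n xi : reip (qh (en n) xi) (h xi) = q j (en n) xi * sqc (h xi).
  by rewrite /reip /qh /sqc !reim/=; ring.
have mE n : measurable_fun setT (fun xi => reip (qh (en n) xi) (h xi)).
  by apply: measurable_reip => //; exact: L2_meas.
have cE xi : reip (qh (en n) xi) (h xi) @[n --> \oo] -->
    xj xi ^+ 2 * derive1 Psi (dotRd xi xi / 2) * sqc (h xi).
  rewrite (_ : (fun n => _) = (fun n => q j (en n) xi * sqc (h xi))).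
    by apply: cvgM; [exact: q_cvg|exact: cvg_cst].
  by apply/funext => n; exact: E.
(* Measurability of the limit integrand is inherited from the difference quotients. *)
have mlim : measurable_fun setT (fun xi => xj xi ^+ 2 * derive1 Psi (dotRd xi xi / 2) * sqc (h xi)).
  by apply: (measurable_fun_cvg (h := fun n xi => reip (qh (en n) xi) (h xi))) => // xi _; exact: cE.
have dom n xi : `|reip (qh (en n) xi) (h xi)| <= CQ * reip (m1h xi) (h xi).
  rewrite E.
  have -> : reip (m1h xi) (h xi) = (m xi + 1) * sqc (h xi).
    by rewrite /reip /m1h /sqc !reim/=; ring.
  by rewrite normrM (ger0_norm (sqc_ge0 _)) mulrA ler_wpM2r ?sqc_ge0// q_le.
have idom : mu.-integrable setT (EFin \o (fun xi => CQ * reip (m1h xi) (h xi))).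
  by apply: integrable_RZ; exact: reip_integ.
split.
  apply: (integrable_le mlim idom) => xi.
  have hn : `|reip (qh (en n) xi) (h xi)| @[n --> \oo] -->
      `|xj xi ^+ 2 * derive1 Psi (dotRd xi xi / 2) * sqc (h xi)| by exact: cvg_norm (cE xi).
  have hc : CQ * reip (m1h xi) (h xi) @[n --> \oo] --> CQ * reip (m1h xi) (h xi) by exact: cvg_cst.
  by apply: (ler_cvg_to hn hc); apply: nearW => n; exact: dom.
have lhs : rip (qh (en n)) h @[n --> \oo] -->
    \int[mu]_xi (xj xi ^+ 2 * derive1 Psi (dotRd xi xi / 2) * sqc (h xi)).
  apply: (@Rdominated_cvg _ _ _ mu _ _ (fun xi => CQ * reip (m1h xi) (h xi))) => //.
  by apply: aeW => xi; exact: cE.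
have rhs : (X * Y + (X + en n * N2 h) * Y + N2 b * N2 h) + CQ * N2 m1h * D n @[n --> \oo] -->
   (X * Y + (X + 0 * N2 h) * Y + N2 b * N2 h) + CQ * N2 m1h * 0.
  apply: cvgD; last by apply: cvgM => //; exact: cvg_cst.
  apply: cvgD; last exact: cvg_cst.
  apply: cvgD; first exact: cvg_cst.
  apply: cvgM; last exact: cvg_cst.
  apply: cvgD; first exact: cvg_cst.
  by apply: cvgM => //; exact: cvg_cst.
have -> : 2 * X * Y + N2 b * N2 h =
  (X * Y + (X + 0 * N2 h) * Y + N2 b * N2 h) + CQ * N2 m1h * 0 by ring.
by apply: (ler_cvg_to lhs rhs); apply: nearW.
Qed.

End coordinate.

End virial.

(** * Weak convergence and orthonormal sequences *)

Section orthonormal_sequences.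
Context {R : realType} (d : nat).
Local Notation mu := (@lebesgue_Rd R d).
Local Notation L2 := (cLp 2%:E).
Local Notation F := (Rd R d -> R[i]).

(** [rest n] is phi minus its projection on the first n vectors. Pythagoras bounds the partial sums
    of the squared coefficients, so the series converges and its terms tend to 0. *)
Lemma bessel_cvg0 (e : nat -> F) (phi : F) : (forall n, L2 (e n)) ->
  (forall n, N2 (e n) = 1) -> (forall i j, (i < j)%N -> rip (e i) (e j) = 0) ->
  L2 phi -> rip phi (e n) @[n --> \oo] --> 0.
Proof.
move=> Le e1 eo Lphi.
pose c n := rip phi (e n).
pose rest := fix rest n : F := if n is k.+1 then
  (fun x => rest k x - (c k)%:C%C * e k x) else phi.
have Lrest n : L2 (rest n) by elim: n => //= n IH; apply: L2B => //; exact: L2Z.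
have rest_e n k : (n <= k)%N -> rip (rest n) (e k) = c k.
  elim: n => //= n IH nk; have LZ := L2Z (c n)%:C%C (Le n).
  by rewrite ripBl// IH ?(ltnW nk)// ripZl// eo// mulr0 subr0.
have Nrest n : N2 (rest n) ^+ 2 = N2 phi ^+ 2 - \sum_(0 <= i < n) c i ^+ 2.
  elim: n => [|n IH]; first by rewrite big_geq// subr0.
  have LZ := L2Z (c n)%:C%C (Le n).
  rewrite big_nat_recr//= -rip_id; last exact: L2B.
  rewrite ripBl ?ripBr//; [|exact: L2B].
  rewrite (ripC _ (rest n)) !ripZr// ripZl// !rip_id// IH e1 rest_e//; ring.
have bound n : \sum_(0 <= i < n) c i ^+ 2 <= N2 phi ^+ 2.
  by rewrite -subr_ge0 -Nrest sqr_ge0.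
have cv : cvgn (series (fun n => c n ^+ 2)).
  apply: nondecreasing_is_cvgn.
    by apply: nondecreasing_series => n _ _; exact: sqr_ge0.
  by exists (N2 phi ^+ 2) => _ [n _ <-]; exact: bound.
have c2 : c n ^+ 2 @[n --> \oo] --> 0 by exact: cvg_series_cvg_0.
have : Num.sqrt (c n ^+ 2) @[n --> \oo] --> Num.sqrt 0.
  by apply: (@cvg_comp _ _ _ (fun n => c n ^+ 2) (@Num.sqrt R) _ _ _ c2); exact: sqrt_continuous.
rewrite sqrtr0; under eq_fun do rewrite sqrtr_sqr.
by move/norm_cvg0P.
Qed.

(** The choice at stage n depends on all earlier terms, so the recursion carries their list [s n].
    Strong induction shows that the extension property applies at every stage, hence [xget] never
    falls back on its default. *)
Lemma ortho_sequence (P : F -> Prop) :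
  (forall n (e : nat -> F), (forall i, (i < n)%N -> P (e i)) ->
     (forall i j, (i < j < n)%N -> rip (e i) (e j) = 0) ->
     exists2 f, P f & forall i, (i < n)%N -> rip (e i) f = 0) ->
  exists2 e : nat -> F, forall n, P (e n) &
    forall i j, (i < j)%N -> rip (e i) (e j) = 0.
Proof.
move=> ext.
pose Good (s : seq F) (f : F) := P f /\ forall i, (i < size s)%N -> rip (nth (fun=> 0) s i) f = 0.
pose pick (s : seq F) : F := xget (fun=> 0) [set f | Good s f].
pose s := fix s n : seq F := if n is k.+1 then rcons (s k) (pick (s k)) else [::].
pose e n := pick (s n).
have sE n : s n = mkseq e n.
  by elim: n => //= n IH; rewrite mkseqS -IH.
have main n : Good (s n) (e n).
  elim/ltn_ind: n => n IH.
  have Pe i : (i < n)%N -> P (e i) by move=> /IH [].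
  have oe i j : (i < j < n)%N -> rip (e i) (e j) = 0.
    move=> /andP[ij /IH [_]]; rewrite sE size_mkseq => /(_ i ij).
    by rewrite nth_mkseq.
  have [f Pf fo] := ext n e Pe oe.
  have : Good (s n) f.
    split=> // i; rewrite sE size_mkseq => ik; rewrite nth_mkseq//.
    exact: fo.
  by rewrite /e /pick => g; case: xgetP => [y _ //|/(_ f)].
exists e => [n|i j ij]; first by have [] := main n.
have [_] := main j; rewrite sE size_mkseq => /(_ i ij).
by rewrite nth_mkseq.
Qed.

(** W is unbounded, so it can be moved across the pairing only onto test functions supported where
    |W| <= M. Testing with g cut off to that set gives 0 for every M, and M -> oo turns this into
    |g|^2 = 0. *)
Lemma multiplication_weak_closed (W : Rd R d -> R) (f w : nat -> F) (g : F) :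
  measurable_fun setT W -> (forall n, L2 (f n)) -> (forall n, L2 (w n)) ->
  (forall n, w n = (fun x => (W x)%:C%C * f n x) %[ae mu]) ->
  (forall phi, L2 phi -> rip phi (f n) @[n --> \oo] --> 0) ->
  L2 g -> N2 (fun x => w n x - g x) @[n --> \oo] --> 0 ->
  N2 g = 0.
Proof.
move=> mW Lf Lw wW weak Lg wg.
pose S (M : nat) : set (Rd R d) := [set x | `|W x| <= M%:R].
have mS M : measurable (S M).
  rewrite (_ : S M = (Num.norm \o W) @^-1` `]-oo, M%:R]%classic); last first.
    by apply/seteqP; split => x /=; rewrite in_itv.
  by rewrite -[X in measurable X]setTI; apply: measurableT_comp => //; exact: measurable_itv.
pose phi M : F := fun x => (\1_(S M) x : R)%:C%C * g x.
have mphi M : cmeasurable (phi M).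
  by apply: cmeasurableM; [apply: cmeasurable_real|exact: L2_meas].
have Lphi M : L2 (phi M).
  apply: (L2_dom (C := 1)) (mphi M) Lg _; apply: aeW => x.
  by rewrite sqcM sqc_real expr1n ler_wpM2r ?sqc_ge0//.
have LWphi M : L2 (fun x => (W x)%:C%C * phi M x).
  apply: (L2_dom (C := M%:R)) _ Lg _.
    by apply: cmeasurableM => //; exact: cmeasurable_real.
  apply: aeW => x; rewrite /phi mulrA -rmorphM/= sqcM sqc_real ler_wpM2r ?sqc_ge0//.
  rewrite indicE; have [xS|_] := boolP (x \in S M); last by rewrite mulr0 expr0n sqr_ge0.
  move: xS; rewrite inE mulr1 => xS.
  by rewrite -[leLHS]real_normK ?num_real// lerXn2r ?nnegrE.
have swap M n : rip (phi M) (w n) = rip (fun x => (W x)%:C%C * phi M x) (f n).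
  have LWf : L2 (fun x => (W x)%:C%C * f n x).
    by apply: (L2_ae _ (Lw n)); [apply: cmeasurableM; [exact: cmeasurable_real|exact: L2_meas]
      |apply: filterS (wW n) => x h _; rewrite h].
  rewrite (rip_ae (Lphi M) (Lw n) (Lphi M) LWf)//.
    by apply: eq_Rintegral => x _; rewrite /reip !reim/=; ring.
  by apply: aeW.
have zero M : rip (phi M) g = 0.
  have c1 : rip (phi M) (w n) @[n --> \oo] --> 0.
    by under eq_fun do rewrite swap; exact: weak.
  have c2 : rip (phi M) (w n) @[n --> \oo] --> rip (phi M) g.
    have c3 : N2 (phi M) * N2 (fun x => w n x - g x) @[n --> \oo] --> 0.
      by rewrite -[X in _ --> X](mulr0 (N2 (phi M))); apply: cvgM => //; exact: cvg_cst.
    apply/cvgrPdist_le => eps eps0; have /cvgr0Pnorm_le/(_ eps eps0) := c3.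
    apply: filterS => n; rewrite ger0_norm ?mulr_ge0 ?N2_ge0// => h.
    rewrite distrC -ripBr//; exact: le_trans (cauchy_schwarz (Lphi M) (L2B (Lw n) Lg)) h.
  exact: (cvg_unique _ c2 c1).
have lim : rip (phi M) g @[M --> \oo] --> rip g g.
  apply: (@Rdominated_cvg _ _ _ mu _ _ (fun x => sqc (g x))).
  - by move=> M; apply: measurable_reip => //; exact: L2_meas.
  - by apply: measurable_reip; exact: L2_meas.
  - apply: aeW => x; apply: cvg_near_cst; near=> M.
    rewrite /phi indicE mem_set ?rmorph1 ?mul1r//.
    by rewrite /S /=; near: M; exact: nbhs_infty_ger.
  - exact: L2_sqc_integ.
  move=> M x; have -> : reip (phi M x) (g x) = \1_(S M) x * sqc (g x).
    by rewrite /reip /phi /sqc !reim/=; ring.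
  rewrite normrM (ger0_norm (sqc_ge0 _)) ler_piMl ?sqc_ge0// indicE.
  by case: (x \in S M); rewrite ?normr1 ?normr0.
have z : rip (phi M) g @[M --> \oo] --> 0.
  rewrite (_ : (fun M => _) = (fun=> 0)); first exact: cvg_cst.
  by apply/funext => M; exact: zero.
have E : rip g g = 0 by exact: (cvg_unique _ lim z).
by apply/eqP; rewrite -sqrf_eq0 -rip_id// E.
Unshelve. all: by end_near. Qed.

End orthonormal_sequences.

(** * The Hamiltonian and its eigenfunctions *)

Lemma Rintegral_big disp (T : measurableType disp) (R : realType)
    (mu : {measure set T -> \bar R}) (I : Type) (s : seq I) (f : I -> T -> R) :
  (forall i, mu.-integrable setT (EFin \o f i)) ->
  mu.-integrable setT (EFin \o (fun x => \sum_(i <- s) f i x)) /\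
  \int[mu]_x (\sum_(i <- s) f i x) = \sum_(i <- s) \int[mu]_x f i x.
Proof.
move=> fi; elim: s => [|i s [IH1 IH2]].
  rewrite big_nil; under eq_fun do rewrite big_nil.
  split; first exact: integrable0.
  by rewrite Rintegral_cst// mul0r.
rewrite big_cons -IH2; under eq_fun do rewrite big_cons.
split; first exact: integrable_RD.
exact: RintegralD.
Qed.

Section operators.
Context {R : realType} (d : nat).
Local Notation mu := (@lebesgue_Rd R d).
Local Notation L2 := (cLp 2%:E).
Implicit Types (f g : Rd R d -> R[i]) (A : @operator R d).

Lemma fourier_multiplierZ (k : Rd R d -> R) c f g : fourier_multiplier k f g ->
  fourier_multiplier k (fun x => c * f x) (fun x => c * g x).
Proof.
move=> [h F1 F2]; exists (fun x => c * h x); first exact: fourierZ.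
have := fourierZ c F2; congr fourier; apply/funext => x; exact: mulrCA.
Qed.

Lemma fourier_multiplierD (k : Rd R d -> R) f g f' g' :
  fourier_multiplier k f g -> fourier_multiplier k f' g' ->
  fourier_multiplier k (fun x => f x + f' x) (fun x => g x + g' x).
Proof.
move=> [h F1 F2] [h' F1' F2']; exists (fun x => h x + h' x); first exact: fourierD.
have := fourierD F2 F2'; congr fourier; apply/funext => x; by rewrite mulrDr.
Qed.

Lemma multiplicationZ (W : Rd R d -> R) c f g : multiplication W f g ->
  multiplication W (fun x => c * f x) (fun x => c * g x).
Proof.
move=> [Lf Lg gf]; split; [exact: L2Z|exact: L2Z|].
by apply: filterS gf => x /(_ Logic.I) -> _; exact: mulrCA.
Qed.

Lemma multiplicationD (W : Rd R d -> R) f g f' g' :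
  multiplication W f g -> multiplication W f' g' ->
  multiplication W (fun x => f x + f' x) (fun x => g x + g' x).
Proof.
move=> [Lf Lg gf] [Lf' Lg' gf']; split; [exact: L2D|exact: L2D|].
by apply: filterS2 gf gf' => x /(_ Logic.I) -> /(_ Logic.I) -> _; rewrite mulrDr.
Qed.

Lemma hamiltonianZ Psi (V : Rd R d -> R) c f g : hamiltonian Psi V f g ->
  hamiltonian Psi V (fun x => c * f x) (fun x => c * g x).
Proof.
move=> [Lg [a [b [fa fb gab]]]]; split; first exact: L2Z.
exists (fun x => c * a x), (fun x => c * b x); split.
- exact: fourier_multiplierZ.
- exact: multiplicationZ.
by apply: filterS gab => x /(_ Logic.I) -> _; rewrite mulrDr.
Qed.

Lemma hamiltonianD Psi (V : Rd R d -> R) f g f' g' :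
  hamiltonian Psi V f g -> hamiltonian Psi V f' g' ->
  hamiltonian Psi V (fun x => f x + f' x) (fun x => g x + g' x).
Proof.
move=> [Lg [a [b [fa fb gab]]]] [Lg' [a' [b' [fa' fb' gab']]]]; split; first exact: L2D.
exists (fun x => a x + a' x), (fun x => b x + b' x); split.
- exact: fourier_multiplierD.
- exact: multiplicationD.
by apply: filterS2 gab gab' => x /(_ Logic.I) -> /(_ Logic.I) -> _; rewrite addrACA.
Qed.

Lemma eigenspaceZ Psi (V : Rd R d -> R) (lambda c : R[i]) f :
  Defs.eigenspace (hamiltonian Psi V) lambda f ->
  Defs.eigenspace (hamiltonian Psi V) lambda (fun x => c * f x).
Proof.
move=> /(hamiltonianZ c); rewrite /Defs.eigenspace /mkset; congr hamiltonian.
by apply/funext => x; exact: mulrCA.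
Qed.

Lemma eigenspaceD Psi (V : Rd R d -> R) (lambda : R[i]) f g :
  Defs.eigenspace (hamiltonian Psi V) lambda f ->
  Defs.eigenspace (hamiltonian Psi V) lambda g ->
  Defs.eigenspace (hamiltonian Psi V) lambda (fun x => f x + g x).
Proof.
move=> Hf Hg; have := hamiltonianD Hf Hg; rewrite /Defs.eigenspace /mkset; congr hamiltonian.
by apply/funext => x; rewrite mulrDr.
Qed.

Lemma eigenspace_L2 Psi (V : Rd R d -> R) (lambda : R[i]) f :
  Defs.eigenspace (hamiltonian Psi V) lambda f -> L2 f.
Proof. by move=> [_ [a [b [_ []]]]]. Qed.

Lemma eigenspace_parts Psi (V : Rd R d -> R) (lambda : R[i]) f :
  Defs.eigenspace (hamiltonian Psi V) lambda f ->
  exists h a b : Rd R d -> R[i], [/\ fourier f h,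
    fourier a (fun xi => (Psi (dotRd xi xi / 2))%:C%C * h xi),
    multiplication V f b & (fun x => lambda * f x) = (fun x => a x + b x) %[ae mu]].
Proof. by move=> [Lg [a [b [[h Fh Fa] fb E]]]]; exists h, a, b. Qed.

(** The symbol is real on the Fourier side and the potential is real on the position side, so each
    moves across its pairing pointwise. *)
Lemma hamiltonian_symmetric Psi (V : Rd R d -> R) f g f' g' :
  hamiltonian Psi V f g -> hamiltonian Psi V f' g' -> rip f g' = rip g f'.
Proof.
move=> [Lg [a [b [[h Fh Fa] [Lf Lb bf] gab]]]] [Lg' [a' [b' [[h' Fh' Fa'] [Lf' Lb' bf'] gab']]]].
have La := fourier_L2l Fa; have La' := fourier_L2l Fa'.
have refl (u : Rd R d -> R[i]) : u = u %[ae mu] by apply: aeW.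
rewrite (rip_ae Lf Lg' Lf (L2D La' Lb') (refl f) gab').
rewrite (rip_ae Lg Lf' (L2D La Lb) Lf' gab (refl f')).
rewrite ripDr// ripDl//; congr (_ + _).
  rewrite -(fourier_rip Fh Fa') -(fourier_rip Fa Fh').
  by apply: eq_Rintegral => xi _; rewrite /reip !reim/=; ring.
rewrite /rip /Rintegral; congr fine; apply: ae_eq_integral => //.
- by apply/measurable_EFinP; apply: measurable_reip; exact: L2_meas.
- by apply/measurable_EFinP; apply: measurable_reip; exact: L2_meas.
apply: filterS2 bf bf' => x /(_ Logic.I) -> /(_ Logic.I) -> _; congr EFin.
by rewrite /reip !reim/=; ring.
Qed.

(** The real inner product detects Im lambda once f is paired with i f: symmetry then reads Im
    lambda |f|^2 = - Im lambda |f|^2. *)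
Lemma eigenvalue_real Psi (V : Rd R d -> R) (lambda : R[i]) f :
  Defs.eigenspace (hamiltonian Psi V) lambda f -> N2 f != 0 ->
  lambda = (complex.Re lambda)%:C%C.
Proof.
move=> Hf N0; have Lf := eigenspace_L2 Hf.
have Lif : L2 (fun x => 'i%C * f x) by exact: L2Z.
have := hamiltonian_symmetric (hamiltonianZ 'i%C Hf) Hf.
have -> : rip (fun x => 'i%C * f x) (fun x => lambda * f x) = complex.Im lambda * N2 f ^+ 2.
  rewrite -rip_id// /rip -RintegralZl//; last exact: reip_integ.
  by apply: eq_Rintegral => x _; rewrite /reip !reim/=; ring.
have -> : rip (fun x => 'i%C * (lambda * f x)) f = - (complex.Im lambda * N2 f ^+ 2).
  rewrite -rip_id// /rip -mulNr -RintegralZl//; last exact: reip_integ.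
  by apply: eq_Rintegral => x _; rewrite /reip !reim/=; ring.
move=> h; have : complex.Im lambda * N2 f ^+ 2 = 0 by lra.
move/eqP; rewrite mulf_eq0 sqrf_eq0 (negbTE N0) orbF => /eqP.
by case: lambda {Hf h} => x y /= ->.
Qed.

Lemma eigenspace_orthogonal Psi (V : Rd R d -> R) (l l' : R) f f' :
  Defs.eigenspace (hamiltonian Psi V) l%:C%C f -> Defs.eigenspace (hamiltonian Psi V) l'%:C%C f' ->
  l != l' -> rip f f' = 0.
Proof.
move=> Hf Hf' ll'; have := hamiltonian_symmetric Hf Hf'.
have Lf := eigenspace_L2 Hf; have Lf' := eigenspace_L2 Hf'.
rewrite ripZr// ripZl// => /eqP; rewrite -subr_eq0 -mulrBl mulf_eq0 subr_eq0.
by rewrite eq_sym (negbTE ll') => /eqP.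
Qed.

End operators.

(** * The weight <x> *)

Section japanese.
Context {R : realType} (d : nat).

Lemma measurable_japanese : measurable_fun setT (@japanese_bracket R d).
Proof.
apply: (measurableT_comp (f := @Num.sqrt R)).
  by apply: continuous_measurable_fun => x; exact: sqrt_continuous.
by apply: measurable_funD => //; exact: measurable_dotRd2.
Qed.

Lemma japanese_sqr (x : Rd R d) : japanese_bracket x ^+ 2 = 1 + dotRd x x.
Proof. by rewrite sqr_sqrtr// addr_ge0// dotRd_ge0. Qed.

End japanese.

(** * Estimates for one eigenfunction *)

Section eigenvalue_estimates.
Context {R : realType} (d : nat).
Local Notation mu := (@lebesgue_Rd R d).
Local Notation L2 := (cLp 2%:E).
Variables (Psi : R -> R) (V : Rd R d -> R).
Hypothesis mPsi : measurable_fun (`[0, +oo[ : set R) Psi.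
Hypothesis mV : measurable_fun setT V.
Hypothesis dPsi : forall u : R, 0 < u -> derivable Psi u 1.
Hypothesis Psi_ge0 : forall u : R, 0 <= u -> 0 <= Psi u.
Hypothesis dPsi_ge0 : forall u : R, 0 < u -> 0 <= derive1 Psi u.
Hypothesis Psi0 : Psi 0 = 0.
Hypothesis H2 : exists c1 d1 : R, [/\ 0 <= c1, 0 <= d1 &
  forall u : R, 0 <= u -> Num.sqrt u <= c1 * Psi u + d1].
Hypothesis H3 : exists c2 d2 : R, [/\ 0 <= c2, 0 <= d2 &
  forall u : R, 0 <= u -> u * derive1 Psi u <= c2 * Psi u + d2].
Hypothesis H4 : exists2 mu : R, 0 < mu &
  forall u : R, 0 <= u -> mu * Psi u <= 2 * (u * derive1 Psi u).

Let m (xi : Rd R d) : R := Psi (dotRd xi xi / 2).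
Let W (x : Rd R d) : R := japanese_bracket x * V x.

Let mm : measurable_fun setT m. Proof. exact: measurable_kinetic. Qed.

Let refl_ae (u : Rd R d -> R[i]) : u = u %[ae mu]. Proof. exact: aeW. Qed.

(* [f] solves [H f = l f], [h] is its Fourier transform, [a = H_0 f], [b = V f] and
   [w = <x> V f]. *)
Definition eigen_data (l : R) (f h a b w : Rd R d -> R[i]) :=
  [/\ fourier f h, fourier a (fun xi => (m xi)%:C%C * h xi), multiplication V f b,
    multiplication W f w & (fun x => l%:C%C * f x) = (fun x => a x + b x) %[ae mu]].

Section one_eigenfunction.
Variables (l : R) (f h a b w : Rd R d -> R[i]).
Hypothesis D : eigen_data l f h a b w.

Let Fh : fourier f h. Proof. by case: D. Qed.
Let Fa : fourier a (fun xi => (m xi)%:C%C * h xi). Proof. by case: D. Qed.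
Let Lf : L2 f. Proof. exact: fourier_L2l Fh. Qed.
Let Lh : L2 h. Proof. exact: fourier_L2r Fh. Qed.
Let La : L2 a. Proof. exact: fourier_L2l Fa. Qed.
Let Lmh : L2 (fun xi => (m xi)%:C%C * h xi). Proof. exact: fourier_L2r Fa. Qed.
Let Lb : L2 b. Proof. by case: D => _ _ []. Qed.
Let Lw : L2 w. Proof. by case: D => _ _ _ []. Qed.
Let bE : b = (fun x => (V x)%:C%C * f x) %[ae mu]. Proof. by case: D => _ _ []. Qed.
Let wE : w = (fun x => (W x)%:C%C * f x) %[ae mu]. Proof. by case: D => _ _ _ []. Qed.
Let sumE : (fun x => l%:C%C * f x) = (fun x => a x + b x) %[ae mu]. Proof. by case: D. Qed.

Lemma potential_part_le : N2 b <= N2 w.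
Proof.
rewrite -[leRHS]mul1r; apply: N2_dom => //; first exact: L2_meas.
apply: filterS2 bE wE => x /(_ Logic.I) -> /(_ Logic.I) ->.
rewrite !sqcM !sqc_real expr1n mul1r ler_wpM2r ?sqc_ge0// /W exprMn japanese_sqr.
by rewrite ler_peMl ?sqr_ge0// lerDl dotRd_ge0.
Qed.

Let xj j (x : Rd R d) : R := (tnth x j : R).
Let mxj j : measurable_fun setT (xj j). Proof. exact: measurable_tnth. Qed.

Let xb_ae j : {ae mu, forall x, sqc ((xj j x)%:C%C * b x) <= 1 ^+ 2 * sqc (w x)}.
Proof.
apply: filterS2 bE wE => x /(_ Logic.I) -> /(_ Logic.I) ->.
rewrite !sqcM !sqc_real expr1n mul1r mulrA ler_wpM2r ?sqc_ge0// /W exprMn japanese_sqr.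
by rewrite ler_wpM2r ?sqr_ge0// (le_trans (coordinate_sqr_le j x))// lerDr.
Qed.

Let mxb j : cmeasurable (fun x => (xj j x)%:C%C * b x).
Proof. by apply: cmeasurableM; [exact: cmeasurable_real|exact: L2_meas]. Qed.

Let Lxb j : L2 (fun x => (xj j x)%:C%C * b x).
Proof. exact: L2_dom (mxb j) Lw (xb_ae j). Qed.

Let Nxb j : N2 (fun x => (xj j x)%:C%C * b x) <= N2 w.
Proof. by rewrite -[leRHS]mul1r; apply: N2_dom (mxb j) Lw (xb_ae j). Qed.

Section momentum.
Variables (c1 d1 : R).
Hypotheses (c10 : 0 <= c1) (d10 : 0 <= d1).
Hypothesis sqrt_le : forall u : R, 0 <= u -> Num.sqrt u <= c1 * Psi u + d1.

Let k (xi : Rd R d) : R[i] := (c1%:C%C * ((m xi)%:C%C * h xi)) + d1%:C%C * h xi.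

Let Lk : L2 k. Proof. by apply: L2D; exact: L2Z. Qed.

(** |xi_j| <= |xi| = sqrt 2 sqrt (|xi|^2 / 2), and (H.2) bounds the last root; the 2 is a rounded
    sqrt 2. *)
Let xh_ae j : {ae mu, forall xi, sqc ((xj j xi)%:C%C * h xi) <= 2 ^+ 2 * sqc (k xi)}.
Proof.
apply: aeW => xi.
have -> : k xi = (c1 * m xi + d1)%:C%C * h xi.
  by rewrite /k rmorphD rmorphM/= mulrDl mulrA.
rewrite !sqcM !sqc_real mulrA ler_wpM2r ?sqc_ge0//.
have u0 : 0 <= dotRd xi xi / 2 by rewrite divr_ge0// dotRd_ge0.
rewrite (le_trans (coordinate_sqr_le j xi))//.
have -> : dotRd xi xi = 2 * Num.sqrt (dotRd xi xi / 2) ^+ 2.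
  by rewrite sqr_sqrtr//; field.
have h1 : Num.sqrt (dotRd xi xi / 2) ^+ 2 <= (c1 * m xi + d1) ^+ 2.
  have h0 := sqrt_le u0.
  by rewrite lerXn2r ?nnegrE ?sqrtr_ge0// (le_trans _ h0)// sqrtr_ge0.
have h2 := sqr_ge0 (c1 * m xi + d1).
have -> : 2 ^+ 2 = 4 :> R by ring.
by lra.
Qed.

Let mxh j : cmeasurable (fun x => (xj j x)%:C%C * h x).
Proof. by apply: cmeasurableM; [exact: cmeasurable_real|exact: L2_meas]. Qed.

Let Lxh j : L2 (fun x => (xj j x)%:C%C * h x).
Proof. exact: L2_dom (mxh j) Lk (xh_ae j). Qed.

Let Nxh j : N2 (fun x => (xj j x)%:C%C * h x) <= 2 * (c1 * N2 a + d1 * N2 f).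
Proof.
have h1 : N2 (fun x => (xj j x)%:C%C * h x) <= 2 * N2 k by apply: N2_dom (mxh j) Lk (xh_ae j).
rewrite (le_trans h1)// ler_wpM2l//.
have h2 := N2D_le (L2Z c1%:C%C Lmh) (L2Z d1%:C%C Lh).
rewrite (le_trans h2)// !N2Z// !sqc_real !sqrtr_sqr !ger0_norm//.
by rewrite (fourier_N2 Fa) (fourier_N2 Fh).
Qed.

Let G (xi : Rd R d) : R[i] := (l - m xi)%:C%C * h xi.

(** The eigenvalue equation holds almost everywhere, whereas the virial inequality takes [G] given
    by a formula at every point; [fourier_ae] reconciles the two. *)
Let FG : fourier b G.
Proof.
have F1 := fourierB (fourierZ l%:C%C Fh) Fa.
apply: (fourier_ae F1).
- exact: L2_meas.
- apply: cmeasurableM; last exact: L2_meas.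
  by apply: cmeasurable_real; exact: measurable_funB.
- by apply: filterS sumE => x /(_ Logic.I) -> _; rewrite addrAC subrr add0r.
- by apply: aeW => xi _; rewrite /G rmorphB/= mulrBl.
Qed.

(** Each coordinate contributes (2 * 2 (c1 |a| + d1) + 1) |w|, one 2 from the virial inequality and
    one from [Nxh]. There are d coordinates, division by mu0 comes from (H.4), and the last + 1
    accounts for <f, V f>. The product form (|a| + 1) |w| is what compactness can exploit. *)
Lemma eigenvalue_estimate mu0 : 0 < mu0 ->
  (forall u : R, 0 <= u -> mu0 * Psi u <= 2 * (u * derive1 Psi u)) ->
  N2 f = 1 ->
  `|l| <= (d%:R / mu0 * (4 * c1 + 4 * d1 + 1) + 1) * (N2 a + 1) * N2 w.
Proof.
move=> mu00 psi4 f1.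
have [c2 [d2 [c20 d20 growth]]] := H3.
have h1 : N2 h = 1 by rewrite (fourier_N2 Fh).
have vir j := virial_coordinate mPsi dPsi Psi_ge0 dPsi_ge0 Psi0 c20 d20 growth Fh FG
  (fun xi => erefl) Lmh (Lxb j) (Lxh j).
pose t j (xi : Rd R d) : R := xj j xi ^+ 2 * derive1 Psi (dotRd xi xi / 2) * sqc (h xi).
have it j : mu.-integrable setT (EFin \o t j) by have [] := vir j.
have Na0 : 0 <= N2 a by exact: N2_ge0.
have Nw0 : 0 <= N2 w by exact: N2_ge0.
have tle j : \int[mu]_xi t j xi <= (4 * (c1 * N2 a + d1) + 1) * N2 w.
  have [_ v] := vir j; rewrite (le_trans v)// h1 mulr1 [leRHS]mulrDl mul1r.
  apply: lerD; last exact: potential_part_le.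
  apply: ler_pM; [by rewrite mulr_ge0// N2_ge0|exact: N2_ge0| |exact: (Nxb j)].
  have := Nxh j; rewrite f1 mulr1 => hx; rewrite -/(xj j); lra.
have [isum sumI] := Rintegral_big (index_enum 'I_d) it.
pose I := \int[mu]_xi (m xi * sqc (h xi)).
have imh : mu.-integrable setT (EFin \o (fun xi => m xi * sqc (h xi))).
  have := reip_integ Lmh Lh; apply: eq_integrable => // xi _; congr EFin.
  by rewrite /reip /sqc !reim/=; ring.
have I0 : 0 <= I.
  apply: Rintegral_ge0 => xi _; rewrite mulr_ge0 ?sqc_ge0// Psi_ge0//.
  by rewrite divr_ge0// dotRd_ge0.
(* Summed over j, the squares xi_j^2 give |xi|^2 = 2 u with u = |xi|^2 / 2, so the integrands on the
   virial side add up to 2 u Psi'(u) |h|^2. *)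
have muI : mu0 * I <= d%:R * ((4 * (c1 * N2 a + d1) + 1) * N2 w).
  rewrite -RintegralZl//; apply: (@le_trans _ _ (\int[mu]_xi (\sum_(j <- index_enum 'I_d) t j xi))).
    apply: le_Rintegral => //; first exact: integrable_RZ.
    move=> xi _; rewrite /t -mulr_suml -mulr_suml mulrA ler_wpM2r ?sqc_ge0//.
    have -> : \sum_(i <- index_enum 'I_d) xj i xi ^+ 2 = dotRd xi xi.
      by apply: eq_bigr => i _; rewrite expr2.
    rewrite (le_trans (psi4 _ _))//; first by rewrite divr_ge0// dotRd_ge0.
    by rewrite le_eqVlt; apply/orP; left; apply/eqP; field.
  rewrite sumI (le_trans (ler_sum _ (fun j _ => tle j)))//.
  by rewrite sumr_const card_ord [leRHS]mulr_natl.
have lE : l = I + rip f b.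
  have <- : rip f (fun x => l%:C%C * f x) = l by rewrite ripZr// rip_id// f1 expr1n mulr1.
  rewrite (rip_ae Lf (L2Z l%:C%C Lf) Lf (L2D La Lb) (refl_ae f) sumE) ripDr//; congr (_ + _).
  rewrite -(fourier_rip Fh Fa); apply: eq_Rintegral => xi _.
  by rewrite /reip /sqc !reim/=; ring.
have Il : I <= d%:R / mu0 * ((4 * (c1 * N2 a + d1) + 1) * N2 w).
  by rewrite mulrAC ler_pdivlMr// mulrC.
have fb : `|rip f b| <= N2 w.
  by rewrite (le_trans (cauchy_schwarz Lf Lb))// f1 mul1r potential_part_le.
rewrite {1}lE (le_trans (ler_normD _ _))// ger0_norm//.
rewrite (le_trans (lerD Il fb))//.
have dmu : 0 <= d%:R / mu0 by rewrite divr_ge0// ltW.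
have p1 : 4 * (c1 * N2 a + d1) + 1 <= (4 * c1 + 4 * d1 + 1) * (N2 a + 1).
  have -> : (4 * c1 + 4 * d1 + 1) * (N2 a + 1) =
    4 * (c1 * N2 a + d1) + 1 + (4 * (d1 * N2 a) + N2 a + 4 * c1) by ring.
  by rewrite lerDl !addr_ge0 ?mulr_ge0.
have p2 : d%:R / mu0 * ((4 * (c1 * N2 a + d1) + 1) * N2 w) <=
    d%:R / mu0 * ((4 * c1 + 4 * d1 + 1) * (N2 a + 1) * N2 w).
  by rewrite ler_wpM2l// ler_wpM2r.
rewrite (le_trans (lerD p2 (lexx _)))//.
rewrite [leRHS](_ : _ = d%:R / mu0 * ((4 * c1 + 4 * d1 + 1) * (N2 a + 1) * N2 w) +
  (N2 a + 1) * N2 w); last by ring.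
by rewrite lerD2l ler_peMl// lerDr.
Qed.

End momentum.

Lemma kinetic_part_le : N2 a <= `|l| * N2 f + N2 w.
Proof.
have LB : L2 (fun x => l%:C%C * f x - b x) by apply: L2B => //; exact: L2Z.
have -> : N2 a = N2 (fun x => l%:C%C * f x - b x).
  by apply: N2_ae => //; apply: filterS sumE => x h0 /h0 ->; rewrite addrK.
rewrite (le_trans (N2B_le (L2Z _ Lf) Lb))// lerD ?potential_part_le//.
by rewrite N2Z// sqc_real sqrtr_sqr.
Qed.

End one_eigenfunction.

End eigenvalue_estimates.

(** * Compactness *)

Section compactness.
Context {R : realType} (d : nat).
Local Notation mu := (@lebesgue_Rd R d).
Local Notation L2 := (cLp 2%:E).
Local Notation F := (Rd R d -> R[i]).
Variables (Psi : R -> R) (V : Rd R d -> R).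
Hypothesis mPsi : measurable_fun (`[0, +oo[ : set R) Psi.
Hypothesis mV : measurable_fun setT V.
Hypothesis dPsi : forall u : R, 0 < u -> derivable Psi u 1.
Hypothesis Psi_ge0 : forall u : R, 0 <= u -> 0 <= Psi u.
Hypothesis dPsi_ge0 : forall u : R, 0 < u -> 0 <= derive1 Psi u.
Hypothesis Psi0 : Psi 0 = 0.
Hypothesis H2 : exists c1 d1 : R, [/\ 0 <= c1, 0 <= d1 &
  forall u : R, 0 <= u -> Num.sqrt u <= c1 * Psi u + d1].
Hypothesis H3 : exists c2 d2 : R, [/\ 0 <= c2, 0 <= d2 &
  forall u : R, 0 <= u -> u * derive1 Psi u <= c2 * Psi u + d2].
Hypothesis H4 : exists2 mu : R, 0 < mu &
  forall u : R, 0 <= u -> mu * Psi u <= 2 * (u * derive1 Psi u).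
Hypothesis H5 : relatively_compact
  (multiplication (fun x => japanese_bracket x * V x)) (free_hamiltonian Psi).

Let W (x : Rd R d) : R := japanese_bracket x * V x.

Let mW : measurable_fun setT W.
Proof. by apply: measurable_funM => //; exact: measurable_japanese. Qed.

Lemma increasing_cvg_infty (phi : nat -> nat) : {homo phi : m n / (m < n)%N} ->
  phi n @[n --> \oo] --> \oo.
Proof.
move=> homo; have ge n : (n <= phi n)%N.
  by elim: n => // n IH; exact: leq_ltn_trans IH (homo n n.+1 (ltnSn n)).
by move=> P [N _ hN]; exists N => // n /= Nn; apply: hN; exact: leq_trans Nn (ge n).
Qed.

(** Relative compactness gives a strong limit g along a subsequence; as u_n is weakly null,
    [multiplication_weak_closed] forces g = 0. *)
Lemma weakly_null_compact (u v w : nat -> F) (M : R) :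
  (forall n, free_hamiltonian Psi (u n) (v n)) ->
  (forall n, multiplication W (u n) (w n)) ->
  (forall n, N2 (u n) <= M) -> (forall n, N2 (v n) <= M) ->
  (forall phi, L2 phi -> rip phi (u n) @[n --> \oo] --> 0) ->
  exists2 phi : nat -> nat, {homo phi : m n / (m < n)%N} &
    N2 (w (phi n)) @[n --> \oo] --> 0.
Proof.
move=> uv uw uM vM weak.
have Lu n : L2 (u n) by have [] := uw n.
have Lw n : L2 (w n) by have [] := uw n.
have Lv n : L2 (v n) by have [h _ [? _ _]] := uv n.
have bu : L2_bounded u by exists M => n; rewrite cLnorm2_L2// lee_fin.
have bv : L2_bounded v by exists M => n; rewrite cLnorm2_L2// lee_fin.
have [phi [hom [g Lg wg]]] := H5.2 u v w uv bu bv uw.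
exists phi => //.
have wg' : N2 (fun x => w (phi n) x - g x) @[n --> \oo] --> 0.
  exact: (@L2_cvgP R d (w \o phi) g (fun n => Lw _) Lg).1 wg.
have g0 : N2 g = 0.
  apply: (multiplication_weak_closed (W := W) (f := u \o phi) (w := w \o phi)) => //.
  - by move=> n; exact: Lu.
  - by move=> n; exact: Lw.
  - by move=> n; have [] := uw (phi n).
  move=> psi Lpsi.
  exact: (cvg_comp _ _ (increasing_cvg_infty hom) (weak psi Lpsi)).
apply: (cvg0_le _ wg') => n; rewrite N2_ge0/=.
by have := N2_le_sub (Lw (phi n)) Lg; rewrite g0 addr0.
Qed.

Lemma eigen_has_data (l : R) (f : F) :
  Defs.eigenspace (hamiltonian Psi V) l%:C%C f ->
  exists h a b w, eigen_data Psi V l f h a b w.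
Proof.
move=> /eigenspace_parts[h [a [b [Fh Fa fb E]]]].
have [w fw] : dom (multiplication W) f by apply: H5.1; exists a; exists h.
by exists h, a, b, w.
Qed.

Lemma kinetic_bound (Lam : R) : exists C : R, forall l f h a b w,
  eigen_data Psi V l f h a b w -> `|l| <= Lam -> N2 f = 1 -> N2 a <= C.
Proof.
apply: contrapT => /forallNP H.
have ex n : exists q : R * F * F * F * F * F,
    let: (l, f, h, a, b, w) := q in
    [/\ eigen_data Psi V l f h a b w, `|l| <= Lam, N2 f = 1 & n.+1%:R < N2 a].
  have := H n.+1%:R.
  move=> /existsNP[l] /existsNP[f] /existsNP[h] /existsNP[a] /existsNP[b] /existsNP[w].
  move=> /not_implyP[D] /not_implyP[lL] /not_implyP[f1] /negP; rewrite -ltNge => na.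
  by exists (l, f, h, a, b, w).
have [q qP] := choice ex.
pose l n := (q n).1.1.1.1.1; pose f n := (q n).1.1.1.1.2; pose h n := (q n).1.1.1.2.
pose a n := (q n).1.1.2; pose b n := (q n).1.2; pose w n := (q n).2.
have P n : [/\ eigen_data Psi V (l n) (f n) (h n) (a n) (b n) (w n),
    `|l n| <= Lam, N2 (f n) = 1 & n.+1%:R < N2 (a n)].
  by have := qP n; rewrite /l /f /h /a /b /w; case: (q n) => [[[[[? ?] ?] ?] ?] ?].
have D n : eigen_data Psi V (l n) (f n) (h n) (a n) (b n) (w n) by have [] := P n.
have a0 n : 0 < N2 (a n) by have [_ _ _ na] := P n; exact: le_lt_trans na.
(* The scale at which the kinetic parts have norm 1, while the eigenfunctions shrink at least like 1
   / (n + 1). *)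
pose s n := (N2 (a n))^-1.
have s0 n : 0 < s n by rewrite invr_gt0.
have s_le n : s n <= n.+1%:R^-1.
  by have [_ _ _ na] := P n; rewrite lef_pV2 ?posrE// ltW.
have s_cvg : s n @[n --> \oo] --> 0.
  apply: (@cvg0_le R _ (fun n => n.+1%:R^-1)); last exact: cvg_harmonic.
  by move=> n; rewrite (ltW (s0 n)) s_le.
have Lf n : L2 (f n) by have [Ff _ _ _ _] := D n; exact: fourier_L2l Ff.
have La n : L2 (a n) by have [_ Fa _ _ _] := D n; exact: fourier_L2l Fa.
have Lw n : L2 (w n) by have [_ _ _ [] ] := D n.
have Ns (g : F) n : L2 g -> N2 (fun x => (s n)%:C%C * g x) = s n * N2 g.
  by move=> Lg; rewrite N2Z// sqc_real sqrtr_sqr gtr0_norm.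
have Nu n : N2 (fun x => (s n)%:C%C * f n x) = s n.
  by rewrite Ns//; have [_ _ -> _] := P n; rewrite mulr1.
have s1 n : s n <= 1 by rewrite (le_trans (s_le n))// invf_le1// ler1n.
have [phi hom wphi] : exists2 phi : nat -> nat, {homo phi : m n / (m < n)%N} &
    N2 (fun x => (s (phi n))%:C%C * w (phi n) x) @[n --> \oo] --> 0.
  apply: (@weakly_null_compact (fun n x => (s n)%:C%C * f n x)
    (fun n x => (s n)%:C%C * a n x) (fun n x => (s n)%:C%C * w n x) 1).
  - by move=> n; have [Fh Fa _ _ _] := D n; apply: fourier_multiplierZ; exists (h n).
  - by move=> n; have [_ _ _ fw _] := D n; exact: multiplicationZ.
  - by move=> n; rewrite Nu.
  - by move=> n; rewrite Ns// /s mulVf// gt_eqF.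
  (* The scaled eigenfunctions tend to 0 in norm, hence weakly. *)
  move=> psi Lpsi; apply/norm_cvg0P.
  apply: (@cvg0_le R _ (fun n => N2 psi * s n)).
    by move=> n; rewrite normr_ge0/= (le_trans (cauchy_schwarz Lpsi (L2Z _ (Lf n))))// Nu.
  by rewrite -[X in _ --> X](mulr0 (N2 psi)); apply: cvgM => //; exact: cvg_cst.
(* The estimate [kinetic_part_le] after scaling. Both terms on the right tend to 0, which
   contradicts the 1 on the left. *)
have key n : 1 <= Lam * s (phi n) + N2 (fun x => (s (phi n))%:C%C * w (phi n) x).
  have [Dn lL f1 _] := P (phi n); have := kinetic_part_le Dn; rewrite f1 mulr1 => h1.
  rewrite Ns//.
  have -> : 1 = s (phi n) * N2 (a (phi n)) by rewrite /s mulVf// gt_eqF.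
  rewrite [Lam * _]mulrC -mulrDr ler_wpM2l ?(ltW (s0 _))//.
  by rewrite (le_trans h1)// lerD2r.
have lim : Lam * s (phi n) + N2 (fun x => (s (phi n))%:C%C * w (phi n) x) @[n --> \oo] --> Lam * 0 + 0.
  apply: cvgD => //; apply: cvgM; first exact: cvg_cst.
  exact: (cvg_comp _ _ (increasing_cvg_infty hom) s_cvg).
have one : (fun _ : nat => 1 : R) n @[n --> \oo] --> (1 : R) by exact: cvg_cst.
have : (1 : R) <= Lam * 0 + 0 by apply: (ler_cvg_to one lim); exact: nearW.
by rewrite mulr0 addr0 ler10.
Qed.

Theorem no_orthonormal_eigensequence (e : nat -> F) (l : nat -> R) (delta Lam : R) :
  0 < delta -> (forall n, Defs.eigenspace (hamiltonian Psi V) (l n)%:C%C (e n)) ->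
  (forall n, N2 (e n) = 1) -> (forall i j, (i < j)%N -> rip (e i) (e j) = 0) ->
  (forall n, delta <= `|l n| <= Lam) -> False.
Proof.
move=> delta0 He e1 eo ll.
have ex n : exists q : F * F * F * F,
    let: (h, a, b, w) := q in eigen_data Psi V (l n) (e n) h a b w.
  by have [h [a [b [w D]]]] := eigen_has_data (He n); exists (h, a, b, w).
have [q qP] := choice ex.
pose h n := (q n).1.1.1; pose a n := (q n).1.1.2; pose b n := (q n).1.2; pose w n := (q n).2.
have D n : eigen_data Psi V (l n) (e n) (h n) (a n) (b n) (w n).
  by have := qP n; rewrite /h /a /b /w; case: (q n) => [[[? ?] ?] ?].
have [C aC] := kinetic_bound Lam.
have aC' n : N2 (a n) <= C by have /andP[_ lL] := ll n; exact: aC (D n) lL (e1 n).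
have Le n : L2 (e n) by exact: eigenspace_L2 (He n).
have [phi hom wphi] : exists2 phi : nat -> nat, {homo phi : m n / (m < n)%N} &
    N2 (w (phi n)) @[n --> \oo] --> 0.
  (* One bound for both sequences: 1 for the eigenfunctions, C for their kinetic parts. *)
  apply: (@weakly_null_compact e a w (Num.max 1 C)).
  - by move=> n; have [Fh Fa _ _ _] := D n; exists (h n).
  - by move=> n; have [_ _ _ fw _] := D n.
  - by move=> n; rewrite e1 le_max lexx.
  - by move=> n; rewrite le_max aC' orbT.
  by move=> psi Lpsi; exact: bessel_cvg0.
have [c1 [d1 [c10 d10 sq]]] := H2; have [mu0 mu00 psi4] := H4.
pose K := (d%:R / mu0 * (4 * c1 + 4 * d1 + 1) + 1) * (C + 1).
have C0 : 0 <= C by exact: le_trans (N2_ge0 (a 0%N)) (aC' 0%N).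
(* The factor |a| + 1 is now bounded by C + 1, so the eigenvalue is controlled by |w| alone, which
   tends to 0 along phi. *)
have key n : delta <= K * N2 (w (phi n)).
  have /andP[dl _] := ll (phi n); rewrite (le_trans dl)//.
  have est := eigenvalue_estimate mPsi dPsi Psi_ge0 dPsi_ge0 Psi0 H3 (D (phi n))
    c10 d10 sq mu00 psi4 (e1 _).
  rewrite (le_trans est)// ler_wpM2r ?N2_ge0// ler_wpM2l//; last by rewrite lerD2r.
  by rewrite addr_ge0// mulr_ge0 ?divr_ge0 ?addr_ge0 ?mulr_ge0// ltW.
have lim : K * N2 (w (phi n)) @[n --> \oo] --> K * 0.
  by apply: cvgM => //; exact: cvg_cst.
have dc : (fun _ : nat => delta) n @[n --> \oo] --> delta by exact: cvg_cst.
have : delta <= K * 0 by apply: (ler_cvg_to dc lim); exact: nearW.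
by rewrite mulr0 leNgt delta0.
Qed.

End compactness.

(** * Discreteness of the point spectrum *)

Section discreteness.
Context {R : realType} (d : nat).
Local Notation mu := (@lebesgue_Rd R d).
Local Notation L2 := (cLp 2%:E).
Local Notation F := (Rd R d -> R[i]).
Local Notation normc := ComplexField.Normc.normc.
Variables (Psi : R -> R) (V : Rd R d -> R).

Local Notation H := (hamiltonian Psi V).

(** The only analytic input of the section, discharged by [no_orthonormal_eigensequence]; the rest
    is symmetry and Gram-Schmidt. *)
Hypothesis no_sequence : forall (e : nat -> F) (l : nat -> R) (delta Lam : R),
  0 < delta -> (forall n, Defs.eigenspace H (l n)%:C%C (e n)) ->
  (forall n, N2 (e n) = 1) -> (forall i j, (i < j)%N -> rip (e i) (e j) = 0) ->
  (forall n, delta <= `|l n| <= Lam) -> False.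

Lemma normalized_eigenfunction (lambda : R[i]) (f : F) :
  Defs.eigenspace H lambda f -> N2 f != 0 ->
  exists2 g, Defs.eigenspace H lambda g & N2 g = 1.
Proof.
move=> Hf f0; exists (fun x => ((N2 f)^-1)%:C%C * f x); first exact: eigenspaceZ.
by rewrite (N2Z _ (eigenspace_L2 Hf)) sqc_real sqrtr_sqr ger0_norm ?invr_ge0 ?N2_ge0// mulVf.
Qed.

Lemma point_spectrum_normalized (lambda : R[i]) : point_spectrum H lambda ->
  exists2 l : R, lambda = l%:C%C &
    exists2 f, Defs.eigenspace H l%:C%C f & N2 f = 1.
Proof.
move=> [f Hf f0]; have N0 : N2 f != 0.
  by apply/eqP => /(N2_eq0 (eigenspace_L2 Hf)).
have lE := eigenvalue_real Hf N0.
exists (complex.Re lambda) => //; rewrite -lE.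
exact: normalized_eigenfunction Hf N0.
Qed.

(** If no finite family spans, Gram-Schmidt extends any finite orthonormal family in the eigenspace
    and so builds a forbidden sequence with constant eigenvalue. Orthogonality for the real inner
    product suffices: a function outside the complex span is outside the real one as well. *)
Lemma finite_multiplicity_of_no_sequence (lambda : R[i]) :
  point_spectrum H lambda -> lambda != 0 -> finite_multiplicity H lambda.
Proof.
move=> /point_spectrum_normalized[l lE [f0 Hf0 _]] lam0; apply: contrapT => nf.
have l0 : l != 0 by apply: contra_neq lam0 => l0; rewrite lE l0.
pose P f := Defs.eigenspace H lambda f /\ N2 f = 1.
have ext n (e : nat -> F) : (forall i, (i < n)%N -> P (e i)) ->
    (forall i j, (i < j < n)%N -> rip (e i) (e j) = 0) ->
    exists2 f, P f & forall i, (i < n)%N -> rip (e i) f = 0.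
  move=> Pe oe.
  have [f [Hf fc]] : exists f, Defs.eigenspace H lambda f /\
      ~ exists c : 'I_n -> R[i], f = (fun x => \sum_i c i * e i x) %[ae mu].
    apply: contrapT => /forallNP h; apply: nf; exists n, (fun i : 'I_n => e i); split.
      by move=> i; have [] := Pe i (ltn_ord i).
    by move=> f Hf; apply: contrapT => fc; apply: (h f).
  have Lf := eigenspace_L2 Hf.
  have Le i : (i < n)%N -> L2 (e i) by move=> /Pe[/eigenspace_L2].
  pose c i : R := rip (e i) f.
  pose T k : F := fun x => \sum_(i < k) (c i)%:C%C * e i x.
  have TS k : T k.+1 = (fun x => T k x + (c k)%:C%C * e k x).
    by apply/funext => x; rewrite /T big_ord_recr.
  have HT k : (k <= n)%N -> Defs.eigenspace H lambda (T k).
    elim: k => [_|k IH kn].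
      have -> : T 0%N = (fun x => 0 * f x) by apply/funext => x; rewrite /T big_ord0 mul0r.
      exact: eigenspaceZ.
    rewrite TS; apply: eigenspaceD; first exact: IH (ltnW kn).
    by apply: eigenspaceZ; have [] := Pe k kn.
  have rT k j : (k <= n)%N -> (j < n)%N -> rip (e j) (T k) = if (j < k)%N then c j else 0.
    move=> + jn; elim: k => [_|k IH kn].
      have -> : T 0%N = (fun x => 0%:C%C * f x).
        by apply/funext => x; rewrite /T big_ord0 rmorph0 mul0r.
      by rewrite ripZr ?mul0r//; exact: Le.
    rewrite TS ripDr; [|exact: eigenspace_L2 (HT k (ltnW kn))|by apply: L2Z; exact: Le|exact: Le].
    rewrite IH ?(ltnW kn)// ripZr; [|exact: Le|exact: Le].
    rewrite ltnS (leq_eqVlt j); have [->|jk] := eqVneq j k.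
      have := rip_id (Le k kn); rewrite (Pe k kn).2 expr1n ltnn add0r => ->; by rewrite mulr1.
    have -> : rip (e j) (e k) = 0.
      move: jk; rewrite neq_ltn => /orP[jk|kj]; first by rewrite oe// jk.
      by rewrite ripC oe// kj.
    by rewrite mulr0 addr0.
  pose g : F := fun x => f x + (-1) * T n x.
  have Hg : Defs.eigenspace H lambda g by apply: eigenspaceD => //; apply: eigenspaceZ; exact: HT.
  have gE : g = (fun x => f x - T n x) by apply/funext => x; rewrite /g mulN1r.
  have LT := eigenspace_L2 (HT n (leqnn n)).
  have Ng : N2 g != 0.
    (* Were the remainder zero, f would be a combination of the e_i with the real coefficients c_i,
       against its choice. *)
    apply/eqP => /(N2_eq0 (eigenspace_L2 Hg)) g0; apply: fc.
    exists (fun i => (c i)%:C%C); apply: filterS g0 => x h _.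
    by have := h Logic.I; rewrite gE => /eqP; rewrite subr_eq0 => /eqP.
  exists (fun x => ((N2 g)^-1)%:C%C * g x).
    split; first exact: eigenspaceZ.
    by rewrite (N2Z _ (eigenspace_L2 Hg)) sqc_real sqrtr_sqr ger0_norm ?invr_ge0 ?N2_ge0// mulVf.
  move=> i ni; rewrite (ripZr _ (eigenspace_L2 Hg) (Le i ni)).
  have -> : rip (e i) g = 0 by rewrite gE (ripBr Lf LT (Le i ni)) rT// ni /c subrr.
  by rewrite mulr0.
have [e Pe oe] := ortho_sequence ext.
apply: (no_sequence (e := e) (l := fun=> l) (delta := `|l|) (Lam := `|l|)) => //.
- by rewrite normr_gt0.
- by move=> n; have [+ _] := Pe n; rewrite lE.
- by move=> n; have [] := Pe n.
- by move=> n; rewrite lexx.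
Qed.

Let normE (z : R[i]) : `|z| = (normc z)%:C%C. Proof. by []. Qed.

Let normc_triangle (x y : R[i]) : normc (x + y) <= normc x + normc y.
Proof. by rewrite -lecR rmorphD/= -!normE ler_normD. Qed.

Let normc_sym (x y : R[i]) : normc (x - y) = normc (y - x).
Proof. by apply: (fmorph_inj (real_complex R)); rewrite /= -!normE distrC. Qed.

Let normc_real (x : R) : normc x%:C%C = `|x|.
Proof. by rewrite /= expr0n addr0 sqrtr_sqr. Qed.

Let normc_gt0 (x : R[i]) : x != 0 -> 0 < normc x.
Proof. by rewrite -normr_gt0 normE -ltcR. Qed.

(** Eigenfunctions of distinct eigenvalues are orthogonal, so it is enough to choose eigenvalues one
    at a time, each new and in a fixed window around |lambda|. Requiring them to differ from lambda
    leaves room to come closer at the next stage. *)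
Lemma limit_point_of_no_sequence (Specp : set (R[i])^o) :
  Specp = point_spectrum H -> limit_point Specp `<=` [set 0].
Proof.
move=> SE lambda lim; apply: contrapT => /eqP lam0.
have nl0 := normc_gt0 lam0.
pose P f := exists l : R, [/\ Defs.eigenspace H l%:C%C f, N2 f = 1,
  normc lambda / 2 <= `|l| <= 2 * normc lambda & l%:C%C != lambda].
have ext n (e : nat -> F) : (forall i, (i < n)%N -> P (e i)) ->
    (forall i j, (i < j < n)%N -> rip (e i) (e j) = 0) ->
    exists2 f, P f & forall i, (i < n)%N -> rip (e i) f = 0.
  move=> Pe _.
  have [l lP] : exists l : nat -> R, forall i, (i < n)%N ->
      Defs.eigenspace H (l i)%:C%C (e i) /\ (l i)%:C%C != lambda.
    suff /choice[l lP] : forall i, exists l : R, (i < n)%N ->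
      Defs.eigenspace H l%:C%C (e i) /\ l%:C%C != lambda by exists l.
    move=> i.
    have [ni|ni] := boolP (i < n)%N; last by exists 0.
    by have [l [? _ _ ?]] := Pe i ni; exists l.
  (* A positive lower bound for the distances from lambda to the eigenvalues already chosen. *)
  have [r r0 rP] : exists2 r : R, 0 < r & forall i, (i < n)%N -> r <= normc ((l i)%:C%C - lambda).
    have lne i : (i < n)%N -> 0 < normc ((l i)%:C%C - lambda).
      by move=> /lP[_ h]; rewrite normc_gt0// subr_eq0.
    elim: n lne {Pe lP} => [_|n IH lne]; first by exists 1.
    have [r r0 rP] := IH (fun i ni => lne i (ltnW ni)).
    exists (Num.min r (normc ((l n)%:C%C - lambda))); first by rewrite lt_min r0 lne.
    move=> i; rewrite ltnS leq_eqVlt => /orP[/eqP->|/rP ri]; first by rewrite ge_min lexx orbT.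
    by rewrite ge_min ri.
  (* Below r the next eigenvalue is nearer to lambda than all earlier ones, hence distinct from
     them; below |lambda| / 2 its modulus lies between |lambda| / 2 and 2 |lambda|. *)
  pose r' : R := Num.min r (normc lambda / 2).
  have r'0 : 0 < r' by rewrite lt_min r0 divr_gt0.
  have [|y [yl Sy Uy]] := lim (ball (lambda : (R[i])^o) r'%:C%C).
    by apply: nbhsx_ballx; rewrite ltcR.
  have {}Uy : normc (lambda - y) < r' by rewrite -ltcR.
  move: Sy; rewrite SE => /point_spectrum_normalized[ly yE [f Hf f1]].
  have /andP[yr yh] : (normc (lambda - y) < r) && (normc (lambda - y) < normc lambda / 2).
    by rewrite -lt_min.
  have h1 := normc_triangle (lambda - y) y; rewrite subrK in h1.
  have h2 := normc_triangle (y - lambda) lambda; rewrite subrK normc_sym in h2.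
  have ny : normc y = `|ly| by rewrite yE normc_real.
  exists f.
    exists ly; split => //; last by rewrite -yE.
    by rewrite ny in h1 h2; apply/andP; split; lra.
  move=> i ni; apply: (eigenspace_orthogonal (lP i ni).1 Hf).
  apply/eqP => lly; have := rP i ni; rewrite lly -yE normc_sym.
  by rewrite leNgt yr.
have [e Pe oe] := ortho_sequence ext.
have [l lP] := choice Pe.
apply: (no_sequence (e := e) (l := l) (delta := normc lambda / 2) (Lam := 2 * normc lambda)) => //.
- by rewrite divr_gt0.
- by move=> n; have [] := lP n.
- by move=> n; have [] := lP n.
- by move=> n; have [] := lP n.
Qed.

End discreteness.

Unset Implicit Arguments.
Set Strict Implicit.
Set Printing Implicit Defensive.

Theorem theorem3p4 (R : realType) (d : nat) (hd : (0 < d)%N)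
    (Psi : R -> R) (V : Rd R d -> R)
    (mPsi : measurable_fun (`[0, +oo[ : set R) Psi) (mV : measurable_fun setT V)
    (H1_derivable : forall u : R, 0 < u -> derivable Psi u 1)
    (H1_continuous : forall u : R, 0 < u -> {for u, continuous (derive1 Psi)})
    (H1_ge0 : forall u : R, 0 <= u -> 0 <= Psi u)
    (H1_deriv_ge0 : forall u : R, 0 < u -> 0 <= derive1 Psi u)
    (H1_right_lim : Psi u @[u --> 0^'+] --> 0)
    (H1_at0 : Psi 0 = 0)
    (H2 : exists c1 d1 : R, [/\ 0 <= c1, 0 <= d1 &
       forall u : R, 0 <= u -> Num.sqrt u <= c1 * Psi u + d1])
    (H3 : exists c2 d2 : R, [/\ 0 <= c2, 0 <= d2 &
       forall u : R, 0 <= u -> u * derive1 Psi u <= c2 * Psi u + d2])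
    (H4 : exists2 mu : R, 0 < mu &
       forall u : R, 0 <= u -> mu * Psi u <= 2 * (u * derive1 Psi u))
    (H5 : relatively_compact
       (multiplication (fun x => japanese_bracket x * V x))
       (free_hamiltonian Psi)) :
  let Specp : set (R[i])^o := point_spectrum (hamiltonian Psi V) in
  [/\ Specp `\ 0 `<=` isolated (Specp `\ 0),
      forall lambda : R[i], (Specp `\ 0) lambda ->
        finite_multiplicity (hamiltonian Psi V) lambda &
      limit_point Specp `<=` [set 0]].
Proof.
move=> Specp.
have noseq := @no_orthonormal_eigensequence R d Psi V mPsi mV H1_derivable H1_ge0
  H1_deriv_ge0 H1_at0 H2 H3 H4 H5.
have lim : limit_point Specp `<=` [set 0].
  exact: (limit_point_of_no_sequence noseq (erefl Specp)).
split => //.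
- move=> lambda [Sl l0]; split; first by rewrite inE.
  (* A nonzero eigenvalue is no limit point, so some neighborhood of it contains no other
     eigenvalue. *)
  have : ~ limit_point Specp lambda by move=> /lim.
  move=> /existsNP[U] /not_implyP[nU hU]; exists U => //.
  apply/seteqP; split => [y [Uy [Sy _]]|_ ->] /=.
    by apply: contrapT => /eqP yl; apply: hU; exists y.
  by split => //; exact: nbhs_singleton nU.
- move=> lambda [Sl /eqP l0].
  exact: (finite_multiplicity_of_no_sequence noseq).
Qed.
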